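(* Let $M=M^n$ be a Wintgen ideal submanifold of dimension $n\ge 4$ and codimension $m\ge 1$ in a real space form $\mathbb{R}^{n+m}(\widetilde{k})$. Then the tensors $R\cdot C-C\cdot R$ and $Q(g,C)$ are linearly dependent if and only if $M$ is totally umbilical in $\mathbb{R}^{n+m}(\widetilde{k})$. In this case, $M$ is conformally flat.
   Context: Manifolds are connected, Riemannian and of class $C^\infty$. $\mathbb{R}^{n+m}(\widetilde{k})$ is a real space form: a Riemannian manifold of dimension $n+m$ and constant curvature $\widetilde{k}$, with metric $\widetilde{g}$. The submanifold $M$ carries the induced metric $g$ with Levi-Civita connection $\nabla$; $h$ is its second fundamental form and the shape operator $A_\xi$ for a normal field $\xi$ is given by $g(A_\xi X,Y)=\widetilde{g}(\xi,h(X,Y))$. $\{E_i\}_{i=1}^n$ is any local orthonormal tangent frame and $\{\xi_\alpha\}_{\alpha=1}^m$ any local orthonormal normal frame; $A_\alpha=A_{\xi_\alpha}$. The mean curvature vector is $\vec{H}=\frac1n\sum_i h(E_i,E_i)$ and $H=\|\vec{H}\|$. $M$ is totally umbilical if $h(X,Y)=g(X,Y)\vec{H}$. For a symmetric $(0,2)$-tensor $A$: $(X\wedge_A Y)Z=A(Y,Z)X-A(X,Z)Y$. $\mathcal{R}(X,Y)Z=\nabla_X\nabla_YZ-\nabla_Y\nabla_XZ-\nabla_{[X,Y]}Z$, $R(X,Y,Z,W)=g(\mathcal{R}(X,Y)Z,W)$, $\mathrm{Ricc}(X,Y)=\mathrm{tr}\{Z\mapsto\mathcal{R}(Z,X)Y\}$,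 $g(\mathcal{S}X,Y)=\mathrm{Ricc}(X,Y)$, $\kappa=\mathrm{tr}\,\mathcal{S}$, and the Weyl tensor is $C(X,Y,Z,W)=g(\mathcal{C}(X,Y)Z,W)$ with $\mathcal{C}(X,Y)=\mathcal{R}(X,Y)-\frac1{n-2}\left(X\wedge_g\mathcal{S}Y+\mathcal{S}X\wedge_gY-\frac{\kappa}{n-1}X\wedge_gY\right)$. For a skew family of endomorphisms $\mathcal{B}(X,Y)$ and a $(0,k)$-tensor $T$ put $(\mathcal{B}(X,Y)\cdot T)(X_1,\dots,X_k)=-\sum_{j=1}^k T(X_1,\dots,\mathcal{B}(X,Y)X_j,\dots,X_k)$. The $(0,k+2)$-tensors $R\cdot T$, $C\cdot T$, $Q(A,T)$ are defined by $(X_1,\dots,X_k;X,Y)\mapsto(\mathcal{B}(X,Y)\cdot T)(X_1,\dots,X_k)$ with $\mathcal{B}(X,Y)=\mathcal{R}(X,Y)$, $\mathcal{C}(X,Y)$, $X\wedge_AY$ respectively. Two tensors $T_1,T_2$ are called linearly dependent (on $M$) if they are linearly dependent at every point of $M$; on the set where $T_2\neq0$ this means $T_1=L\,T_2$ for some function $L$. Normalized scalar curvature: $\rho=\frac{2}{n(n-1)}\sum_{i<j}R(E_i,E_j,E_j,E_i)$. Normal curvature: $R^\perp(X,Y;\xi,\eta)=g([A_\xi,A_\eta]X,Y)$, and $\rho^\perp=\frac{2}{n(n-1)}\sqrt{\sum_{i<j}\sum_{\alpha<\beta}R^\perp(E_i,E_j;\xi_\alpha,\xi_\beta)^2}$.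 $M$ is a Wintgen ideal submanifold if $\rho=H^2-\rho^\perp+\widetilde{k}$ everywhere on $M$ (equality in the Wintgen inequality $\rho\le H^2-\rho^\perp+\widetilde{k}$). *)

(* Defs.v *)
From HB Require Import structures.
From mathcomp Require Import all_boot all_order all_algebra.
From mathcomp Require Import all_classical all_reals all_analysis.

Set Implicit Arguments.
Unset Strict Implicit.
Unset Printing Implicit Defensive.

Import Order.TTheory GRing.Theory Num.Theory.
Import numFieldNormedType.Exports.

Local Open Scope classical_set_scope.
Local Open Scope ring_scope.

(* Conventions.  Tangent vectors at a point are row vectors: their components in
   a given chart.  A tensor field is given by its components in every chart, as
   a function on 'rV_n of which only the values on the image of the chart
   matter.  Linear maps act on row vectors from the right. *)

Section Smooth.
Variables (R : realType) (V W : normedModType R).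

(* 'D_(v1) ('D_(v2) (... ('D_(vk) F))) *)
Definition iter_derive (s : seq V) (F : V -> W) : V -> W :=
  foldr (fun v G x => 'D_v G x) F s.

(* All iterated directional derivatives exist and are Frechet differentiable
   (hence continuous): F is of class C^infinity on the open set U. *)
Definition smooth_on (U : set V) (F : V -> W) : Prop :=
  forall (s : seq V) (x : V), U x -> differentiable (iter_derive s F) x.

End Smooth.

Definition bform (R : realType) (n : nat) (G : 'M[R]_n) (u v : 'rV[R]_n) : R :=
  (u *m G *m v^T) ord0 ord0.

(* The inverse charts are total functions, meaningful on the chart images. *)
Record manifold (R : realType) (n : nat) := Manifold {
  mcarrier :> topologicalType;
  mindex : Type;
  mdom : mindex -> set mcarrier;
  mchart : mindex -> mcarrier -> 'rV[R]_n;
  minv : mindex -> 'rV[R]_n -> mcarrier;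
  m_hausdorff : hausdorff_space mcarrier;
  m_second_countable : @second_countable mcarrier;
  m_connected : connected [set: mcarrier];
  m_cover : forall p : mcarrier, exists i, mdom i p;
  m_open_dom : forall i, open (mdom i);
  m_open_img : forall i, open (mchart i @` mdom i);
  m_chartK : forall i p, mdom i p -> minv i (mchart i p) = p;
  m_chart_continuous : forall i p, mdom i p -> {for p, continuous (mchart i)};
  m_inv_continuous : forall i x, (mchart i @` mdom i) x ->
    {for x, continuous (minv i)};
  m_transition : forall i j,
    smooth_on (mchart i @` (mdom i `&` mdom j)) (mchart j \o minv i)
}.

Record riemannian_manifold (R : realType) (n : nat) := RiemannianManifold {
  rmanifold :> manifold R n;
  metric : mindex rmanifold -> 'rV[R]_n -> 'M[R]_n;
  metric_smooth : forall i, smooth_on (mchart i @` mdom i) (metric i);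
  metric_sym : forall i x, (mchart i @` mdom i) x -> (metric i x)^T = metric i x;
  metric_pos : forall i x, (mchart i @` mdom i) x ->
    forall v, v != 0 -> 0 < bform (metric i x) v v;
  metric_transition : forall i j x,
    (mchart i @` (mdom i `&` mdom j)) x ->
    forall u v, bform (metric i x) u v =
      bform (metric j ((mchart j \o minv i) x))
        ('D_u (mchart j \o minv i) x) ('D_v (mchart j \o minv i) x)
}.

Section Curvature.
Variables (R : realType) (n : nat) (G : 'rV[R]_n -> 'M[R]_n).
Local Notation V := ('rV[R]_n).
Local Notation e_ i := (delta_mx ord0 i : V).

(* Gamma(u, v) = u^i v^j Gamma^k_ij e_k, i.e. by Koszul's formula
   2 g(Gamma(u, v), w) = u(g(v, w)) + v(g(u, w)) - w(g(u, v)), the vectors u, v, w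
   being extended to fields with constant components. *)
Definition christoffel (x u v : V) : V :=
  2^-1 *: (\row_l ('D_u (fun y => bform (G y) v (e_ l)) x
                   + 'D_v (fun y => bform (G y) u (e_ l)) x
                   - 'D_(e_ l) (fun y => bform (G y) u v) x)) *m invmx (G x).

Definition nabla (X Y : V -> V) : V -> V :=
  fun x => 'D_(X x) Y x + christoffel x (X x) (Y x).

Definition lie_bracket (X Y : V -> V) : V -> V :=
  fun x => 'D_(X x) Y x - 'D_(Y x) X x.

Definition curvature_op (X Y Z : V -> V) : V -> V :=
  fun x => nabla X (nabla Y Z) x - nabla Y (nabla X Z) x
           - nabla (lie_bracket X Y) Z x.

(* By tensoriality the value at x depends only on X x, Y x, Z x; tangent vectors
   are extended to fields with constant components. *)
Definition Rop (x u v w : V) : V := curvature_op (cst u) (cst v) (cst w) x.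

Definition Rtensor (x u v w z : V) : R := bform (G x) (Rop x u v w) z.

Definition ricci (x u v : V) : R := \tr (lin1_mx (fun z => Rop x z u v)).

(* Matrix of S, acting on row vectors: g(u *m S, v) = Ricc(u, v). *)
Definition ricci_mx (x : V) : 'M[R]_n :=
  (\matrix_(i, j) ricci x (e_ i) (e_ j)) *m invmx (G x).

Definition kappa (x : V) : R := \tr (ricci_mx x).

(* (X wedge_A Y) Z, for a symmetric (0,2)-tensor with matrix A *)
Definition wedge_op (A : 'M[R]_n) (u v w : V) : V :=
  bform A v w *: u - bform A u w *: v.

Definition Cop (x u v w : V) : V :=
  Rop x u v w - (n%:R - 2)^-1 *:
    (wedge_op (G x) u (v *m ricci_mx x) w + wedge_op (G x) (u *m ricci_mx x) v w
     - (kappa x / (n%:R - 1)) *: wedge_op (G x) u v w).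

Definition Ctensor (x u v w z : V) : R := bform (G x) (Cop x u v w) z.

(* Meaningful for linearly independent u, v only. *)
Definition sectional (x u v : V) : R :=
  Rtensor x u v v u /
    (bform (G x) u u * bform (G x) v v - bform (G x) u v ^+ 2).

End Curvature.

Section Derivation.
Variables (R : realType) (n : nat).
Local Notation V := ('rV[R]_n).
Local Notation tensor4 := (V -> V -> V -> V -> R).
Local Notation tensor6 := (V -> V -> V -> V -> V -> V -> R).

(* (X1, X2, X3, X4; X, Y) |-> (B(X, Y) . T)(X1, X2, X3, X4) *)
Definition derivation (B : V -> V -> V -> V) (T : tensor4) : tensor6 :=
  fun x1 x2 x3 x4 x y =>
    - (T (B x y x1) x2 x3 x4 + T x1 (B x y x2) x3 x4
       + T x1 x2 (B x y x3) x4 + T x1 x2 x3 (B x y x4)).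

Definition Qtensor (A : 'M[R]_n) (T : tensor4) : tensor6 :=
  derivation (wedge_op A) T.

Definition lin_dep (T1 T2 : tensor6) : Prop :=
  exists a b : R, (a, b) <> (0, 0) /\
    forall x1 x2 x3 x4 x y, a * T1 x1 x2 x3 x4 x y + b * T2 x1 x2 x3 x4 x y = 0.

End Derivation.

Section Intrinsic.
Variables (R : realType) (n : nat) (M : riemannian_manifold R n).

Definition constant_curvature (k : R) : Prop :=
  forall (i : mindex M) (p : M), mdom i p ->
  forall u v : 'rV[R]_n, row_free (col_mx u v) ->
    sectional (metric (r := M) i) (mchart i p) u v = k.

Definition RC_CR_QgC_dependent : Prop :=
  forall (i : mindex M) (p : M), mdom i p ->
  let g := metric (r := M) i in
  let x := mchart i p in
  lin_dep
    (fun x1 x2 x3 x4 u v =>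
       derivation (Rop g x) (Ctensor g x) x1 x2 x3 x4 u v
       - derivation (Cop g x) (Rtensor g x) x1 x2 x3 x4 u v)
    (Qtensor (g x) (Ctensor g x)).

(* Around every point there is a smooth function phi such that the metric
   e^(2 phi) g is flat. *)
Definition conformally_flat : Prop :=
  forall (i : mindex M) (p : M), mdom i p ->
  exists (U : set 'rV[R]_n) (phi : 'rV[R]_n -> R^o),
    [/\ open U, U (mchart i p), U `<=` mchart i @` mdom i, smooth_on U phi &
      forall x u v w, U x ->
        Rop (fun y => expR (2 * phi y) *: metric (r := M) i y) x u v w = 0].

End Intrinsic.

Section Submanifold.
Variables (R : realType) (n m : nat).
Variables (M : riemannian_manifold R n) (N : riemannian_manifold R (n + m)).
Variable f : M -> N.
Local Notation V := ('rV[R]_n).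
Local Notation W := ('rV[R]_(n + m)).

Definition coord_map (i : mindex M) (a : mindex N) : V -> W :=
  mchart a \o f \o minv i.

(* M is a submanifold of N by means of f, with metric induced by that of N.
   As the metric of M is definite, f is automatically an immersion. *)
Definition isometric_immersion : Prop :=
  [/\ continuous f,
      forall i a, smooth_on (mchart i @` (mdom i `&` f @^-1` mdom a))
                            (coord_map i a) &
      forall i a x, (mchart i @` (mdom i `&` f @^-1` mdom a)) x ->
        forall u v : V, bform (metric i x) u v =
          bform (metric a (coord_map i a x))
            ('D_u (coord_map i a) x) ('D_v (coord_map i a) x)].

(* i : chart of M, a : chart of N, x : coordinates of a point of M *)
Section InCharts.
Variables (i : mindex M) (a : mindex N) (x : V).
Local Notation F := (coord_map i a).
Local Notation g := (metric i x).
Local Notation gt := (metric a (F x)).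

(* Formula of Gauss: h(X, Y) is the covariant derivative in N of the image of Y
   along X, minus the image of nabla_X Y; here X, Y have constant components. *)
Definition second_form (u v : V) : W :=
  'D_u (fun y => 'D_v F y) x
  + christoffel (metric a) (F x) ('D_u F x) ('D_v F x)
  - 'D_(nabla (metric i) (cst u) (cst v) x) F x.

(* Matrix of A_xi, acting on row vectors: g(u *m A_xi, v) = gt(xi, h(u, v)). *)
Definition shape (xi : W) : 'M[R]_n :=
  (\matrix_(j, l) bform gt xi
     (second_form (delta_mx ord0 j) (delta_mx ord0 l))) *m invmx g.

(* g([A_xi, A_eta] u, v) *)
Definition Rperp (u v : V) (xi eta : W) : R :=
  bform g (u *m shape eta *m shape xi - u *m shape xi *m shape eta) v.

Definition tangent_frame (E : 'I_n -> V) : Prop :=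
  forall j l, bform g (E j) (E l) = (j == l)%:R.

Definition normal_frame (xi : 'I_m -> W) : Prop :=
  (forall al u, bform gt (xi al) ('D_u F x) = 0) /\
  (forall al be, bform gt (xi al) (xi be) = (al == be)%:R).

Definition mean_vector (E : 'I_n -> V) : W :=
  n%:R^-1 *: \sum_j second_form (E j) (E j).

Definition mean_curvature (E : 'I_n -> V) : R :=
  Num.sqrt (bform gt (mean_vector E) (mean_vector E)).

Definition rho (E : 'I_n -> V) : R :=
  2 / (n%:R * (n%:R - 1)) *
  \sum_(j < n) \sum_(l < n | (j < l)%N)
    Rtensor (metric i) x (E j) (E l) (E l) (E j).

Definition rho_perp (E : 'I_n -> V) (xi : 'I_m -> W) : R :=
  2 / (n%:R * (n%:R - 1)) *
  Num.sqrt (\sum_(j < n) \sum_(l < n | (j < l)%N)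
            \sum_(al < m) \sum_(be < m | (al < be)%N)
              Rperp (E j) (E l) (xi al) (xi be) ^+ 2).

End InCharts.

(* These quantities do not depend on the orthonormal frames. *)
Definition wintgen_ideal (k : R) : Prop :=
  forall (i : mindex M) (a : mindex N) (p : M), mdom i p -> mdom a (f p) ->
  let x := mchart i p in
  forall E xi, tangent_frame i x E -> normal_frame i a x xi ->
    rho i x E = mean_curvature i a x E ^+ 2 - rho_perp i a x E xi + k.

Definition totally_umbilical : Prop :=
  forall (i : mindex M) (a : mindex N) (p : M), mdom i p -> mdom a (f p) ->
  let x := mchart i p in
  forall E, tangent_frame i x E ->
  forall u v : V,
    second_form i a x u v = bform (metric i x) u v *: mean_vector i a x E.

End Submanifold.

(* Main.v *)
(* In an orthonormal frame, equality in the Wintgen inequality says that the traceless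
   parts B_al of the shape operators give equality in the DDVV inequality
   sum |[B_al, B_be]|^2 <= (sum |B_al|^2)^2.  Diagonalising the Gram matrix of the B_al
   and then one normalised B_al at a time, equality forces, after rotation of both frames,
   B_al = 0, or B_1 = mu (E_11 - E_22), B_2 = +-mu (E_12 + E_21) and no other.  In the
   second case the Gauss equation gives the curvature explicitly, its Weyl part is that
   of the plane 12 and is not zero, and five components of a (R.C - C.R) + b Q(g, C)
   force a = b = 0.  If M is umbilical, the Gauss equation makes R a multiple of g /\ g at
   each point, so C = 0; the multiple c is constant by Schur's lemma, and (chi + 1/2)^-2 g
   is flat for a suitable local solution of Hess chi = - c chi g, which exists by
   Frobenius' theorem. *)
From HB Require Import structures.
Require Import Defs.
From mathcomp Require Import all_boot all_order all_algebra.
From mathcomp Require Import all_classical all_reals all_analysis.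
From mathcomp Require Import ring lra.

Set Implicit Arguments.
Unset Strict Implicit.
Unset Printing Implicit Defensive.

Import Order.TTheory GRing.Theory Num.Theory.
Import numFieldNormedType.Exports.

Local Open Scope classical_set_scope.
Local Open Scope ring_scope.

(** * Calculus *)

(** The obstacle in the equality discussion is that the number of nonzero B_al is not known
    beforehand, so many commutators compete at once. For a normalised C_al and orthonormal C_be, the
    sum over be of |[C_al, C_be]|^2 - 1 is at most 1, because the pairs of eigenvalues of C_al with
    (a_i - a_j)^2 > 1 form a star. Weighted by the squared norms of the B_al, these row bounds turn
    the DDVV defect into a sum of nonnegative terms, each of which vanishes in case of equality. The
    star could still have several leaves; the vanishing of tr C_al^3, read in an eigenbasis of
    another C_be, leaves only one. The bound n >= 4 makes the factor n - 3 of the Weyl components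
    nonzero and provides two frame vectors off the plane 12. On a sphere, (chi + 1/2)^-2 is the
    factor of stereographic projection. The first integral |grad chi|^2 + c chi^2 = c/4 is what
    makes it work for every sign of c. Frobenius' theorem is proved by solving along rays from one
    point; flatness serves to differentiate the result across the rays. *)

Section Calculus.
Variables (R : realType).

Lemma derive_linear_dir (V W : normedModType R) (f : V -> W) x a u v :
  differentiable f x -> 'D_(a *: u + v) f x = a *: 'D_u f x + 'D_v f x.
Proof. by move=> df; rewrite !deriveE// linearP. Qed.

Lemma derive_sum_dir (V W : normedModType R) (f : V -> W) x I (r : seq I)
    (P : pred I) (a : I -> R) (v : I -> V) :
  differentiable f x ->
  'D_(\sum_(i <- r | P i) a i *: v i) f x = \sum_(i <- r | P i) a i *: 'D_(v i) f x.
Proof.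
move=> df; rewrite !deriveE// linear_sum; apply: eq_bigr => i _.
by rewrite linearZ deriveE.
Qed.

Lemma derivD (V W : normedModType R) (f g : V -> W) x v :
  differentiable f x -> differentiable g x ->
  'D_v (fun y => f y + g y) x = 'D_v f x + 'D_v g x.
Proof. by move=> df dg; apply: deriveD; apply: diff_derivable. Qed.

Lemma derivN (V W : normedModType R) (f : V -> W) x v :
  differentiable f x -> 'D_v (fun y => - f y) x = - 'D_v f x.
Proof. by move=> df; apply: deriveN; apply: diff_derivable. Qed.

Lemma derivB (V W : normedModType R) (f g : V -> W) x v :
  differentiable f x -> differentiable g x ->
  'D_v (fun y => f y - g y) x = 'D_v f x - 'D_v g x.
Proof. by move=> df dg; apply: deriveB; apply: diff_derivable. Qed.

Lemma derivZ (V W : normedModType R) (f : V -> W) c x v :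
  differentiable f x -> 'D_v (fun y => c *: f y) x = c *: 'D_v f x.
Proof. by move=> df; apply: deriveZ; apply: diff_derivable. Qed.

Lemma derive_comp (U V W : normedModType R) (f : U -> V) (g : V -> W) x v :
  differentiable f x -> differentiable g (f x) ->
  'D_v (fun y => g (f y)) x = 'D_('D_v f x) g (f x).
Proof.
move=> df dg; have dfg := differentiable_comp df dg.
by rewrite (deriveE _ dfg) (deriveE _ dg) (deriveE _ df) diff_comp.
Qed.

Lemma diff_compose (U V W : normedModType R) (f : U -> V) (g : V -> W) x :
  differentiable f x -> differentiable g (f x) -> differentiable (fun y => g (f y)) x.
Proof. exact: differentiable_comp. Qed.

Lemma deriv_cst (V W : normedModType R) (a : W) (x v : V) : 'D_v (fun=> a) x = 0.
Proof. exact: derive_cst. Qed.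

Lemma diff_cst' (V W : normedModType R) (a : W) (x : V) : differentiable (fun=> a) x.
Proof. exact: differentiable_cst. Qed.

Lemma diff_sum (V W : normedModType R) I (r : seq I) (P : pred I) (f : I -> V -> W) x :
  (forall i, differentiable (f i) x) ->
  differentiable (fun y => \sum_(i <- r | P i) f i y) x.
Proof.
move=> df; elim: r => [|i r IH].
  by under eq_fun do rewrite big_nil; exact: diff_cst'.
under eq_fun do rewrite big_cons; case: (P i) => //.
exact: (@differentiableD _ _ _ (f i)).
Qed.

Lemma deriv_sum (V W : normedModType R) I (r : seq I) (P : pred I) (f : I -> V -> W) x v :
  (forall i, differentiable (f i) x) ->
  'D_v (fun y => \sum_(i <- r | P i) f i y) x = \sum_(i <- r | P i) 'D_v (f i) x.
Proof.
move=> df; elim: r => [|i r IH].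
  by under eq_fun do rewrite big_nil; rewrite big_nil deriv_cst.
under eq_fun do rewrite big_cons; rewrite big_cons; case: (P i) => //.
by rewrite derivD// ?IH//; exact: diff_sum.
Qed.

Section Bilinear.
Variables (U V W T : normedModType R) (b : {bilinear U -> V -> W}).
Hypothesis bc : continuous (fun p : U * V => b p.1 p.2).

Lemma diff_bil (f : T -> U) (g : T -> V) x :
  differentiable f x -> differentiable g x ->
  differentiable (fun y => b (f y) (g y)) x.
Proof.
move=> df dg; apply: (@differentiable_comp _ _ _ _ (fun y => (f y, g y)) (fun p : U * V => b p.1 p.2)).
  exact: differentiable_pair.
exact: differentiable_bilin.
Qed.

Lemma deriv_bil (f : T -> U) (g : T -> V) x v :
  differentiable f x -> differentiable g x ->
  'D_v (fun y => b (f y) (g y)) x = b ('D_v f x) (g x) + b (f x) ('D_v g x).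
Proof.
move=> df dg; have dp : differentiable (fun y => (f y, g y)) x by exact: differentiable_pair.
have db := differentiable_bilin (f x, g x) bc.
rewrite deriveE; last exact: diff_bil.
rewrite (_ : (fun y => b (f y) (g y)) = (fun p : U * V => b p.1 p.2) \o (fun y => (f y, g y)))//.
rewrite diff_comp// /= diff_bilin// diff_pair//= !deriveE// addrC//.
Qed.

End Bilinear.
End Calculus.

Section Approximation.
Variables (R : realType) (V W : normedModType R).

(** The estimate is the little-o expansion of F at x, and uniqueness of the differential identifies
    it with L. It serves for functions without a closed formula, such as the solution built in
    [frobenius]. *)
Lemma differentiable_approx (F : V -> W) (L : {linear V -> W}) x :
  continuous L ->
  (forall e, 0 < e -> \forall y \near x, `|F y - F x - L (y - x)| <= e * `|y - x|) ->
  differentiable F x /\ forall v, 'D_v F x = L v.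
Proof.
move=> Lc FL; have H : F \o shift x = cst (F x) + L +o_ (0 : V) id.
  apply/eqaddoP => e e0; apply/nbhs_ballP; have /nbhs_ballP[d d0 dH] := FL e e0; exists d => // y; rewrite -ball_normE/= sub0r normrN => yd.
  have := dH (y + x); rewrite -ball_normE /= opprD addrCA subrr addr0 normrN => /(_ yd).
  by rewrite !fctE /= addrK opprD addrA.
have dE := diff_unique Lc H.
have dF : differentiable F x by apply/diff_locallyP; rewrite dE.
by split=> // v; rewrite deriveE// dE.
Qed.

(** The difference of G and F vanishes near x, so [differentiable_approx] applies to it with the
    zero map. *)
Lemma near_differentiable (F G : V -> W) x :
  (\near x, F x = G x) -> differentiable F x -> differentiable G x.
Proof.
move=> FG dF.
have [] // := @differentiable_approx (G \- F) \0 x.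
- by move=> ?; exact: cvg_cst.
- move=> e e0; near=> y.
  have /= -> : F y = G y by near: y.
  have -> /= : F x = G x by exact: nbhs_singleton FG.
  by rewrite !subrr normr0 mulr_ge0// ltW.
move=> dGF _; have := differentiableD dGF dF.
by rewrite (_ : _ + _ = G)//; apply/funext => y; rewrite !fctE /= subrK.
Unshelve. all: by end_near. Qed.

End Approximation.

Section Matrices.
Variables (R : realType) (V : normedModType R) (m n p : nat).

(** In finite dimension a linear map is a fixed combination of the coordinate functions, which are
    differentiable. *)
Lemma continuous_linear_coord (L : {linear 'M[R]_(m, n) -> V}) : continuous L.
Proof.
rewrite (_ : (L : _ -> _) = fun A => \sum_(i < m) \sum_(j < n) A i j *: L (delta_mx i j)).
  move=> A; apply: differentiable_continuous.
  apply: diff_sum => i; apply: diff_sum => j.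
  by apply: differentiableZl; exact: differentiable_coord.
apply/funext => A; rewrite {1}(matrix_sum_delta A) linear_sum.
apply: eq_bigr => i _; rewrite linear_sum.
by apply: eq_bigr => j _; rewrite linearZ.
Qed.

Lemma differentiable_mxP (F : V -> 'M[R]_(m, n)) x :
  differentiable F x <-> forall i j, differentiable (fun y => F y i j) x.
Proof.
split=> [dF i j|dF].
  exact: (@differentiable_comp _ _ _ _ F (fun A => A i j) x dF (differentiable_coord _ _ _)).
rewrite (_ : F = fun y => \sum_i \sum_j F y i j *: delta_mx i j); last first.
  by apply/funext => y; exact: matrix_sum_delta.
apply: diff_sum => i; apply: diff_sum => j.
by apply: differentiableZl; exact: dF.
Qed.

Lemma deriv_coord (F : V -> 'M[R]_(m, n)) x v i j :
  differentiable F x -> 'D_v (fun y => F y i j) x = ('D_v F x) i j.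
Proof. by move=> dF; rewrite derive_mx ?mxE//; exact: diff_derivable. Qed.

End Matrices.

Lemma mulmx_continuous (R : realType) (m n p : nat) :
  continuous (fun q : 'M[R]_(m, n) * 'M[R]_(n, p) => q.1 *m q.2).
Proof.
have dfst q : differentiable (fst : 'M[R]_(m, n) * 'M[R]_(n, p) -> _) q.
  by apply: (@linear_differentiable _ _ _ fst); move=> r; exact: (@cvg_fst _ _ (nbhs r.1) (nbhs r.2)).
have dsnd q : differentiable (snd : 'M[R]_(m, n) * 'M[R]_(n, p) -> _) q.
  by apply: (@linear_differentiable _ _ _ snd); move=> r; exact: (@cvg_snd _ _ (nbhs r.1) (nbhs r.2)).
move=> q; apply: differentiable_continuous.
apply/differentiable_mxP => i j; under eq_fun do rewrite mxE.
apply: diff_sum => k; apply: differentiableM.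
- by move/differentiable_mxP : (dfst q); exact.
- by move/differentiable_mxP : (dsnd q); exact.
Qed.

Lemma scale_bilinear (R : realType) (W : normedModType R) :
  bilinear_for *:%R *:%R ( *:%R : R -> W -> W).
Proof.
split=> [v a b c|a b v w] /=; first by rewrite scalerDl scalerA.
by rewrite scalerDr !scalerA mulrC.
Qed.

(** Makes scaling by a function a case of the general Leibniz rule for bilinear maps. *)
HB.instance Definition _ (R : realType) (W : normedModType R) :=
  bilinear_isBilinear.Build R R W W _ _ ( *:%R : R -> W -> W) (@scale_bilinear R W).

Section Leibniz.
Variables (R : realType) (V : normedModType R).

Lemma scale_cont (W : normedModType R) : continuous (fun q : R * W => q.1 *: q.2).
Proof. exact: scale_continuous. Qed.

Lemma diff_scale (W : normedModType R) (f : V -> R) (g : V -> W) x :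
  differentiable f x -> differentiable g x -> differentiable (fun y => f y *: g y) x.
Proof. exact/diff_bil/scale_cont. Qed.

Lemma deriv_scale (W : normedModType R) (f : V -> R) (g : V -> W) x v :
  differentiable f x -> differentiable g x ->
  'D_v (fun y => f y *: g y) x = 'D_v f x *: g x + f x *: 'D_v g x.
Proof. exact/deriv_bil/scale_cont. Qed.

Lemma mul_cont : continuous (fun q : R * R => q.1 * q.2).
Proof. exact: mul_continuous. Qed.

Lemma diff_mul (f g : V -> R) x :
  differentiable f x -> differentiable g x -> differentiable (fun y => f y * g y) x.
Proof. exact/diff_bil/mul_cont. Qed.

Lemma deriv_mul (f g : V -> R) x v :
  differentiable f x -> differentiable g x ->
  'D_v (fun y => f y * g y) x = 'D_v f x * g x + f x * 'D_v g x.
Proof. exact/deriv_bil/mul_cont. Qed.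

Variables (m n p : nat).

Lemma diff_mulmx (f : V -> 'M[R]_(m, n)) (g : V -> 'M[R]_(n, p)) x :
  differentiable f x -> differentiable g x -> differentiable (fun y => f y *m g y) x.
Proof. by apply: diff_bil; exact: mulmx_continuous. Qed.

Lemma deriv_mulmx (f : V -> 'M[R]_(m, n)) (g : V -> 'M[R]_(n, p)) x v :
  differentiable f x -> differentiable g x ->
  'D_v (fun y => f y *m g y) x = 'D_v f x *m g x + f x *m 'D_v g x.
Proof. by apply: deriv_bil; exact: mulmx_continuous. Qed.

Lemma diff_lin' (W : normedModType R) (L : {linear 'M[R]_(m, n) -> W}) (f : V -> 'M[R]_(m, n)) x :
  differentiable f x -> differentiable (fun y => L (f y)) x.
Proof.
move=> df; apply: diff_compose => //.
by apply: linear_differentiable; exact: continuous_linear_coord.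
Qed.

Lemma deriv_lin (W : normedModType R) (L : {linear 'M[R]_(m, n) -> W}) (f : V -> 'M[R]_(m, n)) x v :
  differentiable f x -> 'D_v (fun y => L (f y)) x = L ('D_v f x).
Proof.
have cL := @continuous_linear_coord _ _ _ _ L.
move=> df; rewrite derive_comp//; last exact: linear_differentiable.
by rewrite deriveE ?diff_lin//; exact: linear_differentiable.
Qed.

End Leibniz.

(** * Functions of finite differentiability class and their closure properties *)

Section Smoothness.
Variables (R : realType) (V : normedModType R).

(** Finite-order version of [smooth_on]. Closure under products and the like is then an induction on
    k, since the derivative of a product involves both factors and their derivatives at the lower
    order. *)
Definition smoothn (W : normedModType R) k (U : set V) (F : V -> W) :=
  forall s : seq V, (size s <= k)%N -> forall x, U x -> differentiable (iter_derive s F) x.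

Section Generic.
Variable (W : normedModType R).
Implicit Types (U : set V) (F G : V -> W) (k : nat).

Lemma smooth_onP U F : smooth_on U F <-> forall k, smoothn k U F.
Proof.
split=> [sF k s _ x|sF s x]; first exact: sF.
exact: (sF (size s)).
Qed.

Lemma smoothn0 U F : smoothn 0 U F <-> forall x, U x -> differentiable F x.
Proof.
split=> [sF x|sF]; first exact: (sF [::]).
by case=> // _ x Ux; exact: sF.
Qed.

Lemma iter_derive_rcons s v F : iter_derive (rcons s v) F = iter_derive s ('D_v F).
Proof. by rewrite /iter_derive foldr_rcons. Qed.

(** Peels off the innermost derivative, hence the [rcons]: the remaining ones act on ['D_v F], which
    is the form needed for induction. *)
Lemma smoothnS k U F :
  smoothn k.+1 U F <->
  (forall x, U x -> differentiable F x) /\ forall v, smoothn k U ('D_v F).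
Proof.
split=> [sF|[dF sF]].
  split=> [x|v s sk x]; first exact: (sF [::]).
  by rewrite -iter_derive_rcons; apply: sF; rewrite size_rcons.
case/lastP => [_|s v]; first exact: dF.
by rewrite size_rcons ltnS iter_derive_rcons; exact: sF.
Qed.

Lemma smoothn_le k l U F : (l <= k)%N -> smoothn k U F -> smoothn l U F.
Proof. by move=> lk sF s sl; apply: sF; rewrite (leq_trans sl). Qed.

Lemma smoothn_sub k U U' F : U' `<=` U -> smoothn k U F -> smoothn k U' F.
Proof. by move=> UU sF s sk x /UU; exact: sF. Qed.

Lemma smoothn_diff k U F x : smoothn k U F -> U x -> differentiable F x.
Proof. by move=> sF; exact: (sF [::]). Qed.

Lemma smoothn_congr k U F G : open U ->
  (forall x, U x -> F x = G x) -> smoothn k U F -> smoothn k U G.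
Proof.
move=> oU; elim: k F G => [|k IH] F G FG.
  move=> /smoothn0 sF; apply/smoothn0 => x Ux.
  apply: near_differentiable (sF x Ux).
  by apply: filterS FG _; exact: open_nbhs_nbhs.
move=> /smoothnS[dF sF]; apply/smoothnS; split=> [x Ux|v].
  apply: near_differentiable (dF x Ux).
  by apply: filterS FG _; exact: open_nbhs_nbhs.
apply: IH (sF v) => x Ux; apply: near_eq_derive.
by apply: filterS FG _; exact: open_nbhs_nbhs.
Qed.

Lemma smoothn_cst k U (a : W) : smoothn k U (fun=> a).
Proof.
elim: k a => [|k IH] a; first by apply/smoothn0 => x _; exact: diff_cst'.
apply/smoothnS; split=> [x _|v]; first exact: diff_cst'.
rewrite (_ : 'D_v _ = fun=> 0); first exact: IH.
by apply/funext => x; rewrite deriv_cst.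
Qed.

Lemma smoothnD k U F G : open U ->
  smoothn k U F -> smoothn k U G -> smoothn k U (fun y => F y + G y).
Proof.
move=> oU; elim: k F G => [|k IH] F G.
  move=> /smoothn0 sF /smoothn0 sG; apply/smoothn0 => x Ux.
  by apply: differentiableD; [exact: sF|exact: sG].
move=> /smoothnS[dF sF] /smoothnS[dG sG]; apply/smoothnS; split=> [x Ux|v].
  by apply: differentiableD; [exact: dF|exact: dG].
apply: (smoothn_congr oU (F := fun y => 'D_v F y + 'D_v G y)); last exact: IH.
by move=> x Ux; rewrite derivD//; [exact: dF|exact: dG].
Qed.

End Generic.

Lemma smoothn_bil (A B C : normedModType R) (b : {bilinear A -> B -> C}) k
    (U : set V) (F : V -> A) (G : V -> B) :
  continuous (fun q : A * B => b q.1 q.2) -> open U ->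
  smoothn k U F -> smoothn k U G -> smoothn k U (fun y => b (F y) (G y)).
Proof.
move=> bc oU; elim: k F G => [|k IH] F G.
  move=> /smoothn0 sF /smoothn0 sG; apply/smoothn0 => x Ux.
  by apply: diff_bil => //; [exact: sF|exact: sG].
move=> sF0 sG0; have [dF sF] := (smoothnS _ _ _).1 sF0; have [dG sG] := (smoothnS _ _ _).1 sG0.
apply/smoothnS; split=> [x Ux|v].
  by apply: diff_bil => //; [exact: dF|exact: dG].
apply: (smoothn_congr oU (F := fun y => b ('D_v F y) (G y) + b (F y) ('D_v G y))).
  by move=> x Ux; rewrite deriv_bil//; [exact: dF|exact: dG].
by apply: smoothnD => //; apply: IH => //; apply: smoothn_le (leqnSn k) _.
Qed.

Lemma smoothn_mul k (U : set V) (F G : V -> R) : open U ->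
  smoothn k U F -> smoothn k U G -> smoothn k U (fun y => F y * G y).
Proof. exact/smoothn_bil/mul_cont. Qed.

Lemma smoothn_scale (W : normedModType R) k (U : set V) (F : V -> R) (G : V -> W) : open U ->
  smoothn k U F -> smoothn k U G -> smoothn k U (fun y => F y *: G y).
Proof. exact/smoothn_bil/scale_cont. Qed.

Lemma smoothn_mulmx m n p k (U : set V) (F : V -> 'M[R]_(m, n)) (G : V -> 'M[R]_(n, p)) :
  open U -> smoothn k U F -> smoothn k U G -> smoothn k U (fun y => F y *m G y).
Proof. by apply: smoothn_bil; exact: mulmx_continuous. Qed.

Lemma smoothnN (W : normedModType R) k (U : set V) (F : V -> W) : open U ->
  smoothn k U F -> smoothn k U (fun y => - F y).
Proof.
move=> oU sF; under eq_fun do rewrite -scaleN1r.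
by apply: smoothn_scale => //; exact: smoothn_cst.
Qed.

Lemma smoothnB (W : normedModType R) k (U : set V) (F G : V -> W) : open U ->
  smoothn k U F -> smoothn k U G -> smoothn k U (fun y => F y - G y).
Proof. by move=> oU sF sG; apply: smoothnD => //; exact: smoothnN. Qed.

Lemma smoothn_sum (W : normedModType R) k (U : set V) I (r : seq I) (P : pred I) (f : I -> V -> W) :
  open U -> (forall i, smoothn k U (f i)) ->
  smoothn k U (fun y => \sum_(i <- r | P i) f i y).
Proof.
move=> oU sf; elim: r => [|i r IH].
  by under eq_fun do rewrite big_nil; exact: smoothn_cst.
under eq_fun do rewrite big_cons; case: (P i) => //.
exact: smoothnD.
Qed.

Lemma smoothn_lin m n (W : normedModType R) k (U : set V) (L : {linear 'M[R]_(m, n) -> W})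
    (F : V -> 'M[R]_(m, n)) : open U ->
  smoothn k U F -> smoothn k U (fun y => L (F y)).
Proof.
move=> oU; elim: k F => [|k IH] F.
  by move=> /smoothn0 sF; apply/smoothn0 => x Ux; apply: diff_lin'; exact: sF.
move=> /smoothnS[dF sF]; apply/smoothnS; split=> [x Ux|v].
  by apply: diff_lin'; exact: dF.
apply: (smoothn_congr oU (F := fun y => L ('D_v F y))); last exact: IH.
by move=> x Ux; rewrite deriv_lin//; exact: dF.
Qed.

End Smoothness.

#[local] Opaque derive.

(** * Symmetry of second derivatives *)

Section Schwarz.
Variables (R : realType) (V : normedModType R).

Lemma line_derive (W : normedModType R) (F : V -> W) x u (s : R) :
  differentiable F (x + s *: u) ->
  is_derive s 1 (fun r : R => F (x + r *: u)) ('D_u F (x + s *: u)).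
Proof.
move=> dF; have dl : differentiable (fun r : R => x + r *: u) s.
  apply: differentiableD; first exact: diff_cst'.
  by apply: diff_scale; [exact: (@ex_diff _ _ _ _ _ id)|exact: diff_cst'].
apply: DeriveDef; first by apply: diff_derivable; exact: diff_compose.
rewrite (@derive_comp _ _ _ _ (fun r : R => x + r *: u) F)// derivD ?deriv_cst ?add0r; last 2 first.
- exact: diff_cst'.
- by apply: diff_scale; [exact: (@ex_diff _ _ _ _ _ id)|exact: diff_cst'].
by rewrite deriv_scale ?deriv_cst ?scaler0 ?addr0 ?derive_id ?scale1r.
Qed.

Lemma MVT_line (F : V -> R) x u (t : R) : 0 < t ->
  (forall s, 0 <= s <= t -> differentiable F (x + s *: u)) ->
  exists2 s, 0 <= s <= t & F (x + t *: u) - F x = 'D_u F (x + s *: u) * t.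
Proof.
move=> t0 dF.
have [||s] := @MVT R (fun r => F (x + r *: u)) (fun r => 'D_u F (x + r *: u)) 0 t t0.
- move=> s; rewrite in_itv/= => /andP[s0 st]; apply: line_derive; apply: dF.
  by rewrite !ltW.
- apply: derivable_within_continuous => s; rewrite in_itv/= => sI.
  by have [] := line_derive (dF s sI).
rewrite in_itv/= => /andP[s0 st]; rewrite scale0r addr0 subr0 => E.
by exists s; rewrite ?ltW.
Qed.

(** Two applications of the mean value theorem, first along u and then along v. The left side is
    symmetric in u and v while the right side is not, which is the source of Schwarz' theorem. *)
Lemma second_difference (F : V -> R) (U : set V) x u v (t d : R) :
  smoothn 2 U F -> ball x d `<=` U -> 0 < t -> t * (`|u| + `|v|) < d ->
  exists2 p, ball x d p &
  F (x + t *: u + t *: v) - F (x + t *: u) - (F (x + t *: v) - F x)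
   = 'D_v ('D_u F) p * t * t.
Proof.
move=> /smoothnS[dF /(_ u) /smoothnS[dF' _]] bU t0 td.
have inb s r : 0 <= s <= t -> 0 <= r <= t -> ball x d (x + s *: u + r *: v).
  move=> /andP[s0 st] /andP[r0 rt]; rewrite -ball_normE/= -addrA opprD addNKr normrN.
  apply: le_lt_trans td; rewrite mulrDr (le_trans (ler_normD _ _))// !normrZ !ger0_norm//.
  by apply: lerD; apply: ler_wpM2r.
have tt : 0 <= t <= t by rewrite lexx ltW.
have ll : 0 <= (0 : R) <= t by rewrite lexx ltW.
pose G y := F (y + t *: v) - F y.
have dsh y : differentiable (fun y : V => y + t *: v) y.
  by apply: differentiableD; [exact: (@ex_diff _ _ _ _ _ id)|exact: diff_cst'].
have dFt s : 0 <= s <= t -> differentiable (fun y => F (y + t *: v)) (x + s *: u).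
  by move=> sI; apply: diff_compose => //; apply/dF/bU/inb.
have dF0 s : 0 <= s <= t -> differentiable F (x + s *: u).
  move=> sI; apply/dF/bU; have := inb s 0 sI ll.
  by rewrite scale0r addr0.
have [s sI GE] : exists2 s, 0 <= s <= t & G (x + t *: u) - G x = 'D_u G (x + s *: u) * t.
  apply: (@MVT_line G) => [//|s sI]; rewrite /G.
  by apply: differentiableB; [exact: dFt|exact: dF0].
have [r rI FE] : exists2 r, 0 <= r <= t &
    'D_u F (x + s *: u + t *: v) - 'D_u F (x + s *: u) = 'D_v ('D_u F) (x + s *: u + r *: v) * t.
  apply: (@MVT_line ('D_u F)) => [//|r rI].
  apply: dF'; apply: bU; exact: inb.
exists (x + s *: u + r *: v); first exact: inb.
rewrite -FE; move: GE; rewrite /G => ->; congr (_ * _).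
have -> : 'D_u G (x + s *: u) = _ := derivB u (dFt s sI) (dF0 s sI); congr (_ - _).
have dFs : differentiable F (x + s *: u + t *: v) by apply/dF/bU/inb.
rewrite (derive_comp _ (dsh (x + s *: u)) dFs).
by rewrite derivD ?deriv_cst ?addr0 ?derive_id.
Qed.

Lemma schwarz_real (F : V -> R) (U : set V) x u v : open U -> U x -> smoothn 2 U F ->
  'D_u ('D_v F) x = 'D_v ('D_u F) x.
Proof.
move=> oU Ux sF.
have cont a b : {for x, continuous ('D_b ('D_a F))}.
  apply: differentiable_continuous.
  by have := sF [:: b; a] isT x Ux.
apply/eqP; rewrite -subr_eq0 -normr_le0; apply/ler_addgt0Pr => e e0; rewrite add0r.
have e20 : 0 < e / 2 by rewrite divr_gt0.
have /cvgrPdist_lt/(_ _ e20) A1 := cont u v.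
have /cvgrPdist_lt/(_ _ e20) A2 := cont v u.
have A0 : nbhs x U by exact: open_nbhs_nbhs.
have AA := @filterI _ _ (nbhs_filter x) _ _ A0 (@filterI _ _ (nbhs_filter x) _ _ A1 A2).
have [d d0 dP] := (nbhs_ballP _ _).1 AA.
(* Small enough for both second differences to stay in the ball; the summand 1 excludes a zero
   denominator. *)
pose t := d / (`|u| + `|v| + 1) / 2.
have uv0 : 0 < `|u| + `|v| + 1 by rewrite ltr_wpDl// addr_ge0.
have t0 : 0 < t by rewrite !divr_gt0.
have bU : ball x d `<=` U by move=> y /dP[yU _].
have td : t * (`|u| + `|v|) < d.
  apply: (@le_lt_trans _ _ (t * (`|u| + `|v| + 1))).
    by rewrite ler_pM2l// lerDl.
  rewrite /t mulrAC divfK ?gt_eqF//.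
  by rewrite ltr_pdivrMr// ltr_pMr// ltr1n.
have [p pb pE] := second_difference sF bU t0 td.
have td' : t * (`|v| + `|u|) < d by rewrite [X in _ * X]addrC.
have [q qb qE] := second_difference sF bU t0 td'.
have [_ [/= Hp _]] := dP _ pb; have [_ [_ /= Hq]] := dP _ qb.
move: pE qE Hp Hq; rewrite [x + t *: v + _]addrAC.
generalize ('D_v ('D_u F) p) ('D_u ('D_v F) q) ('D_u ('D_v F) x) ('D_v ('D_u F) x).
generalize (F (x + t *: u + t *: v)) (F (x + t *: u)) (F (x + t *: v)) (F x).
move=> A B C D a b c f pE qE Hp Hq.
(* Both mixed derivatives, taken at the intermediate points p and q, equal the same second
   difference divided by t^2. *)
have E : a = b.
  apply: (mulIf (lt0r_neq0 t0)); apply: (mulIf (lt0r_neq0 t0)); rewrite -pE -qE.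
  by ring.
rewrite (_ : c - f = (c - b) - (f - a)); last by rewrite E; ring.
by rewrite (le_trans (ler_normB _ _))// [leRHS]splitr lerD// ltW.
Qed.

Lemma schwarz m n (F : V -> 'M[R]_(m, n)) (U : set V) x u v :
  open U -> U x -> smoothn 2 U F -> 'D_u ('D_v F) x = 'D_v ('D_u F) x.
Proof.
move=> oU Ux sF; apply/matrixP => i j.
have dF a y : U y -> differentiable ('D_a F) y by exact: (sF [:: a]).
have key a b : ('D_a ('D_b F) x) i j = 'D_a ('D_b (fun y => F y i j)) x.
  rewrite -deriv_coord; last exact: dF.
  apply: near_eq_derive; near=> y; rewrite deriv_coord//.
  apply: (sF [::] isT); near: y; exact: open_nbhs_nbhs.
apply: (etrans (key u v)); apply: (etrans _ (esym (key v u))).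
apply: (schwarz_real u v oU Ux).
move=> s s2 y Uy; suff : differentiable (fun y => iter_derive s F y i j) y.
  apply: near_differentiable.
  have := open_nbhs_nbhs (conj oU Uy); apply: filterS => z.
  elim: s s2 z {y Uy} => //= a s IH s2 z Uz.
  rewrite -deriv_coord; last by apply: sF => //; exact: ltnW.
  apply: near_eq_derive.
  have := open_nbhs_nbhs (conj oU Uz); apply: filterS => w.
  by apply: IH; exact: ltnW.
have /differentiable_mxP := sF s s2 y Uy; exact.
Unshelve. all: by end_near. Qed.

End Schwarz.

(** * Linear systems and the Frobenius theorem *)

Section MatrixNorm.
Variable R : realType.

Lemma mx_entry_le m n (A : 'M[R]_(m, n)) i j : `|A i j| <= `|A|.
Proof.
rewrite [leRHS]/Num.Def.normr/= mx_normrE.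
exact: (le_bigmax _ (fun ij => `|A ij.1 ij.2|) (i, j)).
Qed.

Lemma mx_norm_le m n (A : 'M[R]_(m, n)) c :
  0 <= c -> (forall i j, `|A i j| <= c) -> `|A| <= c.
Proof.
move=> c0 Ac; rewrite [leLHS]/Num.Def.normr/= mx_normrE.
by apply: bigmax_le => // -[i j] _; exact: Ac.
Qed.

Lemma mulmx_norm m n p (A : 'M[R]_(m, n)) (B : 'M[R]_(n, p)) :
  `|A *m B| <= n%:R * `|A| * `|B|.
Proof.
apply: mx_norm_le => [|i j]; first by rewrite !mulr_ge0.
rewrite mxE (le_trans (ler_norm_sum _ _ _))//.
rewrite -mulrA mulr_natl -[X in _ *+ X]card_ord -sumr_const.
by apply: ler_sum => k _; rewrite normrM ler_pM// mx_entry_le.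
Qed.

End MatrixNorm.

(** * Linear ordinary differential equations *)

Section Ode.
Variables (R : realType) (N : nat).
Implicit Types (q : R -> 'rV[R]_N).

(** The norm is the maximum of the entries, so the scalar mean value theorem for one entry at a time
    gives the bound with the same constant. *)
Lemma MVT_norm p (q : R -> 'M[R]_(p, N)) (a b c : R) : a <= b -> 0 <= c ->
  (forall t : R, a <= t <= b -> differentiable q t /\ `|'D_1 q t| <= c) ->
  `|q b - q a| <= c * (b - a).
Proof.
move=> ab c0 dq; apply: mx_norm_le => [|i j]; first by rewrite mulr_ge0// subr_ge0.
have dqij t : a <= t <= b -> is_derive t 1 (fun t => q t i j) ('D_1 q t i j).
  move=> /dq[dqt _]; rewrite -deriv_coord//; apply: derivableP.
  by apply: diff_derivable; move/differentiable_mxP : dqt; exact.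
have [|| s sI] := @MVT_segment R (fun t => q t i j) (fun t => 'D_1 q t i j) a b ab.
- by move=> t; rewrite in_itv/= => /andP[t1 t2]; apply: dqij; rewrite !ltW.
- apply: derivable_within_continuous => t; rewrite in_itv/= => tI.
  by have [] := dqij t tI.
move: sI; rewrite in_itv/= => sI E; rewrite !mxE E normrM [X in _ * X]ger0_norm ?subr_ge0//.
apply: ler_wpM2r; rewrite ?subr_ge0//.
by apply: le_trans (mx_entry_le _ _ _) _; have [] := dq s sI.
Qed.

Lemma small_gronwall q (c : R) : 0 <= c -> q 0 = 0 ->
  (forall t : R, 0 <= t <= 1 -> differentiable q t /\ `|'D_1 q t| <= `|q t| / 2 + c) ->
  forall t : R, 0 <= t <= 1 -> `|q t| <= 2 * c.
Proof.
move=> c0 q0 dq.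
have cq : {within `[0, 1], continuous (fun t => `|q t|)}.
  apply: continuous_in_subspaceT => t; rewrite inE/= in_itv/= => /dq[/differentiable_continuous cq _].
  exact: (cvg_norm cq).
have [t0] := EVT_max ler01 cq; rewrite in_itv/= => t0I max.
have key : `|q t0| <= `|q t0| / 2 + c.
  have B0 : 0 <= `|q t0| / 2 + c by rewrite addr_ge0// divr_ge0.
  have : `|q t0 - q 0| <= (`|q t0| / 2 + c) * (t0 - 0).
    apply: MVT_norm => //; first by case/andP : t0I.
    move=> t /andP[t1 t2]; have tI : 0 <= t <= 1.
      by rewrite t1 (le_trans t2)//; case/andP : t0I.
    have [dqt le] := dq t tI; split=> //; apply: le_trans le _.
    by rewrite lerD2r ler_wpM2r// max// in_itv/=.
  rewrite q0 !subr0 => /le_trans; apply.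
  by rewrite ler_piMr//; case/andP : t0I.
have {}key : `|q t0| <= 2 * c by lra.
by move=> t tI; apply: le_trans key; apply: max; rewrite in_itv.
Qed.

Lemma antiderivative_real (f : R -> R) : continuous f ->
  exists2 F : R -> R, F 0 = 0 &
    forall t : R, -3 < t < 3 -> differentiable F t /\ 'D_1 F t = f t.
Proof.
(* The base point -4 and the right end 4 used below leave every t in (-3, 3) in the interior of the
   interval of integration. *)
move=> cf; pose F x := (\int[lebesgue_measure]_(t in [set` `[-4, x]]) f t)%R.
exists (fun t => F t - F 0); first by rewrite subrr.
move=> t /andP[t1 t2].
have [||||dF FE] := @continuous_FTC1_closed R f (-4) t 4.
- by rewrite (lt_trans t2)// ltr_nat.
- apply: continuous_compact_integrable; first exact: segment_compact.
  by apply: continuous_subspaceT => x; exact: cf.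
- by rewrite (lt_trans _ t1)// ltrN2 ltr_nat.
- exact: cf.
have dF' : differentiable F t by exact/derivable1_diffP.
split; first by apply: differentiableB => //; exact: diff_cst'.
by rewrite derivB// deriv_cst subr0 -derive1E FE.
Qed.

Lemma antiderivative (f : R -> 'rV[R]_N) : continuous f ->
  exists2 F : R -> 'rV[R]_N, F 0 = 0 &
    forall t : R, -3 < t < 3 -> differentiable F t /\ 'D_1 F t = f t.
Proof.
move=> cf.
have cfj j : continuous (fun t => f t ord0 j).
  by move=> t; apply: (@continuous_comp _ _ _ f (fun A => A ord0 j)); [exact: cf|exact: coord_continuous].
pose Fj j := projT1 (cid2 (antiderivative_real (cfj j))).
have Fj0 j : Fj j 0 = 0 by rewrite /Fj; case: cid2.
have FjD j (t : R) : -3 < t < 3 -> differentiable (Fj j) t /\ 'D_1 (Fj j) t = f t ord0 j.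
  by rewrite /Fj; case: cid2 => /= F _; apply.
have dF (t : R) : -3 < t < 3 -> differentiable (fun t => \row_j Fj j t) t.
  move=> tI; apply/differentiable_mxP => i j.
  under eq_fun do rewrite mxE; exact: (FjD j t tI).1.
exists (fun t => \row_j Fj j t); first by apply/rowP => j; rewrite !mxE.
move=> t tI; split; first exact: dF.
apply/rowP => j; rewrite -deriv_coord; last exact: dF.
by under eq_fun do rewrite mxE; exact: (FjD j t tI).2.
Qed.

Lemma MVT_norm0 q (c t : R) : 0 <= c -> -2 <= t <= 2 ->
  (forall s : R, -2 <= s <= 2 -> differentiable q s /\ `|'D_1 q s| <= c) ->
  `|q t - q 0| <= c * 2.
Proof.
move=> c0 /andP[t1 t2] dq; have [t0|t0] := leP 0 t.
  apply: (@le_trans _ _ (c * (t - 0))); last by rewrite subr0 ler_wpM2l.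
  apply: MVT_norm => // s /andP[s0 st]; apply: dq.
  by rewrite (le_trans st)// andbT (le_trans _ s0)// lerN10.
rewrite distrC; apply: (@le_trans _ _ (c * (0 - t))); last by rewrite sub0r ler_wpM2l// lerNl.
apply: MVT_norm => //; first exact: ltW.
move=> s /andP[s0 st]; apply: dq.
by rewrite (le_trans t1)//= (le_trans st).
Qed.

Lemma le0_geometric (x c : R) : (forall k, x <= c / 2 ^+ k) -> x <= 0.
Proof.
move=> xc; rewrite leNgt; apply/negP => x0.
have c0 : 0 < c by have := xc 0%N; rewrite expr0 divr1; exact: lt_le_trans.
pose k := Num.bound (c / x).
have ck : c / x < k%:R by apply: archi_boundP; rewrite divr_ge0// ltW.
have k2 : (k%:R : R) < 2 ^+ k by rewrite -natrX ltr_nat ltn_expl.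
have := xc k; rewrite ler_pdivlMr ?exprn_gt0// mulrC -ler_pdivlMr//.
by rewrite leNgt (lt_trans ck k2).
Qed.

Lemma geometric_small (c e : R) : 0 < e -> exists k, c / 2 ^+ k < e.
Proof.
move=> e0; apply: contrapT => nk.
suff : e <= 0 by rewrite leNgt e0.
apply: (@le0_geometric _ c) => k; rewrite leNgt; apply/negP => ck; apply: nk.
by exists k.
Qed.

Lemma geometric_limit (u : nat -> 'rV[R]_N) (c : R) :
  (forall k m, (k <= m)%N -> `|u m - u k| <= c / 2 ^+ k) ->
  exists l, forall k, `|l - u k| <= c / 2 ^+ k.
Proof.
move=> uB; have cu : cvg (u @ \oo).
  apply: cauchy_cvg; apply: cauchy_exP => e e0.
  have [k ck] := geometric_small c e0.
  exists (u k); exists k => // m /= km.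
  by rewrite -ball_normE /= distrC (le_lt_trans (uB _ _ km)).
exists (lim (u @ \oo)) => k; apply/ler_addgt0Pr => e e0.
have /cvgrPdist_lt/(_ _ e0)[m _ mP] := cu.
have := mP (maxn m k) (leq_maxl _ _) => /= /ltW le1.
have le2 := uB k (maxn m k) (leq_maxr _ _).
rewrite -(subrKA (u (maxn m k))) addrC.
by rewrite (le_trans (ler_normD _ _))// lerD.
Qed.

(** The projection of the line onto [-2, 2]. Composed with it, data controlled only on [-2, 2]
    become continuous on the whole line and can be integrated. *)
Definition clip (t : R) : R := (`|t + 2| - `|t - 2|) / 2.

Lemma clip_continuous : continuous clip.
Proof.
move=> t; apply: cvgM; last exact: cvg_cst.
apply: cvgB; apply: cvg_norm.
  by apply: cvgD; [exact: cvg_id|exact: cvg_cst].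
by apply: cvgB; [exact: cvg_id|exact: cvg_cst].
Qed.

Lemma clip_itv t : -2 <= clip t <= 2.
Proof.
rewrite /clip; have [] := ger0P (t + 2); have [] := ger0P (t - 2) => *; lra.
Qed.

Lemma clipE t : -2 <= t <= 2 -> clip t = t.
Proof.
rewrite /clip; have [] := ger0P (t + 2); have [] := ger0P (t - 2) => *; lra.
Qed.

(** Picard iteration. Integrating a factor 1/4 over a length at most 2 makes the iteration a
    contraction by 1/2 on [-2, 2], so one solution covers the whole interval. *)
Lemma linear_ode (a : R -> 'M[R]_N) (y0 : 'rV[R]_N) :
  (forall t : R, -2 <= t <= 2 -> {for t, continuous a}) ->
  (forall (t : R) (z : 'rV[R]_N), -2 <= t <= 2 -> `|z *m a t| <= `|z| / 4) ->
  exists2 y : R -> 'rV[R]_N, y 0 = y0 &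
    forall t : R, -2 < t < 2 -> differentiable y t /\ 'D_1 y t = y t *m a t.
Proof.
move=> ca ba.
pose g (f : R -> 'rV[R]_N) t := f (clip t) *m a (clip t).
have cg (f : R -> 'rV[R]_N) : continuous (f \o clip) -> continuous (g f).
  move=> cf t.
  have cft : f (clip s) @[s --> t] --> f (clip t) := cf t.
  have cat : a (clip s) @[s --> t] --> a (clip t).
    have : {for t, continuous (a \o clip)} by apply: continuous_comp; [exact: clip_continuous|exact/ca/clip_itv].
    by [].
  have H2 := @mulmx_continuous R 1 N N (f (clip t), a (clip t)).
  exact: (@continuous2_cvg _ _ _ _ _ _ _ _ _ _ _ H2 cft cat).
(* T is the Picard operator; the continuity condition sits inside the existential, so T is total and
   arbitrary on the other functions. *)
have /choice[T TP] : forall f : R -> 'rV[R]_N, exists h : R -> 'rV[R]_N,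
    continuous (f \o clip) -> h 0 = y0 /\
    forall t : R, -3 < t < 3 -> differentiable h t /\ 'D_1 h t = g f t.
  move=> f; have [cf|ncf] := pselect (continuous (f \o clip)); last by exists f.
  have [F F0 FP] := antiderivative (cg f cf).
  exists (fun t => y0 + F t) => _; split; first by rewrite F0 addr0.
  move=> t /FP[dF FE]; split.
    by apply: differentiableD; first exact: diff_cst'.
  by rewrite derivD ?deriv_cst ?add0r//; exact: diff_cst'.
have in3 (t : R) : -2 <= t <= 2 -> -3 < t < 3.
  by move=> ?; lra.
have contT f : continuous (f \o clip) -> continuous (T f \o clip).
  move=> /TP[_ Tf] t; apply: continuous_comp; first exact: clip_continuous.
  apply: differentiable_continuous; apply: (Tf _ _).1.
  exact/in3/clip_itv.
have contr f1 f2 c : 0 <= c -> continuous (f1 \o clip) -> continuous (f2 \o clip) ->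
    (forall t : R, -2 <= t <= 2 -> `|f1 t - f2 t| <= c) ->
    forall t : R, -2 <= t <= 2 -> `|T f1 t - T f2 t| <= c / 2.
  move=> c0 cf1 cf2 f12 t tI.
  have [T10 T1] := TP _ cf1; have [T20 T2] := TP _ cf2.
  have -> : T f1 t - T f2 t = (T f1 t - T f2 t) - (T f1 0 - T f2 0).
    by rewrite T10 T20 subrr subr0.
  have -> : c / 2 = c / 4 * 2 by lra.
  apply: (MVT_norm0 (q := fun t => T f1 t - T f2 t)); [by rewrite divr_ge0|exact: tI|].
  move=> s sI; have [d1 E1] := T1 s (in3 _ sI); have [d2 E2] := T2 s (in3 _ sI).
  split; first exact: differentiableB.
  rewrite derivB// E1 E2 /g clipE// -mulmxBl (le_trans (ba _ _ sI))//.
  by apply: ler_wpM2r => //; exact: f12.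
pose Y k := iter k T (fun=> y0).
have cY k : continuous (Y k \o clip).
  by elim: k => [|k IH]; [move=> t; exact: cvg_cst|exact: contT].
have YB k : forall t : R, -2 <= t <= 2 -> `|Y k.+1 t - Y k t| <= `|y0| / 2 ^+ k.
  elim: k => [|k IH] t tI.
    have [T0 Tt] := TP _ (cY 0%N).
    rewrite expr0 divr1 /=.
    have -> : T (fun=> y0) t - y0 = T (fun=> y0) t - T (fun=> y0) 0 by rewrite T0.
    apply: (@le_trans _ _ (`|y0| / 4 * 2)); last by have := normr_ge0 y0; lra.
    apply: MVT_norm0 => //.
    move=> s sI; have [ds Es] := Tt s (in3 _ sI); split=> //.
    by rewrite Es /g ba// clip_itv.
  have -> : `|y0| / 2 ^+ k.+1 = `|y0| / 2 ^+ k / 2 by rewrite exprSr invfM mulrA.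
  have c0 : 0 <= `|y0| / 2 ^+ k by rewrite divr_ge0 ?exprn_ge0.
  exact: (contr (Y k.+1) (Y k) _ c0 (cY _) (cY _) IH t tI).
have YC k m (t : R) : -2 <= t <= 2 -> `|Y (m + k)%N t - Y k t| <= 2 * `|y0| / 2 ^+ k - 2 * `|y0| / 2 ^+ (m + k).
  move=> tI; elim: m => [|m IH]; first by rewrite !subrr normr0.
  rewrite addSn; have -> : Y (m + k).+1 t - Y k t = (Y (m + k).+1 t - Y (m + k)%N t) + (Y (m + k)%N t - Y k t).
    by rewrite addrA subrK.
  apply: le_trans (ler_normD _ _) _; have := YB (m + k)%N t tI; move: IH.
  rewrite exprS invfM; set A := `|_|; set B := `|_|; set C := _ ^- _; set D := _ ^- _.
  by move=> ? ?; lra.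
have YC' k m (t : R) : -2 <= t <= 2 -> (k <= m)%N -> `|Y m t - Y k t| <= 2 * `|y0| / 2 ^+ k.
  move=> tI km; have := YC k (m - k)%N t tI; rewrite subnK// => /le_trans; apply.
  by rewrite lerBlDr lerDl divr_ge0// ?exprn_ge0// mulr_ge0.
have /choice[y yB'] : forall t : R, exists l, forall k, `|l - Y k (clip t)| <= 2 * `|y0| / 2 ^+ k.
  by move=> t; apply: geometric_limit => k m km; apply: YC' => //; exact: clip_itv.
(* The limit depends on t through [clip t] only, so y may be replaced by its composite with
   [clip]. *)
wlog yclip : y yB' / y \o clip = y.
  move=> /(_ (y \o clip)); apply.
    by move=> t k; have /= := yB' (clip t) k; rewrite (clipE (clip_itv t)).
  by apply/funext => t /=; rewrite (clipE (clip_itv t)).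
have yB k (t : R) : -2 <= t <= 2 -> `|y t - Y k t| <= 2 * `|y0| / 2 ^+ k.
  by move=> tI; have := yB' t k; rewrite clipE.
have cy : continuous (y \o clip).
  rewrite yclip => t; apply/cvgrPdist_lt => e e0.
  have e30 : 0 < e / 3 by rewrite divr_gt0.
  have [k ck] := geometric_small (2 * `|y0|) e30.
  have /cvgrPdist_lt/(_ _ e30) := cY k t; apply: filterS => s /= h1.
  have := yB' t k; have := yB' s k => h2 h3.
  have -> : y t - y s = (y t - Y k (clip t)) + (Y k (clip t) - Y k (clip s)) - (y s - Y k (clip s)).
    by rewrite opprB addrA !addrA !subrK.
  apply: (le_lt_trans (ler_normB _ _)).
  have := ler_normD (y t - Y k (clip t)) (Y k (clip t) - Y k (clip s)).
  move: h1 h2 h3 ck; move: (2 * `|y0| / _) `|_ - _| `|_ - _| `|_ - _| `|_ + _| => a1 a2 a3 a4 a5.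
  by move=> *; lra.
(* The solution is T y rather than y: T y is differentiable by construction, and it agrees with the
   fixed point y on [-2, 2]. *)
exists (T y); first exact: (TP _ cy).1.
have TyE (t : R) : -2 <= t <= 2 -> T y t = y t.
  move=> tI; apply/eqP; rewrite -subr_eq0 -normr_le0.
  apply: (@le0_geometric _ (2 * `|y0|)) => k.
  have h1 : `|T y t - Y k.+1 t| <= 2 * `|y0| / 2 ^+ k / 2.
    have c0 : 0 <= 2 * `|y0| / 2 ^+ k by rewrite divr_ge0 ?exprn_ge0// mulr_ge0.
    exact: (contr y (Y k) _ c0 cy (cY k) (yB k) t tI).
  have h2 := yB k.+1 t tI.
  have -> : T y t - y t = (T y t - Y k.+1 t) - (y t - Y k.+1 t) by rewrite opprB addrA subrK.
  apply: le_trans (ler_normB _ _) _; move: h1 h2; rewrite exprS invfM.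
  move: `|T y t - _| `|y t - _| (2 ^+ k)^-1 => A B C *; lra.
move=> t tI; have tI' : -2 <= t <= 2 by lra.
have [dT TE] := (TP _ cy).2 t (in3 _ tI'); split=> //.
by rewrite TE /g clipE// TyE.
Qed.

End Ode.

Section Local.
Variables (R : realType) (n : nat).
Local Notation V := ('rV[R]_n).

Lemma differentiable_approx_rV (W : normedModType R) (F : V -> W) (l : 'I_n -> W) x :
  (forall e : R, 0 < e -> \forall y \near x,
     `|F y - F x - \sum_j (y - x) ord0 j *: l j| <= e * `|y - x|) ->
  differentiable F x /\ forall v, 'D_v F x = \sum_j v ord0 j *: l j.
Proof.
pose L (v : V) := \sum_j v ord0 j *: l j.
have linL : linear L.
  move=> a u v; rewrite /L scaler_sumr -big_split; apply: eq_bigr => j _ /=.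
  by rewrite !mxE scalerDl scalerA.
pose LM := GRing.isLinear.Build _ _ _ _ _ linL.
pose L' : {linear V -> W} := HB.pack L LM.
move=> H; apply: (@differentiable_approx _ _ _ F L') => //.
exact: continuous_linear_coord.
Qed.

Lemma derive_basis (W : normedModType R) (F : V -> W) x u :
  differentiable F x -> 'D_u F x = \sum_j u ord0 j *: 'D_(delta_mx ord0 j) F x.
Proof.
by move=> dF; rewrite {1}(row_sum_delta u) derive_sum_dir.
Qed.

Lemma row_entry_le (u : V) j : `|u ord0 j| <= `|u|.
Proof. exact: mx_entry_le. Qed.

Lemma norm_sum_coord (W : normedModType R) (u : V) (f : 'I_n -> W) c :
  (forall j, `|f j| <= c) -> `|\sum_j u ord0 j *: f j| <= n%:R * `|u| * c.
Proof.
move=> fc; rewrite (le_trans (ler_norm_sum _ _ _))//.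
rewrite -mulrA mulr_natl -[X in _ *+ X]card_ord -sumr_const.
by apply: ler_sum => k _; rewrite normrZ ler_pM// row_entry_le.
Qed.

Lemma segment_bound p q (F : V -> 'M[R]_(p, q)) y w c : 0 <= c ->
  (forall t : R, 0 <= t <= 1 ->
     differentiable F (y + t *: w) /\ `|'D_w F (y + t *: w)| <= c) ->
  `|F (y + w) - F y| <= c.
Proof.
move=> c0 H.
have := @MVT_norm R q p (fun t => F (y + t *: w)) 0 1 c ler01 c0.
rewrite scale1r scale0r addr0 subr0 mulr1; apply => t /H[dF le].
have [d E] := line_derive dF; rewrite E; split; last exact: le.
exact/derivable1_diffP.
Qed.

Lemma ball_line (x0 y w : V) (d t : R) : 0 <= t <= 1 -> ball x0 d y -> ball x0 d (y + w) ->
  ball x0 d (y + t *: w).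
Proof.
move=> /andP[t0 t1]; rewrite -!ball_normE/= => h1 h2.
have -> : x0 - (y + t *: w) = (1 - t) *: (x0 - y) + t *: (x0 - (y + w)).
  by apply/matrixP => i j; rewrite !mxE; ring.
rewrite (le_lt_trans (ler_normD _ _))// !normrZ !ger0_norm ?subr_ge0//.
have h3 := ltW h1; have h4 := ltW h2.
have [->|tn] := eqVneq t 0; first by rewrite subr0 mul1r mul0r addr0.
have tp : 0 < t by rewrite lt_neqAle eq_sym tn.
apply: (@lt_le_trans _ _ ((1 - t) * d + t * d)); last by rewrite -mulrDl subrK mul1r.
by apply: ler_ltD; [rewrite ler_wpM2l ?subr_ge0|rewrite ltr_pM2l].
Qed.

Lemma near_bound (I : finType) (W : I -> normedModType R) (F : forall i, V -> W i) x0 :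
  (forall i, differentiable (F i) x0) ->
  exists2 M : R, 0 <= M & \forall y \near x0, forall i, `|F i y| <= M.
Proof.
move=> dF; exists (\sum_i (`|F i x0| + 1)); first by apply: sumr_ge0 => i _; rewrite addr_ge0.
pose M := \sum_i (`|F i x0| + 1).
suff H i : \forall y \near x0, `|F i y| <= M.
  exact: (@filter_forall _ _ (fun i => [set y | `|F i y| <= M]) (nbhs x0) _ H).
have /cvg_norm/cvgr_le := differentiable_continuous (dF i).
have lt : `|F i x0| < `|F i x0| + 1 by rewrite ltrDl.
move=> /(_ _ lt); apply: filterS => y /le_trans; apply.
by rewrite /M (bigD1 i)//= lerDl; apply: sumr_ge0 => j _; rewrite addr_ge0.
Qed.

End Local.

(** * Frobenius' theorem for flat linear systems *)

Section Frobenius.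
Variables (R : realType) (n N : nat).
Local Notation V := ('rV[R]_n).
Local Notation e_ j := (delta_mx ord0 j : V).
Variables (U : set V) (B : 'I_n -> V -> 'M[R]_N) (x0 : V) (y0 : 'rV[R]_N).
Hypothesis oU : open U.
Hypothesis Ux0 : U x0.
Hypothesis sB : forall j, smoothn 2 U (B j).

(** The matrix-valued one-form A of the system dY = Y A. The hypothesis [flat] below is the
    condition that D_u D_v Y = D_v D_u Y for its solutions; the order of the products comes from the
    action on row vectors. *)
Definition cform (x u : V) : 'M[R]_N := \sum_j u ord0 j *: B j x.

Hypothesis flat : forall x u v, U x ->
  'D_u (cform ^~ v) x + cform x u *m cform x v = 'D_v (cform ^~ u) x + cform x v *m cform x u.

Lemma cformD x u v : cform x (u + v) = cform x u + cform x v.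
Proof.
by rewrite /cform -big_split; apply: eq_bigr => j _; rewrite mxE scalerDl.
Qed.

Lemma diff_cform u x : U x -> differentiable (cform ^~ u) x.
Proof.
move=> Ux; apply: diff_sum => j; apply: differentiableZ.
exact: smoothn_diff (sB j) Ux.
Qed.

Lemma deriv_cform u w x : U x -> 'D_w (cform ^~ u) x = \sum_j u ord0 j *: 'D_w (B j) x.
Proof.
move=> Ux; have dB j : differentiable (B j) x by exact: smoothn_diff (sB j) Ux.
rewrite deriv_sum => [|j]; last exact: differentiableZ.
by apply: eq_bigr => j _; rewrite deriveZ//; exact: diff_derivable.
Qed.

(** Only the finitely many [B j] and their first two derivatives along basis vectors have to be
    bounded near x0. Other directions follow by expansion in the basis and increments by the mean
    value theorem on segments of the ball; the last bound is the second-order Taylor remainder. *)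
Lemma frobenius_bounds : exists d K : R, [/\ 0 < d, 0 <= K, ball x0 d `<=` U &
  [/\ forall x u (z : 'rV[R]_N), ball x0 d x -> `|z *m cform x u| <= K * `|u| * `|z|,
      forall x u w (z : 'rV[R]_N), ball x0 d x -> `|z *m 'D_w (cform ^~ u) x| <= K * `|w| * `|u| * `|z|,
      forall x u w (z : 'rV[R]_N), ball x0 d x -> ball x0 d (x + w) ->
        `|z *m (cform (x + w) u - cform x u)| <= K * `|w| * `|u| * `|z| &
      forall x u w (z : 'rV[R]_N), ball x0 d x -> ball x0 d (x + w) ->
        `|z *m (cform (x + w) u - cform x u - 'D_w (cform ^~ u) x)|
          <= K * `|w| ^+ 2 * `|u| * `|z|]].
Proof.
have sB1 j i : smoothn 1 U ('D_(e_ i) (B j)) by have /smoothnS[_] := sB j.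
have sB2 j i k : smoothn 0 U ('D_(e_ k) ('D_(e_ i) (B j))) by have /smoothnS[_] := sB1 j i.
have [M1 M10 nM1] := near_bound (fun j => smoothn_diff (sB j) Ux0).
have [M2 M20 nM2] := near_bound (fun p : 'I_n * 'I_n => smoothn_diff (sB1 p.1 p.2) Ux0).
have [M3 M30 nM3] := near_bound (fun p : 'I_n * 'I_n * 'I_n => smoothn_diff (sB2 p.1.1 p.1.2 p.2) Ux0).
have nU : nbhs x0 U by exact: open_nbhs_nbhs.
have /nbhs_ballP[d d0 dP] : \forall y \near x0, [/\ U y, forall j, `|B j y| <= M1,
  forall i j, `|'D_(e_ i) (B j) y| <= M2 & forall i j k, `|'D_(e_ k) ('D_(e_ i) (B j)) y| <= M3].
  have nF := nbhs_filter x0.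
  have := @filterI _ _ nF _ _ nU (@filterI _ _ nF _ _ nM1 (@filterI _ _ nF _ _ nM2 nM3)).
  apply: filterS => y [Uy [h1 [h2 h3]]]; split.
  - exact: Uy.
  - exact: h1.
  - by move=> i j; exact: (h2 (j, i)).
  - by move=> i j k; exact: (h3 (j, i, k)).
pose n1 : R := n%:R; have n10 : 0 <= n1 by [].
have D1 j w y : ball x0 d y -> `|'D_w (B j) y| <= n1 * `|w| * M2.
  move=> /dP[Uy _ h _]; rewrite derive_basis; last exact: smoothn_diff (sB j) Uy.
  by apply: norm_sum_coord => i; exact: h.
have D2 j w v y : ball x0 d y -> `|'D_w ('D_v (B j)) y| <= n1 * `|v| * (n1 * `|w| * M3).
  move=> yb; have [Uy _ _ h] := dP _ yb.
  have -> : 'D_w ('D_v (B j)) y = 'D_w (fun z => \sum_i v ord0 i *: 'D_(e_ i) (B j) z) y.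
    apply: near_eq_derive; have := open_nbhs_nbhs (conj oU Uy); apply: filterS => z Uz.
    by rewrite derive_basis//; exact: smoothn_diff (sB j) Uz.
  have dB i : differentiable ('D_(e_ i) (B j)) y by exact: smoothn_diff (sB1 j i) Uy.
  rewrite deriv_sum => [|i]; last exact: differentiableZ.
  under eq_bigr => i _ do rewrite (derivZ _ _ (dB i)) (derive_basis _ (dB i)).
  by apply: norm_sum_coord => i; apply: norm_sum_coord => k; exact: h.
have L1 j w y : ball x0 d y -> ball x0 d (y + w) -> `|B j (y + w) - B j y| <= n1 * `|w| * M2.
  move=> yb ywb; apply: segment_bound => [|t tI]; first by rewrite !mulr_ge0.
  have b := ball_line tI yb ywb; split; last exact: D1.
  by have [Uy _ _ _] := dP _ b; exact: smoothn_diff (sB j) Uy.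
have L1' j v w y : ball x0 d y -> ball x0 d (y + w) ->
    `|'D_v (B j) (y + w) - 'D_v (B j) y| <= n1 * `|v| * (n1 * `|w| * M3).
  move=> yb ywb; apply: (@segment_bound _ _ _ _ ('D_v (B j))) => [|t tI].
    by rewrite !mulr_ge0.
  have b := ball_line tI yb ywb; split; last exact: D2.
  have [Uy _ _ _] := dP _ b; have /smoothnS[_ s1] := sB j.
  exact: smoothn_diff (s1 v) Uy.
have L2 j w y : ball x0 d y -> ball x0 d (y + w) ->
    `|B j (y + w) - B j y - 'D_w (B j) y| <= n1 * `|w| * (n1 * `|w| * M3).
  move=> yb ywb; pose c : 'M[R]_N := 'D_w (B j) y.
  have := @MVT_norm R N N (fun t => B j (y + t *: w) - t *: c) 0 1 (n1 * `|w| * (n1 * `|w| * M3)) ler01.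
  rewrite !scale1r !scale0r addr0 !subr0 mulr1 addrAC; apply; first by rewrite !mulr_ge0.
  move=> t tI; have b := ball_line tI yb ywb; have [Uy _ _ _] := dP _ b.
  have dB := smoothn_diff (sB j) Uy.
  have [d1 E] := line_derive dB; have {}d1 := (derivable1_diffP _ _).1 d1.
  have d2 : differentiable (fun t : R => t *: c) t.
    by apply: diff_scale; [exact: (@ex_diff _ _ _ _ _ id)|exact: diff_cst'].
  split; first exact: differentiableB.
  rewrite derivB// E deriv_scale//.
  rewrite deriv_cst scaler0 addr0 derive_id scale1r.
  apply: le_trans (L1' j w (t *: w) y yb b) _.
  have tw : `|t *: w| <= `|w|.
    case/andP: tI => t0 t1; rewrite normrZ ger0_norm// ler_piMl//.
  by rewrite ler_wpM2l ?mulr_ge0// ler_wpM2r// ler_wpM2l.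
(* Each derivative costs one factor [n1] for the expansion of its direction, and so does the
   argument u of the form; the factor N comes from [mulmx_norm]. *)
pose K := N%:R * (n1 * M1 + n1 * (n1 * M2) + n1 * (n1 * (n1 * M3))).
have KM c : c \in [:: n1 * M1; n1 * (n1 * M2); n1 * (n1 * (n1 * M3))] -> N%:R * c <= K.
  move=> H; apply: ler_wpM2l => //.
  have a1 : 0 <= n1 * M1 by rewrite mulr_ge0.
  have a2 : 0 <= n1 * (n1 * M2) by rewrite !mulr_ge0.
  have a3 : 0 <= n1 * (n1 * (n1 * M3)) by rewrite !mulr_ge0.
  by move: H; rewrite !inE => /or3P[] /eqP ->; lra.
have K0 : 0 <= K.
  by apply: le_trans (KM (n1 * M1) _); rewrite ?inE ?eqxx// !mulr_ge0.
have fin (z : 'rV[R]_N) (X : 'M[R]_N) (c a : R) : 0 <= a ->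
    c \in [:: n1 * M1; n1 * (n1 * M2); n1 * (n1 * (n1 * M3))] ->
    `|X| <= c * a -> `|z *m X| <= K * a * `|z|.
  move=> a0 cI Xc; apply: le_trans (mulmx_norm _ _) _.
  rewrite mulrAC; apply: ler_wpM2r => //.
  apply: le_trans (_ : N%:R * (c * a) <= _); first exact: ler_wpM2l.
  by rewrite mulrA; apply: ler_wpM2r => //; exact: KM.
exists d, K; split=> //; first by move=> y /dP[].
split.
- move=> x u z /dP[_ h _ _]; apply: (fin _ _ (n1 * M1)) => //; first by rewrite !inE eqxx.
  by rewrite mulrAC; apply: norm_sum_coord.
- move=> x u w z xb; have [Ux _ _ _] := dP _ xb.
  rewrite -[K * _ * _]mulrA; apply: (fin _ _ (n1 * (n1 * M2))); first by rewrite mulr_ge0.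
    by rewrite !inE eqxx orbT.
  rewrite deriv_cform//; apply: le_trans (norm_sum_coord _ (fun j => D1 j w x xb)) _.
  by rewrite le_eqVlt; apply/orP; left; apply/eqP; rewrite -/n1; ring.
- move=> x u w z xb xwb.
  rewrite -[K * _ * _]mulrA; apply: (fin _ _ (n1 * (n1 * M2))); first by rewrite mulr_ge0.
    by rewrite !inE eqxx orbT.
  rewrite /cform -sumrB; under eq_bigr do rewrite -scalerBr.
  apply: le_trans (norm_sum_coord _ (fun j => L1 j w x xb xwb)) _.
  by rewrite le_eqVlt; apply/orP; left; apply/eqP; rewrite -/n1; ring.
move=> x u w z xb xwb; have [Ux _ _ _] := dP _ xb.
rewrite -[K * _ * _]mulrA; apply: (fin _ _ (n1 * (n1 * (n1 * M3)))).
- by rewrite mulr_ge0// exprn_ge0.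
- by rewrite !inE eqxx !orbT.
rewrite deriv_cform// /cform -!sumrB; under eq_bigr do rewrite -!scalerBr.
apply: le_trans (norm_sum_coord _ (fun j => L2 j w x xb xwb)) _.
by rewrite le_eqVlt; apply/orP; left; apply/eqP; rewrite -/n1; ring.
Qed.

(** For each direction xi the equation is solved along the ray x0 + t xi, and Y (x0 + xi) is the
    value at t = 1. What has to be proved is that Y has the prescribed derivative across the rays as
    well; this is the quadratic estimate [key]. *)
Lemma frobenius : exists2 d : R, 0 < d & exists2 Y : V -> 'rV[R]_N, Y x0 = y0 &
  ball x0 d `<=` U /\ forall x, ball x0 d x ->
    differentiable Y x /\ forall u, 'D_u Y x = Y x *m cform x u.
Proof.
have [d [K [d0 K0 dU [bA bDA bL bT]]]] := frobenius_bounds.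
(* The bound d / 2 keeps the rays in the ball up to parameter 2, and the last one gives K |xi| <=
   1/16, small enough for both [linear_ode] and [small_gronwall]. *)
pose r := Num.min (d / 2) (Num.min 1 (16 * K + 1)^-1).
have K160 : 0 < 16 * K + 1 by rewrite ltr_wpDl// mulr_ge0.
have r0 : 0 < r by rewrite !lt_min divr_gt0// ltr01/= invr_gt0.
have r1 : r <= 1 by rewrite !ge_min lexx orbT.
have rd : r * 2 <= d by rewrite -ler_pdivlMr// ge_min lexx.
have rK : K * r <= 1 / 16.
  have : r <= (16 * K + 1)^-1 by rewrite !ge_min lexx !orbT.
  rewrite -[leRHS]mul1r ler_pdivlMr// => h.
  have := ltW r0; lra.
have inb (xi : V) (t : R) : `|xi| < r -> -2 <= t <= 2 -> ball x0 d (x0 + t *: xi).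
  move=> xr tI; rewrite -ball_normE/= opprD addNKr normrN normrZ.
  have : `|t| <= 2 by rewrite ler_norml.
  move=> t2; apply: lt_le_trans rd.
  apply: (@le_lt_trans _ _ (2 * `|xi|)); first exact: ler_wpM2r.
  by rewrite mulrC ltr_pM2r.
have line_diff (W : normedModType R) (F : V -> W) xi (t : R) :
    differentiable F (x0 + t *: xi) ->
    differentiable (fun s : R => F (x0 + s *: xi)) t /\
    'D_1 (fun s : R => F (x0 + s *: xi)) t = 'D_xi F (x0 + t *: xi).
  by move=> dF; have [d1 E] := line_derive dF; split; [exact/derivable1_diffP|exact: E].
have ex_ray (xi : V) : exists y : R -> 'rV[R]_N, `|xi| < r -> y 0 = y0 /\
    forall t : R, -2 < t < 2 -> differentiable y t /\ 'D_1 y t = y t *m cform (x0 + t *: xi) xi.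
  have [xr|nxr] := ltP `|xi| r; last by exists (fun=> 0).
  have [||y y00 yP] := @linear_ode R N (fun t => cform (x0 + t *: xi) xi) y0.
  - move=> t tI; apply: differentiable_continuous.
    by apply: (line_diff _ (cform ^~ xi) xi t _).1; apply: diff_cform; exact/dU/inb.
  - move=> t z tI; apply: le_trans (bA _ xi z (inb _ _ xr tI)) _.
    have h : K * `|xi| <= 1 / 16 by apply: le_trans rK; rewrite ler_wpM2l// ltW.
    have : K * `|xi| * `|z| <= 1 / 16 * `|z| by exact: ler_wpM2r.
    have := normr_ge0 z; lra.
  by exists y.
have {ex_ray}[y yP] := choice ex_ray.
have in2 (t : R) : 0 <= t <= 1 -> -2 < t < 2 by move=> ?; lra.
have in2' (t : R) : 0 <= t <= 1 -> -2 <= t <= 2 by move=> ?; lra.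
have yB (xi : V) (t : R) : `|xi| < r -> 0 <= t <= 1 -> `|y xi t| <= 2 * `|y0|.
  move=> xr; move: t; have [y00 yD] := yP _ xr.
  have H : forall t : R, 0 <= t <= 1 -> `|y xi t - y0| <= 2 * (`|y0| / 16).
    apply: small_gronwall; [by rewrite divr_ge0|by rewrite y00 subrr|].
    move=> t tI; have [dy Dy] := yD _ (in2 _ tI).
    split; first by apply: differentiableB => //; exact: diff_cst'.
    rewrite derivB// deriv_cst subr0 Dy.
    have h : K * `|xi| <= 1 / 16 by apply: le_trans rK; rewrite ler_wpM2l// ltW.
    apply: le_trans (bA _ xi _ (inb _ _ xr (in2' _ tI))) _.
    have h1 : K * `|xi| * `|y xi t| <= 1 / 16 * `|y xi t| by exact: ler_wpM2r.
    have h2 : `|y xi t| <= `|y xi t - y0| + `|y0| by rewrite -{1}[y xi t](subrK y0) ler_normD.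
    have := normr_ge0 (y xi t - y0); lra.
  move=> t /H h; have h2 : `|y xi t| <= `|y xi t - y0| + `|y0| by rewrite -{1}[y xi t](subrK y0) ler_normD.
  have := normr_ge0 y0; lra.
(* The factor 2 is that of [small_gronwall]; 4 K and 4 K^2 collect the quadratic error terms found
   below. *)
pose C := 2 * ((4 * K + 4 * K * K) * `|y0|).
have C0 : 0 <= C by rewrite !mulr_ge0// addr_ge0// !mulr_ge0.
have key (xi h : V) : `|xi| < r -> `|xi + h| < r ->
    `|y (xi + h) 1 - y xi 1 - y xi 1 *m cform (x0 + xi) h| <= C * `|h| ^+ 2.
  move=> xr xhr; have [y00 yD] := yP _ xr; have [z00 zD] := yP _ xhr.
  (* The error of the expected first variation in xi. At parameter t the point x0 + t xi moves by t
     h, whence the factor t. *)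
  pose q (t : R) := y (xi + h) t - y xi t - t *: (y xi t *m cform (x0 + t *: xi) h).
  have h2r : `|h| <= 2 * r.
    have -> : h = (xi + h) - xi by rewrite addrC addKr.
    by rewrite (le_trans (ler_normB _ _))//; have := ltW xr; have := ltW xhr; lra.
  suff : forall t : R, 0 <= t <= 1 -> `|q t| <= 2 * ((4 * K + 4 * K * K) * `|y0| * `|h| ^+ 2).
    move=> H; rewrite /C -mulrA; have := H 1; rewrite /q !scale1r; apply.
    by rewrite lexx ler01.
  apply: small_gronwall.
  - by rewrite !mulr_ge0// addr_ge0// !mulr_ge0.
  - by rewrite /q z00 y00 scale0r subr0 subrr.
  move=> t tI; have [dy Dy] := yD _ (in2 _ tI); have [dz Dz] := zD _ (in2 _ tI).
  have xb := inb _ _ xr (in2' _ tI); have xhb := inb _ _ xhr (in2' _ tI).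
  set xt := x0 + t *: xi in Dy xb *.
  have Uxt : U xt by exact: dU.
  have [dl Dl] := line_diff _ (cform ^~ h) xi t (diff_cform h Uxt).
  have dm := diff_mulmx dy dl.
  have did : differentiable (fun t : R => t) t by exact: (@ex_diff _ _ _ _ _ id).
  have dt := diff_scale did dm.
  have dzy := differentiableB dz dy.
  split; first exact: differentiableB.
  (* Flatness trades the derivative of A(h) along xi for that of A(xi) along h plus a commutator.
     What remains is linear in q, or is a Taylor remainder or increment of A, or contains the
     difference of the two solutions times a term of order h; the difference is itself of order h up
     to q. *)
  have -> : 'D_1 q t = q t *m cform xt xi
      + (y (xi + h) t *m (cform (xt + t *: h) xi - cform xt xi - 'D_(t *: h) (cform ^~ xi) xt)
         + y (xi + h) t *m (cform (xt + t *: h) h - cform xt h))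
      + ((y (xi + h) t - y xi t) *m cform xt h + (y (xi + h) t - y xi t) *m 'D_(t *: h) (cform ^~ xi) xt).
    have -> : 'D_1 q t = _ := derivB (1 : R) dzy dt.
    rewrite (derivB (1 : R) dz dy) (deriv_scale (1 : R) did dm) (deriv_mulmx (1 : R) dy dl) Dl Dy Dz derive_id scale1r.
    rewrite -/xt.
    have -> : x0 + t *: (xi + h) = xt + t *: h by rewrite scalerDr addrA.
    rewrite (cformD _ xi h).
    have Fl := flat xi h Uxt.
    have -> : 'D_xi (cform ^~ h) xt = 'D_h (cform ^~ xi) xt + cform xt h *m cform xt xi - cform xt xi *m cform xt h.
      by apply/eqP; rewrite eq_sym subr_eq -Fl.
    have -> : 'D_(t *: h) (cform ^~ xi) xt = t *: 'D_h (cform ^~ xi) xt.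
      have dc := diff_cform xi Uxt; rewrite (deriveE _ dc) (deriveE _ dc) linearZ.
      by [].
    rewrite /q -/xt; move: (cform xt xi) (cform xt h) (cform (xt + t *: h) xi) (cform (xt + t *: h) h).
    move: ('D_h (cform ^~ xi) xt) (y (xi + h) t) (y xi t) => Q z w a b a' b'.
    rewrite !(mulmxDr, mulmxDl, mulmxN, mulNmx, =^~ scalemxAr, =^~ scalemxAl) !mulmxA.
    move: (z *m a') (z *m b') (w *m a *m b) (w *m b *m a) (z *m a) (z *m b) (z *m Q) (w *m Q) (w *m b) (w *m a).
    move=> *; apply/rowP => j; rewrite !mxE; ring.
  have th : `|t *: h| <= `|h|.
    by case/andP: tI => ? ?; rewrite normrZ ger0_norm// ler_piMl.
  have xb' : ball x0 d (xt + t *: h) by rewrite /xt -addrA -scalerDr.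
  have zB := yB _ _ xhr tI.
  set z := y (xi + h) t in zB *; set w := y xi t.
  have T1 := bT xt xi (t *: h) z xb xb'.
  have T2 := bL xt h (t *: h) z xb xb'.
  have T3 := bA xt xi (q t) xb.
  have T4 := bA xt h (z - w) xb.
  have T5 := bDA xt xi (t *: h) (z - w) xb.
  have T6 := bA xt h w xb.
  have wB := yB _ _ xr tI; rewrite -/w in wB.
  have zwE : `|z - w| <= `|q t| + `|w *m cform xt h|.
    have -> : z - w = q t + t *: (w *m cform xt h) by rewrite /q subrK.
    rewrite (le_trans (ler_normD _ _))// lerD2l normrZ.
    by case/andP: tI => ? ?; rewrite ger0_norm// ler_piMl.
  pose H : R := `|h|; pose Q := `|q t|; pose Z0 := `|y0|.
  have H0 : 0 <= H by exact: normr_ge0.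
  have Q0 : 0 <= Q by exact: normr_ge0.
  have Z00 : 0 <= Z0 by exact: normr_ge0.
  have KH : K * H <= 1 / 8.
    by apply: le_trans (_ : K * (2 * r) <= _); [exact: ler_wpM2l|lra].
  have KH0 : 0 <= K * H by exact: mulr_ge0.
  have xi1 : `|xi| <= 1 by apply: le_trans r1; exact: ltW.
  have Kxi : K * `|xi| <= 1 / 16 by apply: le_trans rK; rewrite ler_wpM2l// ltW.
  have B1 : K * `|t *: h| ^+ 2 * `|xi| * `|z| <= K * H ^+ 2 * (2 * Z0).
    apply: ler_pM => //; [by rewrite !mulr_ge0// exprn_ge0|].
    rewrite -[leRHS]mulr1; apply: ler_pM => //; first by rewrite mulr_ge0// exprn_ge0.
    by apply: ler_wpM2l => //; apply: lerXn2r; rewrite ?nnegrE.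
  have B2 : K * `|t *: h| * `|h| * `|z| <= K * H ^+ 2 * (2 * Z0).
    rewrite expr2 [K * (H * H)]mulrA.
    apply: ler_pM => //; [by rewrite !mulr_ge0|].
    by apply: ler_wpM2r => //; exact: ler_wpM2l.
  have B3 : K * `|xi| * Q <= 1 / 16 * Q by exact: ler_wpM2r.
  have B6 : `|w *m cform xt h| <= K * H * (2 * Z0).
    by apply: le_trans T6 _; exact: ler_wpM2l.
  have B5 : K * `|t *: h| * `|xi| * `|z - w| <= K * H * `|z - w|.
    apply: ler_wpM2r => //; rewrite -[leRHS]mulr1; apply: ler_pM => //.
      by rewrite mulr_ge0.
    exact: ler_wpM2l.
  have B7 : K * H * `|z - w| <= K * H * (Q + K * H * (2 * Z0)).
    by apply: ler_wpM2l => //; apply: le_trans zwE _; rewrite lerD2l.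
  have B8 : K * H * Q <= 1 / 8 * Q by exact: ler_wpM2r.
  rewrite -/Q in T3 *.
  apply: (@le_trans _ _ (K * `|xi| * Q + (K * H ^+ 2 * (2 * Z0) + K * H ^+ 2 * (2 * Z0)) + (K * H * `|z - w| + K * H * `|z - w|))).
    apply: le_trans (ler_normD _ _) _; apply: lerD.
      apply: le_trans (ler_normD _ _) _; apply: lerD => //.
      apply: le_trans (ler_normD _ _) _; apply: lerD.
        exact: le_trans T1 _.
      exact: le_trans T2 _.
    apply: le_trans (ler_normD _ _) _; apply: lerD => //.
    exact: le_trans T5 _.
  rewrite mulrDr in B7.
  have -> : (4 * K + 4 * K * K) * `|y0| * `|h| ^+ 2 = 2 * (K * H ^+ 2 * (2 * Z0)) + 2 * (K * H * (K * H * (2 * Z0))).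
    by rewrite /H /Z0; ring.
  move: B3 B7 B8; move: (K * `|xi| * Q) (K * H * `|z - w|) (K * H * Q) (K * H ^+ 2 * (2 * Z0)) (K * H * (K * H * (2 * Z0))) => b1 b2 b3 b4 b5 *.
  by lra.
have r0' : `|0 : V| < r by rewrite normr0.
have y0t (t : R) : 0 <= t <= 1 -> y 0 t = y0.
  have [y00 yD] := yP _ r0'.
  move=> tI; apply/eqP; rewrite -subr_eq0 -normr_le0.
  have := @small_gronwall R N (fun t => y 0 t - y0) 0 (lexx _).
  rewrite mulr0; apply => //; first by rewrite y00 subrr.
  move=> s sI; have [dy Dy] := yD _ (in2 _ sI).
  split; first by apply: differentiableB => //; exact: diff_cst'.
  rewrite derivB// deriv_cst subr0 Dy.
  have -> : cform (x0 + s *: 0) 0 = 0.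
    by rewrite /cform big1// => j _; rewrite mxE scale0r.
  by rewrite mulmx0 normr0 addr0 divr_ge0.
exists r => //; exists (fun x => y (x - x0) 1).
  by rewrite subrr y0t// lexx ler01.
split; first by move=> x xb; apply: dU; move: xb; apply: le_ball; have := ltW r0; lra.
move=> x; rewrite -ball_normE /= distrC => xr.
pose z := y (x - x0) 1.
have [|dY DY] := @differentiable_approx_rV R n _ (fun x => y (x - x0) 1) (fun j => z *m B j x) x.
- move=> e e0; have C10 : 0 < C + 1 by rewrite ltr_wpDl.
  apply/nbhs_ballP; exists (Num.min (r - `|x - x0|) (e / (C + 1))).
    by rewrite /= lt_min subr_gt0 xr divr_gt0.
  move=> w; rewrite -ball_normE/= distrC lt_min => /andP[w1 w2].
  have wr : `|(x - x0) + (w - x)| < r.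
    by apply: le_lt_trans (ler_normD _ _) _; rewrite -ltrBrDl.
  have := key _ _ xr wr.
  have -> : x - x0 + (w - x) = w - x0 by rewrite addrC addrA subrK.
  have -> : x0 + (x - x0) = x by rewrite addrC subrK.
  have -> : y (x - x0) 1 *m cform x (w - x) = \sum_j (w - x) ord0 j *: (z *m B j x).
    by rewrite /cform mulmx_sumr; apply: eq_bigr => j _; rewrite -scalemxAr.
  move=> /le_trans; apply; rewrite expr2 mulrA; apply: ler_wpM2r => //.
  have : `|w - x| * (C + 1) < e by rewrite -ltr_pdivlMr.
  have := normr_ge0 (w - x); lra.
split=> // u; rewrite DY /cform mulmx_sumr.
by apply: eq_bigr => j _; rewrite -scalemxAr.
Qed.

End Frobenius.

(** * Bilinear forms, Levi-Civita connection and curvature *)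

Section BilinearForms.
Variables (R : realType) (n : nat).
Implicit Types (A B : 'M[R]_n) (u v w : 'rV[R]_n).

Lemma bformDl A u v w : bform A (u + v) w = bform A u w + bform A v w.
Proof. by rewrite /bform !mulmxDl mxE. Qed.

Lemma bformDr A u v w : bform A u (v + w) = bform A u v + bform A u w.
Proof. by rewrite /bform linearD mulmxDr mxE. Qed.

Lemma bformZl A a u w : bform A (a *: u) w = a * bform A u w.
Proof. by rewrite /bform -!scalemxAl mxE. Qed.

Lemma bformZr A a u w : bform A u (a *: w) = a * bform A u w.
Proof. by rewrite /bform linearZ -scalemxAr mxE. Qed.

Lemma bformNl A u w : bform A (- u) w = - bform A u w.
Proof. by rewrite -scaleN1r bformZl mulN1r. Qed.

Lemma bformNr A u w : bform A u (- w) = - bform A u w.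
Proof. by rewrite -scaleN1r bformZr mulN1r. Qed.

Lemma bformBl A u v w : bform A (u - v) w = bform A u w - bform A v w.
Proof. by rewrite bformDl bformNl. Qed.

Lemma bformBr A u v w : bform A u (v - w) = bform A u v - bform A u w.
Proof. by rewrite bformDr bformNr. Qed.

Lemma bform0l A w : bform A 0 w = 0.
Proof. by rewrite /bform !mul0mx mxE. Qed.

Lemma bform0r A w : bform A w 0 = 0.
Proof. by rewrite /bform linear0 mulmx0 mxE. Qed.

Lemma bform_suml A I (r : seq I) (P : pred I) (f : I -> 'rV[R]_n) w :
  bform A (\sum_(i <- r | P i) f i) w = \sum_(i <- r | P i) bform A (f i) w.
Proof. by rewrite /bform !mulmx_suml summxE. Qed.

Lemma bform_sumr A I (r : seq I) (P : pred I) (f : I -> 'rV[R]_n) w :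
  bform A w (\sum_(i <- r | P i) f i) = \sum_(i <- r | P i) bform A w (f i).
Proof. by rewrite /bform linear_sum mulmx_sumr summxE. Qed.

Lemma bformDm A B u v : bform (A + B) u v = bform A u v + bform B u v.
Proof. by rewrite /bform mulmxDr mulmxDl mxE. Qed.

Lemma bformZm A a u v : bform (a *: A) u v = a * bform A u v.
Proof. by rewrite /bform -scalemxAr -scalemxAl mxE. Qed.

Lemma bformNm A u v : bform (- A) u v = - bform A u v.
Proof. by rewrite -scaleN1r bformZm mulN1r. Qed.

Lemma bform_summ I (r : seq I) (P : pred I) (f : I -> 'M[R]_n) u v :
  bform (\sum_(i <- r | P i) f i) u v = \sum_(i <- r | P i) bform (f i) u v.
Proof. by rewrite /bform mulmx_sumr mulmx_suml summxE. Qed.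

Lemma bform_tr A u v : bform A^T u v = bform A v u.
Proof.
rewrite /bform (_ : u *m A^T *m v^T = (v *m A *m u^T)^T) ?mxE//.
by rewrite !trmx_mul trmxK mulmxA.
Qed.

Lemma bformC A u v : A^T = A -> bform A u v = bform A v u.
Proof. by move=> AT; rewrite -{1}AT bform_tr. Qed.

Lemma bform_mull A B u v : bform A (u *m B) v = bform (B *m A) u v.
Proof. by rewrite /bform !mulmxA. Qed.

Lemma bform_mulr A B u v : bform A u (v *m B) = bform (A *m B^T) u v.
Proof. by rewrite /bform trmx_mul !mulmxA. Qed.

Lemma bform_delta A i j : bform A (delta_mx ord0 i) (delta_mx ord0 j) = A i j.
Proof. by rewrite /bform -rowE trmx_delta -colE !mxE. Qed.

Lemma bform_deltar A u j : bform A u (delta_mx ord0 j) = (u *m A) ord0 j.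
Proof. by rewrite /bform trmx_delta -colE !mxE. Qed.

Lemma bform_eq A B : (forall u v, bform A u v = bform B u v) -> A = B.
Proof. by move=> AB; apply/matrixP => i j; rewrite -!bform_delta AB. Qed.

Lemma bform_sumE A u v : bform A u v = \sum_i \sum_j u ord0 i * v ord0 j * A i j.
Proof.
rewrite {1}(row_sum_delta u) {1}(row_sum_delta v) bform_suml.
apply: eq_bigr => i _; rewrite bform_sumr; apply: eq_bigr => j _.
by rewrite bformZl bformZr bform_delta mulrA.
Qed.

Lemma bform_expandr A u v : bform A u v = \sum_j v ord0 j * (u *m A) ord0 j.
Proof.
rewrite {1}(row_sum_delta v) bform_sumr; apply: eq_bigr => j _.
by rewrite bformZr bform_deltar.
Qed.

Definition posdef A := A^T = A /\ forall v, v != 0 -> 0 < bform A v v.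

Lemma posdef_unit A : posdef A -> A \in unitmx.
Proof.
case=> _ posA; rewrite -row_free_unit -kermx_eq0 -submx0.
apply/rV_subP => v /sub_kermxP vA; rewrite submx0; apply/negPn/negP => /posA.
by rewrite /bform vA mul0mx mxE ltxx.
Qed.

Lemma bform_ndeg A v : posdef A -> (forall w, bform A v w = 0) -> v = 0.
Proof.
case=> _ posA v0; apply/eqP/negPn/negP => /posA.
by rewrite v0 ltxx.
Qed.

Lemma bform_injl A u v : posdef A -> (forall w, bform A u w = bform A v w) -> u = v.
Proof.
move=> pA uv; apply/eqP; rewrite -subr_eq0; apply/eqP; apply: (bform_ndeg pA) => w.
by rewrite bformBl uv subrr.
Qed.

End BilinearForms.

Section SmoothMatrices.
Variables (R : realType) (V : normedModType R).

Lemma smoothn_mx m n k (U : set V) (F : V -> 'M[R]_(m, n)) : open U ->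
  (forall i j, smoothn k U (fun y => F y i j)) -> smoothn k U F.
Proof.
move=> oU sF; apply: (smoothn_congr oU (F := fun y => \sum_i \sum_j F y i j *: delta_mx i j)).
  by move=> x _; rewrite [RHS]matrix_sum_delta.
apply: smoothn_sum => // i; apply: smoothn_sum => // j.
by apply: smoothn_scale => //; exact: smoothn_cst.
Qed.

Lemma smoothn_coord m n k (U : set V) (F : V -> 'M[R]_(m, n)) i j : open U ->
  smoothn k U F -> smoothn k U (fun y => F y i j).
Proof.
pose c (A : 'M[R]_(m, n)) : R := A i j.
have linc : linear c by move=> a A B; rewrite /c !mxE.
pose LM := GRing.isLinear.Build _ _ _ _ _ linc.
pose L : {linear 'M[R]_(m, n) -> R} := HB.pack c LM.
exact: (@smoothn_lin R V m n R k U L F).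
Qed.

Lemma smoothn_prod k (U : set V) I (r : seq I) (P : pred I) (f : I -> V -> R) : open U ->
  (forall i, smoothn k U (f i)) -> smoothn k U (fun y => \prod_(i <- r | P i) f i y).
Proof.
move=> oU sf; elim: r => [|i r IH].
  by under eq_fun do rewrite big_nil; exact: smoothn_cst.
under eq_fun do rewrite big_cons; case: (P i) => //.
exact: smoothn_mul.
Qed.

Lemma smoothn_det n k (U : set V) (F : V -> 'M[R]_n) : open U ->
  smoothn k U F -> smoothn k U (fun y => \det (F y)).
Proof.
move=> oU sF; apply: smoothn_sum => // s; apply: smoothn_mul => //; first exact: smoothn_cst.
by apply: smoothn_prod => // i; exact: smoothn_coord.
Qed.

Lemma smoothn_adj n k (U : set V) (F : V -> 'M[R]_n) : open U ->
  smoothn k U F -> smoothn k U (fun y => \adj (F y)).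
Proof.
move=> oU sF; apply: smoothn_mx => // i j; under eq_fun do rewrite mxE.
apply: smoothn_mul => //; first exact: smoothn_cst.
apply: smoothn_det => //; apply: smoothn_mx => // a b; under eq_fun do rewrite !mxE.
exact: smoothn_coord.
Qed.

Lemma deriv_inv (f : V -> R) x v : f x != 0 -> differentiable f x ->
  'D_v (fun y => (f y)^-1) x = - ((f x)^-1 * ((f x)^-1 * 'D_v f x)).
Proof.
move=> fx df; have H := @deriveV _ _ f x v fx (diff_derivable df).
by rewrite [LHS]H -exprVn expr2 scaleNr -scalerA.
Qed.

Lemma smoothn_inv k (U : set V) (f : V -> R) : open U -> (forall x, U x -> f x != 0) ->
  smoothn k U f -> smoothn k U (fun y => (f y)^-1).
Proof.
move=> oU f0; elim: k => [|k IH].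
  by move=> /smoothn0 sf; apply/smoothn0 => x Ux; apply: differentiableV; [exact: sf|exact: f0].
move=> sf; have /smoothnS[df sDf] := sf; have sI := IH (smoothn_le (leqnSn k) sf).
apply/smoothnS; split=> [x Ux|v].
  by apply: differentiableV; [exact: df|exact: f0].
apply: (smoothn_congr oU (F := fun y => - ((f y)^-1 * ((f y)^-1 * 'D_v f y)))).
  by move=> x Ux; rewrite deriv_inv//; [exact: f0|exact: df].
by apply: smoothnN => //; apply: smoothn_mul => //; apply: smoothn_mul.
Qed.

Lemma smoothn_invmx n k (U : set V) (F : V -> 'M[R]_n) : open U ->
  (forall x, U x -> F x \in unitmx) ->
  smoothn k U F -> smoothn k U (fun y => invmx (F y)).
Proof.
move=> oU uF sF; apply: (smoothn_congr oU (F := fun y => (\det (F y))^-1 *: \adj (F y))).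
  by move=> x Ux; rewrite /invmx uF.
apply: smoothn_scale => //; last exact: smoothn_adj.
by apply: smoothn_inv => //; [move=> x /uF; rewrite unitmxE unitfE|exact: smoothn_det].
Qed.

End SmoothMatrices.

Section FormDerivatives.
Variables (R : realType) (W : normedModType R) (n : nat).

Lemma diff_trmx m (F : W -> 'M[R]_(m, n)) x : differentiable F x -> differentiable (fun y => (F y)^T) x.
Proof. exact: (@diff_lin' R W m n _ (@trmx R m n)). Qed.

Lemma deriv_trmx m (F : W -> 'M[R]_(m, n)) x v :
  differentiable F x -> 'D_v (fun y => (F y)^T) x = ('D_v F x)^T.
Proof. exact: (@deriv_lin R W m n _ (@trmx R m n)). Qed.

Lemma diff_bform (G : W -> 'M[R]_n) (X Y : W -> 'rV[R]_n) x :
  differentiable G x -> differentiable X x -> differentiable Y x ->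
  differentiable (fun y => bform (G y) (X y) (Y y)) x.
Proof.
move=> dG dX dY; have := diff_mulmx (diff_mulmx dX dG) (diff_trmx dY).
by move/differentiable_mxP; apply.
Qed.

Lemma deriv_bform (G : W -> 'M[R]_n) (X Y : W -> 'rV[R]_n) x v :
  differentiable G x -> differentiable X x -> differentiable Y x ->
  'D_v (fun y => bform (G y) (X y) (Y y)) x =
  bform ('D_v G x) (X x) (Y x) + bform (G x) ('D_v X x) (Y x) + bform (G x) (X x) ('D_v Y x).
Proof.
move=> dG dX dY; have d1 := diff_mulmx dX dG; have d2 := diff_trmx dY.
have d3 := diff_mulmx d1 d2.
rewrite /bform (deriv_coord _ _ _ d3) (deriv_mulmx _ d1 d2) (deriv_mulmx _ dX dG) (deriv_trmx _ dY).
by rewrite mulmxDl [LHS]mxE [X in X + _]mxE [X in X + _ = _]addrC.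
Qed.

Lemma diff_bform_cst (G : W -> 'M[R]_n) a b x :
  differentiable G x -> differentiable (fun y => bform (G y) a b) x.
Proof. by move=> dG; apply: (diff_bform dG); exact: diff_cst'. Qed.

Lemma deriv_bform_cst (G : W -> 'M[R]_n) a b x v :
  differentiable G x -> 'D_v (fun y => bform (G y) a b) x = bform ('D_v G x) a b.
Proof.
move=> dG; rewrite (deriv_bform _ dG (diff_cst' a x) (diff_cst' b x)).
by rewrite !deriv_cst bform0l bform0r !addr0.
Qed.

Lemma smoothn_bform k (U : set W) (G : W -> 'M[R]_n) (X Y : W -> 'rV[R]_n) : open U ->
  smoothn k U G -> smoothn k U X -> smoothn k U Y ->
  smoothn k U (fun y => bform (G y) (X y) (Y y)).
Proof.
move=> oU sG sX sY; apply: (@smoothn_coord _ _ 1 1 k U (fun y => X y *m G y *m (Y y)^T)) => //.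
apply: smoothn_mulmx => //; first exact: smoothn_mulmx.
exact: (@smoothn_lin R W 1 n _ k U (@trmx R 1 n) Y).
Qed.

End FormDerivatives.

(** * The Koszul formula at one point *)

Section Koszul.
Variables (R : realType) (n : nat) (g : 'M[R]_n) (D : 'rV[R]_n -> 'M[R]_n).
Local Notation V := ('rV[R]_n).
Local Notation e_ i := (delta_mx ord0 i : V).
Hypothesis pg : posdef g.
Hypothesis DT : forall u, (D u)^T = D u.
Hypothesis DE : forall u, D u = \sum_j u ord0 j *: D (e_ j).

(** Twice the Christoffel symbols of the first kind, with [D u] standing for the derivative of the
    metric along u; [bform_koszul] gives the usual three terms. *)
Definition koszul u : 'M[R]_n := D u +
  \matrix_(i, l) ((u *m D (e_ i)) ord0 l - (u *m D (e_ l)) ord0 i).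

Definition koszul_gam u : 'M[R]_n := (2^-1 *: koszul u) *m invmx g.

Lemma bform_koszul u v w :
  bform (koszul u) v w = bform (D u) v w + bform (D v) u w - bform (D w) u v.
Proof.
rewrite bformDm -addrA; congr (_ + _).
rewrite bform_sumE (DE v) (DE w) !bform_summ.
transitivity (\sum_i \sum_j (v ord0 i * w ord0 j * (u *m D (e_ i)) ord0 j
   - v ord0 i * w ord0 j * (u *m D (e_ j)) ord0 i)).
  by apply: eq_bigr => i _; apply: eq_bigr => j _; rewrite mxE mulrBr.
under eq_bigr => i _ do rewrite sumrB.
rewrite sumrB; congr (_ - _).
  apply: eq_bigr => i _; rewrite bformZm bform_expandr mulr_sumr.
  by apply: eq_bigr => j _; rewrite mulrA.
rewrite exchange_big; apply: eq_bigr => j _; rewrite bformZm bform_expandr mulr_sumr.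
by apply: eq_bigr => i _; rewrite mulrA [_ * w _ _]mulrC.
Qed.

Lemma koszul_row u v :
  2^-1 *: (\row_l (bform (D u) v (e_ l) + bform (D v) u (e_ l) - bform (D (e_ l)) u v))
    *m invmx g = v *m koszul_gam u.
Proof.
rewrite /koszul_gam mulmxA -[v *m (_ *: _)]scalemxAr.
congr ((_ *: _) *m _); apply/rowP => l; rewrite mxE.
by rewrite -bform_koszul bform_deltar.
Qed.

Lemma bform_koszul_gam u v w : bform g (v *m koszul_gam u) w =
  2^-1 * (bform (D u) v w + bform (D v) u w - bform (D w) u v).
Proof.
rewrite bform_mull /koszul_gam mulmxKV; last exact/posdef_unit.
by rewrite bformZm bform_koszul.
Qed.

Lemma koszul_compat u v w :
  bform (D u) v w = bform g (v *m koszul_gam u) w + bform g v (w *m koszul_gam u).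
Proof.
rewrite (bformC v _ (proj1 pg)) !bform_koszul_gam (bformC w v (DT u)).
have E (a b c : R) : a = 2^-1 * (a + b - c) + 2^-1 * (a + c - b) by lra.
exact: E.
Qed.

Lemma koszul_compat_mx u : D u = koszul_gam u *m g + g *m (koszul_gam u)^T.
Proof.
by apply: bform_eq => v w; rewrite koszul_compat bform_mull bform_mulr bformDm.
Qed.

Lemma koszul_sym u v : v *m koszul_gam u = u *m koszul_gam v.
Proof.
apply: (bform_injl pg) => w; rewrite !bform_koszul_gam (bformC v u (DT w)).
by congr (_ * (_ - _)); exact: addrC.
Qed.

(** The row vector on the left enters linearly by construction, and [koszul_sym] exchanges it with
    the direction. *)
Lemma koszul_gamP a u v : koszul_gam (a *: u + v) = a *: koszul_gam u + koszul_gam v.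
Proof.
apply: bform_eq => w z.
suff E : w *m koszul_gam (a *: u + v) = w *m (a *: koszul_gam u + koszul_gam v).
  by rewrite /bform E.
by rewrite koszul_sym mulmxDl -scalemxAl mulmxDr -scalemxAr !(koszul_sym _ w).
Qed.

End Koszul.

(** * The Levi-Civita connection in a chart and the identities of its curvature *)

Section LeviCivita.
Variables (R : realType) (n : nat) (U : set 'rV[R]_n) (G : 'rV[R]_n -> 'M[R]_n).
Local Notation V := ('rV[R]_n).
Local Notation e_ i := (delta_mx ord0 i : V).
Hypothesis oU : open U.
Hypothesis sG : forall k, smoothn k U G.
Hypothesis pG : forall x, U x -> posdef (G x).

Let dG x : U x -> differentiable G x.
Proof. move=> Ux; exact: (smoothn_diff (@sG 0%N) Ux). Qed.

Lemma near_U (x : V) (P : V -> Prop) : U x -> (forall y, U y -> P y) -> \forall y \near x, P y.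
Proof.
by move=> Ux UP; have := open_nbhs_nbhs (conj oU Ux); apply: filterS.
Qed.

Lemma derive_eq_on (W : normedModType R) (F F' : V -> W) x v : U x ->
  (forall y, U y -> F y = F' y) -> 'D_v F x = 'D_v F' x.
Proof. by move=> Ux FF; apply: near_eq_derive; exact: near_U. Qed.

Lemma dG_sym x v : U x -> ('D_v G x)^T = 'D_v G x.
Proof.
move=> Ux; rewrite -deriv_trmx; last exact: dG.
by apply: derive_eq_on => // y /pG[].
Qed.

(** Connection matrix along u: the covariant derivative along u of a field with constant components
    v is v *m gam x u. *)
Definition gam x u : 'M[R]_n := koszul_gam (G x) (fun w => 'D_w G x) u.

Let DE x (Ux : U x) u : 'D_u G x = \sum_j u ord0 j *: 'D_(e_ j) G x.
Proof. exact: derive_basis (dG Ux). Qed.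

Lemma christoffel_gam x u v : U x -> christoffel G x u v = v *m gam x u.
Proof.
move=> Ux; rewrite -(koszul_row (G x) (DE Ux)) /christoffel.
congr ((_ *: _) *m _); apply/rowP => l; rewrite !mxE.
by rewrite !(deriv_bform_cst _ _ _ (dG Ux)).
Qed.

Lemma gam_compat x u v w : U x ->
  bform ('D_u G x) v w = bform (G x) (v *m gam x u) w + bform (G x) v (w *m gam x u).
Proof. by move=> Ux; exact: (koszul_compat (pG Ux) (fun u => dG_sym u Ux) (DE Ux)). Qed.

Lemma gam_compat_mx x u : U x -> 'D_u G x = gam x u *m G x + G x *m (gam x u)^T.
Proof. by move=> Ux; exact: (koszul_compat_mx (pG Ux) (fun u => dG_sym u Ux) (DE Ux)). Qed.

Lemma gam_sym x u v : U x -> v *m gam x u = u *m gam x v.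
Proof. by move=> Ux; exact: (koszul_sym (pG Ux) (fun u => dG_sym u Ux) (DE Ux)). Qed.

Lemma gamP x a u v : U x -> gam x (a *: u + v) = a *: gam x u + gam x v.
Proof. by move=> Ux; exact: (koszul_gamP (pG Ux) (fun u => dG_sym u Ux) (DE Ux)). Qed.

Lemma gam0 x : U x -> gam x 0 = 0.
Proof. by move=> Ux; have := gamP (-1) 0 0 Ux; rewrite scaler0 addr0 scaleN1r addNr. Qed.

Lemma smoothn_gam k u : smoothn k U (gam ^~ u).
Proof.
have sdG w l : smoothn l U ('D_w G) by have /smoothnS[_] := @sG l.+1.
apply: smoothn_mulmx => //; last by apply: smoothn_invmx => // x /pG/posdef_unit.
apply: smoothn_scale => //; first exact: smoothn_cst.
apply: smoothnD => //; apply: smoothn_mx => // i l.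
under eq_fun do rewrite mxE; apply: smoothnB => //;
  by apply: smoothn_coord => //; apply: smoothn_mulmx => //; exact: smoothn_cst.
Qed.

Lemma diff_gam u x : U x -> differentiable (gam ^~ u) x.
Proof. by move=> Ux; exact: smoothn_diff (@smoothn_gam 0%N u) Ux. Qed.

(* Curvature matrix, acting on row vectors *)
Definition curv x u v : 'M[R]_n :=
  'D_u (gam ^~ v) x - 'D_v (gam ^~ u) x + gam x v *m gam x u - gam x u *m gam x v.

Lemma Rop_curv x u v w : U x -> Rop G x u v w = w *m curv x u v.
Proof.
move=> Ux; rewrite /Rop /curvature_op.
have ch0 : lie_bracket (cst u) (cst v) = cst 0.
  by apply/funext => y; rewrite /lie_bracket !deriv_cst subrr.
have nab a b : nabla G (cst a) (cst b) = fun y => christoffel G y a b.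
  by apply/funext => y; rewrite /nabla deriv_cst add0r.
rewrite ch0 !nab /nabla /cst !(christoffel_gam _ _ Ux) gam0// mulmx0 subr0.
have D a b : 'D_a (fun y => christoffel G y b w) x = w *m 'D_a (gam ^~ b) x.
  rewrite (derive_eq_on _ Ux (fun y Uy => christoffel_gam b w Uy)).
  rewrite (deriv_mulmx _ (diff_cst' w x) (diff_gam b Ux)).
  by rewrite deriv_cst mul0mx add0r.
rewrite !D /curv mulmxBr mulmxDr mulmxBr !mulmxA.
by rewrite opprD addrACA addrA.
Qed.

Lemma smoothn_curv k u v : smoothn k U (fun y => curv y u v).
Proof.
have s1 a : smoothn k U (gam ^~ a) by exact: smoothn_gam.
have s2 a b : smoothn k U ('D_a (gam ^~ b)).
  by have /smoothnS[_] := smoothn_gam (k := k.+1) b.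
apply: smoothnB => //; last exact: smoothn_mulmx.
apply: smoothnD => //; last exact: smoothn_mulmx.
exact: smoothnB.
Qed.

Lemma curv_skew x u v : curv x v u = - curv x u v.
Proof.
rewrite /curv; generalize ('D_u (gam ^~ v) x) ('D_v (gam ^~ u) x) (gam x u) (gam x v).
by move=> *; apply/matrixP => i j; rewrite !mxE; ring.
Qed.

Lemma curvP x a u w v : U x -> curv x (a *: u + w) v = a *: curv x u v + curv x w v.
Proof.
move=> Ux; rewrite /curv (derive_linear_dir _ _ _ (diff_gam v Ux)).
have -> : 'D_v (gam ^~ (a *: u + w)) x = a *: 'D_v (gam ^~ u) x + 'D_v (gam ^~ w) x.
  rewrite (derive_eq_on _ Ux (fun y Uy => gamP a u w Uy)).
  rewrite derivD; [|exact: differentiableZ (diff_gam _ Ux)|exact: diff_gam].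
  by rewrite derivZ//; exact: diff_gam.
rewrite (gamP _ _ _ Ux) mulmxDl mulmxDr -scalemxAl -scalemxAr.
generalize ('D_u (gam ^~ v) x) ('D_w (gam ^~ v) x) ('D_v (gam ^~ u) x) ('D_v (gam ^~ w) x).
generalize (gam x u) (gam x v) (gam x w).
by move=> *; apply/matrixP => i j; rewrite !mxE; ring.
Qed.

(** Differentiating the symmetry [gam_sym] pairs the derivative terms, and the symmetry itself pairs
    the quadratic ones. *)
Lemma curv_bianchi x u v w : U x ->
  w *m curv x u v + u *m curv x v w + v *m curv x w u = 0.
Proof.
move=> Ux.
have D a b c : c *m 'D_a (gam ^~ b) x = b *m 'D_a (gam ^~ c) x.
  have M (d e : V) : d *m 'D_a (gam ^~ e) x = 'D_a (fun y => d *m gam y e) x.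
    by rewrite (deriv_mulmx _ (diff_cst' d x) (diff_gam e Ux)) deriv_cst mul0mx add0r.
  by rewrite (M c b) (M b c); apply: (derive_eq_on _ Ux) => y Uy; exact: gam_sym.
have E1 := D u v w; have E2 := D v u w; have E3 := D w v u.
have S1 := gam_sym v w Ux; have S2 := gam_sym u w Ux; have S3 := gam_sym u v Ux.
rewrite /curv; move: E1 E2 E3 S1 S2 S3.
generalize (gam x u) (gam x v) (gam x w).
generalize ('D_u (gam ^~ v) x) ('D_u (gam ^~ w) x) ('D_v (gam ^~ u) x).
generalize ('D_v (gam ^~ w) x) ('D_w (gam ^~ v) x) ('D_w (gam ^~ u) x).
move=> Dvw Dwv Dwu Duv Duw Dvu gu gv gw E1 E2 E3 S1 S2 S3.
rewrite !(mulmxDr, mulmxN) !mulmxA E1 E2 E3 S1 S2 S3.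
by move=> *; apply/rowP => j; rewrite !mxE; ring.
Qed.

(** Metric compatibility expresses the derivatives of G through [gam]; equality of the mixed second
    derivatives of G is then the skew symmetry of the curvature. *)
Lemma curv_metric x u v : U x ->
  curv x u v *m G x + G x *m (curv x u v)^T = 0.
Proof.
move=> Ux.
have dgam a := diff_gam a Ux; have dgamT a := diff_trmx (dgam a).
have dGx := dG Ux; have GT := (pG Ux).1.
have E a b : 'D_b ('D_a G) x = 'D_b (gam ^~ a) x *m G x + gam x a *m 'D_b G x
    + ('D_b G x *m (gam x a)^T + G x *m ('D_b (gam ^~ a) x)^T).
  have H : forall y, U y -> 'D_a G y = gam y a *m G y + G y *m (gam y a)^T.
    by move=> y Uy; exact: gam_compat_mx.
  apply: (etrans (derive_eq_on b Ux H)).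
  apply: (etrans (derivD b (diff_mulmx (dgam a) dGx) (diff_mulmx dGx (dgamT a)))).
  by rewrite (deriv_mulmx b (dgam a) dGx) (deriv_mulmx b dGx (dgamT a)) (deriv_trmx b (dgam a)).
have S : 'D_v ('D_u G) x = 'D_u ('D_v G) x := schwarz v u oU Ux (sG (k := 2)).
move: S; rewrite (E u v) (E v u) (gam_compat_mx u Ux) (gam_compat_mx v Ux) /curv.
generalize ('D_u (gam ^~ v) x) ('D_v (gam ^~ u) x) (gam x u) (gam x v) (G x).
move=> Duv Dvu gu gv g.
have T (a b c d : 'M[R]_n) : (a - b + c - d)^T = a^T - b^T + c^T - d^T.
  by apply/matrixP => i j; rewrite !mxE.
rewrite T !trmx_mul !(mulmxDl, mulmxDr, mulNmx, mulmxN) !mulmxA => S.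
apply/matrixP => i j; have := congr1 (fun A : 'M[R]_n => A i j) S; rewrite !mxE => Sij.
by lra.
Qed.

(** B differentiates the endomorphism only, not the two direction arguments. The directions are
    constant fields with vanishing brackets, so after Schwarz' theorem the cyclic sum cancels
    algebraically. *)
Lemma curv_bianchi2 x u v w : U x ->
  let B a b c := 'D_a (fun y => curv y b c) x + curv x b c *m gam x a - gam x a *m curv x b c in
  B u v w + B v w u + B w u v = 0.
Proof.
move=> Ux B.
have dgam a := diff_gam a Ux.
have s1 a b : smoothn 1 U ('D_b (gam ^~ a)) by have /smoothnS[_] := smoothn_gam (k := 2) a.
have ddgam a b : differentiable ('D_b (gam ^~ a)) x by exact: smoothn_diff (s1 a b) Ux.
have E a b c : 'D_a (fun y => curv y b c) x = 'D_a ('D_b (gam ^~ c)) x - 'D_a ('D_c (gam ^~ b)) x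
    + ('D_a (gam ^~ c) x *m gam x b + gam x c *m 'D_a (gam ^~ b) x)
    - ('D_a (gam ^~ b) x *m gam x c + gam x b *m 'D_a (gam ^~ c) x).
  have d1 := differentiableB (ddgam c b) (ddgam b c).
  have d2 := diff_mulmx (dgam c) (dgam b); have d3 := diff_mulmx (dgam b) (dgam c).
  apply: (etrans (derivB a (differentiableD d1 d2) d3)).
  rewrite (deriv_mulmx a (dgam b) (dgam c)) -(deriv_mulmx a (dgam c) (dgam b)).
  rewrite -(derivB a (ddgam c b) (ddgam b c)); congr (_ - _).
  exact: (derivD a d1 d2).
have S a b c : 'D_a ('D_b (gam ^~ c)) x = 'D_b ('D_a (gam ^~ c)) x.
  exact: (schwarz a b oU Ux (smoothn_gam (k := 2) c)).
have E1 := E u v w; have E2 := E v w u; have E3 := E w u v.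
have S1 := S u v w; have S2 := S v w u; have S3 := S w u v.
rewrite /B; move: E1 E2 E3 S1 S2 S3.
generalize ('D_u (fun y => curv y v w) x) ('D_v (fun y => curv y w u) x) ('D_w (fun y => curv y u v) x).
rewrite /curv.
generalize ('D_u ('D_w (gam ^~ v)) x) ('D_v ('D_u (gam ^~ w)) x) ('D_w ('D_v (gam ^~ u)) x).
generalize ('D_u ('D_v (gam ^~ w)) x) ('D_v ('D_w (gam ^~ u)) x) ('D_w ('D_u (gam ^~ v)) x).
generalize ('D_u (gam ^~ v) x) ('D_u (gam ^~ w) x) ('D_v (gam ^~ u) x).
generalize ('D_v (gam ^~ w) x) ('D_w (gam ^~ v) x) ('D_w (gam ^~ u) x).
generalize (gam x u) (gam x v) (gam x w).
move=> gu gv gw Dvw Dwv Dwu Duv Duw Dvu T1 T2 T3 T4 T5 T6 F1 F2 F3 -> -> -> -> -> ->.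
rewrite !(mulmxDl, mulmxDr, mulNmx, mulmxN) !mulmxA.
by apply/matrixP => i j; rewrite !mxE; ring.
Qed.

End LeviCivita.

(** * The Gauss equation *)

Section CurvatureLike.
Variables (R : realType) (V : lmodType R) (T : V -> V -> V -> V -> R).
Hypothesis TD : forall u u' v w z, T (u + u') v w z = T u v w z + T u' v w z.
Hypothesis T12 : forall u v w z, T v u w z = - T u v w z.
Hypothesis T34 : forall u v w z, T u v z w = - T u v w z.
Hypothesis TB : forall u v w z, T u v w z + T v w u z + T w u v z = 0.

(** The octahedron argument: the four Bianchi identities at the cyclic shifts of (u, v, w, z),
    combined through the skew symmetries. *)
Lemma curvature_like_pair u v w z : T u v w z = T w z u v.
Proof.
have b1 := TB u v w z; have b2 := TB v w z u; have b3 := TB w z u v; have b4 := TB z u v w.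
have e1 := T34 v w u z; have e2 := T12 u w v z.
have e3 := T12 v z w u; have e4 := T34 w z u v; have e5 := T12 w u z v; have e6 := T34 u w v z.
have e7 := T34 z u v w; have e8 := T34 u v w z; have e9 := T12 z v u w.
have e10 := T34 v z u w; have e11 := T34 u z v w; have e12 := T12 u z w v.
have e13 := T12 u z v w; have e14 := T34 w u v z; have e15 := T34 z v u w.
have e16 := T12 v z u w; have e17 := T34 z u w v.
lra.
Qed.

(** Polarisation in u and then in v makes T skew in its middle pair, hence in its first three
    arguments, and the Bianchi identity becomes 3 T = 0. *)
Lemma curvature_like0 : (forall u v, T u v v u = 0) -> forall u v w z, T u v w z = 0.
Proof.
move=> T0.
have TD2 u v v' w z : T u (v + v') w z = T u v w z + T u v' w z.
  by rewrite T12 TD opprD -!(T12 _ u).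
have TD4 u v w z z' : T u v w (z + z') = T u v w z + T u v w z'.
  by rewrite curvature_like_pair TD2 -!(curvature_like_pair u v w).
have TD3 u v w w' z : T u v (w + w') z = T u v w z + T u v w' z.
  by rewrite T34 TD4 opprD -!(T34 _ _ z).
have h1 u v z : T u v v z = 0.
  have := T0 (u + z) v; rewrite TD !TD4 !T0 add0r addr0 => e.
  have e' := curvature_like_pair z v v u.
  have e2 := T12 u v z v; have e3 := T34 u v v z.
  lra.
have h2 u v w z : T u w v z = - T u v w z.
  have := h1 u (v + w) z; rewrite TD2 !TD3 !h1 add0r addr0 => /eqP.
  by rewrite addr_eq0 => /eqP ->; rewrite opprK.
move=> u v w z; have := TB u v w z.
have := h2 v u w z; have := h2 u v w z; have := h2 w u v z; have := h2 u w v z.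
have := T12 u v w z; have := T12 u w v z; have := T12 v w u z; have := T12 w v u z.
have := h2 v w u z; have := h2 w v u z; have := T12 v u w z.
lra.
Qed.

End CurvatureLike.

(** The argument behind the uniqueness of the Levi-Civita connection: six alternating exchanges
    return to (a, b, c) with the opposite sign. *)
Lemma sym_skew0 (R : realType) (V : Type) (E : V -> V -> V -> R) :
  (forall a b c, E a b c = E b a c) -> (forall a b c, E a b c = - E a c b) ->
  forall a b c, E a b c = 0.
Proof.
move=> E12 E23 a b c.
have := E23 a b c; have := E12 a c b; have := E23 c a b; have := E12 c b a.
have := E23 b c a; have := E12 b a c; lra.
Qed.

Section Gauss.
Variables (R : realType) (n N : nat) (U : set 'rV[R]_n) (W : set 'rV[R]_N).
Variables (F : 'rV[R]_n -> 'rV[R]_N) (G : 'rV[R]_n -> 'M[R]_n) (Gt : 'rV[R]_N -> 'M[R]_N).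
Hypothesis oU : open U.
Hypothesis oW : open W.
Hypothesis FUW : forall x, U x -> W (F x).
Hypothesis sF : forall k, smoothn k U F.
Hypothesis sG : forall k, smoothn k U G.
Hypothesis pG : forall x, U x -> posdef (G x).
Hypothesis sGt : forall k, smoothn k W Gt.
Hypothesis pGt : forall y, W y -> posdef (Gt y).
Hypothesis iso : forall x u v, U x ->
  bform (G x) u v = bform (Gt (F x)) ('D_u F x) ('D_v F x).

Local Notation gamG := (gam G).
Local Notation gamT := (gam Gt).

Let dF x : U x -> differentiable F x.
Proof. by move=> Ux; exact: smoothn_diff (@sF 0%N) Ux. Qed.

Let s1F k u : smoothn k U ('D_u F).
Proof. by have /smoothnS[_] := @sF k.+1. Qed.

Let d1F x u : U x -> differentiable ('D_u F) x.
Proof. by move=> Ux; exact: smoothn_diff (s1F (k := 0%N) u) Ux. Qed.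

Let s2F k u v : smoothn k U ('D_v ('D_u F)).
Proof. by have /smoothnS[_] := s1F (k := k.+1) u. Qed.

Let d2F x u v : U x -> differentiable ('D_v ('D_u F)) x.
Proof. by move=> Ux; exact: smoothn_diff (s2F (k := 0%N) u v) Ux. Qed.

Let symF x u v : U x -> 'D_u ('D_v F) x = 'D_v ('D_u F) x.
Proof. by move=> Ux; exact: (schwarz u v oU Ux (sF (k := 2))). Qed.

(* The pull-back along F of the Levi-Civita connection *)
Definition pull y u : 'M[R]_N := gamT (F y) ('D_u F y).

Definition cov u (s : 'rV[R]_n -> 'rV[R]_N) : 'rV[R]_n -> 'rV[R]_N :=
  fun y => 'D_u s y + s y *m pull y u.

Lemma gamT_sum y a : W y ->
  gamT y a = \sum_j a ord0 j *: gamT y (delta_mx ord0 j).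
Proof.
move=> Wy; rewrite {1}(row_sum_delta a).
elim: (index_enum _) => [|j r IH]; first by rewrite !big_nil (gam0 oW sGt pGt Wy).
by rewrite !big_cons (gamP oW sGt pGt _ _ _ Wy) IH.
Qed.

Let dgamF x a : U x -> differentiable (fun y => gamT (F y) a) x.
Proof.
move=> Ux.
exact: (@diff_compose _ _ _ _ F (gamT ^~ a) x (dF Ux) (diff_gam oW sGt pGt a (FUW Ux))).
Qed.

Lemma pullE x u : U x ->
  pull x u = \sum_j ('D_u F x) ord0 j *: gamT (F x) (delta_mx ord0 j).
Proof. by move=> Ux; exact/gamT_sum/FUW. Qed.

Let dcoord x u (j : 'I_N) : U x -> differentiable (fun y => ('D_u F y) ord0 j) x.
Proof. by move=> Ux; move/differentiable_mxP : (d1F u Ux); exact. Qed.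

Lemma diff_pull x u : U x -> differentiable (pull ^~ u) x.
Proof.
move=> Ux; have H y : U y -> \sum_j ('D_u F y) ord0 j *: gamT (F y) (delta_mx ord0 j) = pull y u.
  by move=> Uy; rewrite pullE.
apply: (near_differentiable (near_U oU Ux H)).
by apply: diff_sum => j; exact: (diff_scale (dcoord u j Ux) (dgamF _ Ux)).
Qed.

(** [pull] depends on the point through the base point F y and through the vector D_u F; linearity
    in that vector, written in coordinates, separates the two contributions. *)
Lemma deriv_pull x u v : U x ->
  'D_v (pull ^~ u) x = gamT (F x) ('D_v ('D_u F) x)
    + 'D_('D_v F x) (gamT ^~ ('D_u F x)) (F x).
Proof.
move=> Ux; have WF := FUW Ux.
have dt a := diff_gam oW sGt pGt a WF.
have -> : 'D_v (pull ^~ u) x = 'D_v (fun y => \sum_j ('D_u F y) ord0 j *: gamT (F y) (delta_mx ord0 j)) x.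
  by apply: (derive_eq_on oU _ Ux) => y Uy; exact: pullE.
have -> : 'D_('D_v F x) (gamT ^~ ('D_u F x)) (F x) =
    'D_('D_v F x) (fun y => \sum_j ('D_u F x) ord0 j *: gamT y (delta_mx ord0 j)) (F x).
  by apply: (derive_eq_on oW _ WF) => y Wy; exact: gamT_sum.
rewrite (gamT_sum _ WF).
rewrite deriv_sum => [|j]; last exact: (diff_scale (dcoord u j Ux) (dgamF _ Ux)).
rewrite deriv_sum => [|j]; last exact: differentiableZ (dt _).
rewrite -big_split; apply: eq_bigr => j _ /=.
rewrite (deriv_scale v (dcoord u j Ux) (dgamF _ Ux)) (deriv_coord _ _ _ (d1F u Ux)).
rewrite (derivZ _ _ (dt _)); congr (_ + _ *: _).
exact: (@derive_comp _ _ _ _ F (gamT ^~ (delta_mx ord0 j)) x v (dF Ux) (dt _)).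
Qed.

(** The curvature of the pulled-back connection is the pulled-back curvature: the terms with second
    derivatives of F cancel by their symmetry. *)
Lemma curv_pull x u v : U x ->
  'D_u (pull ^~ v) x - 'D_v (pull ^~ u) x + pull x v *m pull x u - pull x u *m pull x v
  = curv Gt (F x) ('D_u F x) ('D_v F x).
Proof.
move=> Ux; have := symF u v Ux; move: (deriv_pull v u Ux) (deriv_pull u v Ux).
rewrite /curv -[gamT (F x) ('D_u F x)]/(pull x u) -[gamT (F x) ('D_v F x)]/(pull x v).
generalize ('D_u (pull ^~ v) x) ('D_v (pull ^~ u) x) ('D_u ('D_v F) x) ('D_v ('D_u F) x).
generalize ('D_('D_u F x) (gamT ^~ ('D_v F x)) (F x)) ('D_('D_v F x) (gamT ^~ ('D_u F x)) (F x)).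
move=> a b c d e f -> -> ->.
by rewrite opprD addrACA subrr add0r.
Qed.

Lemma diff_cov x u s : U x -> differentiable s x -> differentiable ('D_u s) x ->
  differentiable (cov u s) x.
Proof.
move=> Ux ds ds'; apply: (differentiableD ds').
exact: (diff_mulmx ds (diff_pull u Ux)).
Qed.

Lemma ricci_identity x u v s : U x -> smoothn 2 U s ->
  cov u (cov v s) x - cov v (cov u s) x = s x *m curv Gt (F x) ('D_u F x) ('D_v F x).
Proof.
move=> Ux ss; have ds := smoothn_diff ss Ux.
have ds' a : differentiable ('D_a s) x.
  by have /smoothnS[_ s1] := ss; exact: smoothn_diff (s1 a) Ux.
have E a b : cov a (cov b s) x = 'D_a ('D_b s) x + ('D_a s x *m pull x b + s x *m 'D_a (pull ^~ b) x)
    + ('D_b s x + s x *m pull x b) *m pull x a.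
  rewrite {1}/cov; congr (_ + _).
  rewrite -(deriv_mulmx a ds (diff_pull b Ux)).
  exact: (derivD a (ds' b) (diff_mulmx ds (diff_pull b Ux))).
rewrite (E u v) (E v u) -(curv_pull u v Ux).
have S : 'D_u ('D_v s) x = 'D_v ('D_u s) x := schwarz u v oU Ux ss.
move: S; generalize ('D_u ('D_v s) x) ('D_v ('D_u s) x) ('D_u s x) ('D_v s x) (s x).
generalize (pull x u) (pull x v) ('D_u (pull ^~ v) x) ('D_v (pull ^~ u) x).
move=> pu pv puv pvu suv svu su sv s0 ->.
rewrite !(mulmxDl, mulmxDr, mulNmx, mulmxN) !mulmxA.
by apply/matrixP => i j; rewrite !mxE; ring.
Qed.

Lemma deriv_GtF x u : U x -> 'D_u (fun y => Gt (F y)) x = 'D_('D_u F x) Gt (F x).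
Proof.
move=> Ux.
exact: (@derive_comp _ _ _ _ F Gt x u (dF Ux) (smoothn_diff (@sGt 0%N) (FUW Ux))).
Qed.

Let dGtF x : U x -> differentiable (fun y => Gt (F y)) x.
Proof.
move=> Ux.
exact: (@diff_compose _ _ _ _ F Gt x (dF Ux) (smoothn_diff (@sGt 0%N) (FUW Ux))).
Qed.

Lemma cov_compat x u s t : U x -> differentiable s x -> differentiable t x ->
  'D_u (fun y => bform (Gt (F y)) (s y) (t y)) x =
  bform (Gt (F x)) (cov u s x) (t x) + bform (Gt (F x)) (s x) (cov u t x).
Proof.
move=> Ux ds dt; rewrite (deriv_bform u (dGtF Ux) ds dt) (deriv_GtF u Ux).
rewrite (gam_compat oW sGt pGt _ _ _ (FUW Ux)) /cov -/(pull x u).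
move: ('D_u s x) ('D_u t x) => a b; rewrite bformDl bformDr; ring.
Qed.

Lemma cov_sym x u w : U x -> cov u ('D_w F) x = cov w ('D_u F) x.
Proof.
move=> Ux; rewrite /cov (symF u w Ux) /pull.
by rewrite (gam_sym oW sGt pGt _ _ (FUW Ux)).
Qed.

(** The difference E of the two sides is symmetric in u, w since both connections are torsion free,
    and skew in w, z since both are compatible with the metrics that F identifies. Hence it vanishes
    by [sym_skew0]. *)
Lemma cov_tangent x u w z : U x ->
  bform (Gt (F x)) (cov u ('D_w F) x) ('D_z F x) = bform (G x) (w *m gamG x u) z.
Proof.
move=> Ux.
pose E u w z := bform (Gt (F x)) (cov u ('D_w F) x) ('D_z F x) - bform (G x) (w *m gamG x u) z.
have E12 a b c : E a b c = E b a c.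
  by rewrite /E (cov_sym a b Ux) (gam_sym oU sG pG a b Ux).
have GT := (pG Ux).1; have GtT := (pGt (FUW Ux)).1.
have E23 a b c : E a b c = - E a c b.
  have h1 : 'D_a (fun y => bform (G y) b c) x = 'D_a (fun y => bform (Gt (F y)) ('D_b F y) ('D_c F y)) x.
    by apply: (derive_eq_on oU _ Ux) => y Uy; exact: iso.
  have h : bform (G x) (b *m gamG x a) c + bform (G x) b (c *m gamG x a) =
      bform (Gt (F x)) (cov a ('D_b F) x) ('D_c F x) + bform (Gt (F x)) ('D_b F x) (cov a ('D_c F) x).
    apply: (etrans (esym (gam_compat oU sG pG a b c Ux))).
    apply: (etrans (esym (deriv_bform_cst b c a (smoothn_diff (@sG 0%N) Ux)))).
    apply: (etrans h1).
    exact: (cov_compat a Ux (d1F b Ux) (d1F c Ux)).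
  have aux (X1 Y1 X2 Y2 X3 Y3 : R) :
    Y1 + Y3 = X1 + X3 -> Y3 = Y2 -> X3 = X2 -> X1 - Y1 = - (X2 - Y2) by lra.
  exact: (aux _ _ _ _ _ _ h (bformC _ _ GT) (bformC _ _ GtT)).
have E0 := sym_skew0 E12 E23 u w z.
by apply/eqP; rewrite -subr_eq0; apply/eqP.
Qed.

Definition sff x u w : 'rV[R]_N := cov u ('D_w F) x - 'D_(w *m gamG x u) F x.

Lemma sff_normal x u w z : U x -> bform (Gt (F x)) (sff x u w) ('D_z F x) = 0.
Proof.
by move=> Ux; rewrite /sff bformBl (cov_tangent u w z Ux) -(iso _ _ Ux) subrr.
Qed.

Lemma sff_sym x u w : U x -> sff x u w = sff x w u.
Proof. by move=> Ux; rewrite /sff (cov_sym u w Ux) (gam_sym oU sG pG u w Ux). Qed.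

Lemma cov_inner x u v w z : U x ->
  bform (Gt (F x)) (cov v ('D_w F) x) (cov u ('D_z F) x) =
  bform (Gt (F x)) (sff x v w) (sff x u z) + bform (G x) (w *m gamG x v) (z *m gamG x u).
Proof.
move=> Ux; have GtT := (pGt (FUW Ux)).1.
have E a b : cov a ('D_b F) x = sff x a b + 'D_(b *m gamG x a) F x by rewrite /sff subrK.
have ex (A : 'M[R]_N) s1 t1 s2 t2 : bform A (s1 + t1) (s2 + t2) =
    bform A s1 s2 + bform A s1 t2 + (bform A t1 s2 + bform A t1 t2).
  by rewrite bformDl !bformDr.
rewrite (E v w) (E u z) ex.
have aux (p a b q r : R) : a = 0 -> b = 0 -> r = q -> p + a + (b + q) = p + r.
  by move=> -> -> ->; rewrite addr0 add0r.
have n1 := sff_normal v w (z *m gamG x u) Ux.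
have n2 := etrans (bformC _ _ GtT) (sff_normal u z (w *m gamG x v) Ux).
exact: (aux _ _ _ _ _ n1 n2 (iso _ _ Ux)).
Qed.

(** The identity [cov_tangent] holds at every point, so it can be differentiated once more;
    antisymmetrising in u, v gives both curvatures, and the products of first covariant derivatives
    give the terms with [sff] by [cov_inner]. *)
Theorem gauss x u v w z : U x ->
  bform (Gt (F x)) ('D_w F x *m curv Gt (F x) ('D_u F x) ('D_v F x)) ('D_z F x) =
  bform (G x) (w *m curv G x u v) z
  - bform (Gt (F x)) (sff x v w) (sff x u z) + bform (Gt (F x)) (sff x u w) (sff x v z).
Proof.
move=> Ux.
have E a b : bform (Gt (F x)) (cov a (cov b ('D_w F)) x) ('D_z F x)
    + bform (Gt (F x)) (cov b ('D_w F) x) (cov a ('D_z F) x)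
    = bform (G x) (w *m 'D_a (gamG ^~ b) x) z + bform (G x) (w *m gamG x b *m gamG x a) z
      + bform (G x) (w *m gamG x b) (z *m gamG x a).
  have dc := diff_cov Ux (d1F w Ux) (d2F w b Ux).
  rewrite -(cov_compat a Ux dc (d1F z Ux)).
  have -> : 'D_a (fun y => bform (Gt (F y)) (cov b ('D_w F) y) ('D_z F y)) x
      = 'D_a (fun y => bform (G y) (w *m gamG y b) z) x.
    by apply: (derive_eq_on oU _ Ux) => y Uy; exact: cov_tangent.
  have dg := diff_gam oU sG pG b Ux; have dw := diff_cst' w x.
  rewrite (deriv_bform a (smoothn_diff (@sG 0%N) Ux) (diff_mulmx dw dg) (diff_cst' z x)).
  rewrite (deriv_mulmx a dw dg) !deriv_cst mul0mx add0r bform0r addr0.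
  rewrite (gam_compat oU sG pG a _ _ Ux).
  move: (bform _ _ _) (bform _ _ _) (bform _ _ _) => p q r; ring.
have RI := ricci_identity u v Ux (s1F (k := 2) w).
rewrite -RI bformBl.
have aux (p q r1 r2 a1 a2 b1 b2 g1 g2 s1 s2 t1 : R) :
    p + r1 = a1 + b1 + g1 -> q + r2 = a2 + b2 + g2 -> r1 = s1 + g1 -> r2 = s2 + g2 ->
    t1 = a1 - a2 + b1 - b2 -> p - q = t1 - s1 + s2 by move=> *; lra.
apply: (aux _ _ _ _ _ _ _ _ _ _ _ _ _ (E u v) (E v u) (cov_inner u v w z Ux) (cov_inner v u w z Ux)).
by rewrite /curv !(mulmxDr, mulmxN) !mulmxA !(bformDl, bformNl).
Qed.

End Gauss.

(** * Constant curvature, Schur's lemma and conformal flatness *)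

Section ConstantCurvature.
Variables (R : realType) (n : nat) (U : set 'rV[R]_n) (G : 'rV[R]_n -> 'M[R]_n).
Local Notation V := ('rV[R]_n).
Hypothesis oU : open U.
Hypothesis sG : forall k, smoothn k U G.
Hypothesis pG : forall x, U x -> posdef (G x).

Definition gram x u v := bform (G x) u u * bform (G x) v v - bform (G x) u v ^+ 2.

Lemma gram_gt0 x u v : U x -> v != 0 -> (forall t : R, u != t *: v) -> 0 < gram x u v.
Proof.
move=> Ux v0 uv; have [GT pos] := pG Ux.
have gv := pos v v0.
pose t := bform (G x) u v / bform (G x) v v.
have gw : 0 < bform (G x) (u - t *: v) (u - t *: v) by apply: pos; rewrite subr_eq0.
have -> : gram x u v = bform (G x) (u - t *: v) (u - t *: v) * bform (G x) v v.
  rewrite /gram bformBl !bformBr !bformZl !bformZr (bformC v u GT) /t.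
  move: (bform (G x) v v) gv => q q0; move: (bform _ _ _) (bform _ _ _) => p r.
  by field; rewrite gt_eqF.
exact: mulr_gt0.
Qed.

Lemma Rtensor_curv x u v w z : U x -> Rtensor G x u v w z = bform (G x) (w *m curv G x u v) z.
Proof. by move=> Ux; rewrite /Rtensor (Rop_curv oU sG pG u v w Ux). Qed.

(** The difference T of the two sides is a curvature-like tensor, to which [curvature_like0]
    applies. The hypothesis covers independent pairs only; for dependent ones both sides vanish,
    whence the case distinction in [R0]. *)
Lemma sectional_full x k : U x ->
  (forall u v : V, row_free (col_mx u v) -> sectional G x u v = k) ->
  forall u v w z, bform (G x) (w *m curv G x u v) z =
    k * (bform (G x) v w * bform (G x) u z - bform (G x) u w * bform (G x) v z).
Proof.
move=> Ux sec u v w z; have [GT pos] := pG Ux.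
pose T (u v w z : V) : R := bform (G x) (w *m curv G x u v) z
  - k * (bform (G x) v w * bform (G x) u z - bform (G x) u w * bform (G x) v z).
apply/eqP; rewrite -subr_eq0; apply/eqP; rewrite -/(T u v w z).
have skew a b c d : bform (G x) (c *m curv G x a b) d = - bform (G x) (d *m curv G x a b) c.
  apply/eqP; rewrite -subr_eq0 opprK; apply/eqP.
  rewrite (bformC _ c GT) !(bform_mull, bform_mulr) -bformDm.
  by rewrite (curv_metric oU sG pG a b Ux) /bform mulmx0 mul0mx mxE.
have curvD a b c : curv G x (a + b) c = curv G x a c + curv G x b c.
  by rewrite -[a]scale1r (curvP oU sG pG _ _ _ _ Ux) !scale1r.
have c0 d : curv G x d d = 0.
  have /eqP := curv_skew G x d d.
  by rewrite -subr_eq0 opprK -mulr2n -scaler_nat scaler_eq0 pnatr_eq0 /= => /eqP.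
have R0 a b : bform (G x) (b *m curv G x a b) a = k * gram x a b.
  have [->|b0] := eqVneq b 0; first by rewrite /gram mul0mx !(bform0l, bform0r); ring.
  have [[t ->]|nt] := pselect (exists t : R, a = t *: b).
    have -> : curv G x (t *: b) b = 0.
      have {1}-> : t *: b = (t - 1) *: b + b by rewrite scalerBl scale1r subrK.
      by rewrite (curvP oU sG pG _ _ _ _ Ux) c0 scaler0 addr0.
    by rewrite mulmx0 bform0l /gram !(bformZl, bformZr); ring.
  have ab t : a != t *: b by apply/eqP => e; apply: nt; exists t.
  have g0 := gram_gt0 Ux b0 ab.
  have rf : row_free (col_mx a b).
    apply: inj_row_free => y; rewrite -[y]hsubmxK mul_row_col.
    rewrite [lsubmx y]mx11_scalar [rsubmx y]mx11_scalar !mul_scalar_mx.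
    move: (lsubmx y 0 0) (rsubmx y 0 0) => p q pq.
    have p0 : p = 0.
      apply/eqP/negPn/negP => pn0; move/eqP: pq; rewrite addr_eq0 => /eqP pq.
      have /eqP := ab (- (p^-1 * q)); apply.
      by rewrite scaleNr -scalerA -scalerN -pq scalerA mulVf// scale1r.
    move: pq; rewrite p0 scale0r add0r => /eqP; rewrite scaler_eq0 (negPf b0) orbF => /eqP ->.
    by rewrite !raddf0 row_mx0.
  have := sec a b rf; rewrite /sectional (Rtensor_curv _ _ _ _ Ux) -/(gram x a b) => <-.
  by rewrite divfK// gt_eqF.
apply: (curvature_like0 (T := T)).
- move=> a a' b c d; rewrite /T curvD mulmxDr !bformDl.
  have aux (X Y P Q1 Q2 S1 S2 Z : R) : X + Y - k * (P * (Q1 + Q2) - (S1 + S2) * Z) =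
    (X - k * (P * Q1 - S1 * Z)) + (Y - k * (P * Q2 - S2 * Z)) by ring.
  exact: aux.
- move=> a b c d; rewrite /T curv_skew mulmxN bformNl; ring.
- move=> a b c d; rewrite /T skew; ring.
- move=> a b c d; rewrite /T.
  have := curv_bianchi oU sG pG a b c Ux => B.
  have B' : bform (G x) (c *m curv G x a b) d + bform (G x) (a *m curv G x b c) d + bform (G x) (b *m curv G x c a) d = 0.
    by rewrite -!bformDl B bform0l.
  have aux (X1 X2 X3 bc ad ac bd ab cd ca ba cb : R) :
      X1 + X2 + X3 = 0 -> ca = ac -> ba = ab -> cb = bc ->
      X1 - k * (bc * ad - ac * bd) + (X2 - k * (ca * bd - ba * cd)) + (X3 - k * (ab * cd - cb * ad)) = 0.
    by move=> h -> -> ->; rewrite -[RHS]h; ring.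
  exact: (aux _ _ _ _ _ _ _ _ _ _ _ _ B' (bformC _ _ GT) (bformC _ _ GT) (bformC _ _ GT)).
- move=> a b; rewrite /T R0 /gram (bformC b a GT); ring.
Qed.

End ConstantCurvature.

Lemma zero_deriv_ball (R : realType) (V : normedModType R) (f : V -> R) x0 d :
  (forall x, ball x0 d x -> differentiable f x /\ forall u, 'D_u f x = 0) ->
  forall x, ball x0 d x -> f x = f x0.
Proof.
move=> H x xb; apply/eqP; rewrite -subr_eq0; apply/eqP.
have d0 : 0 < d by move: xb; rewrite -ball_normE /=; apply: le_lt_trans.
have seg (s : R) : 0 <= s <= 1 -> ball x0 d (x0 + s *: (x - x0)).
  move=> /andP[s0 s1]; rewrite -ball_normE/= opprD addNKr normrN normrZ ger0_norm//.
  move: xb; rewrite -ball_normE/= distrC; apply: le_lt_trans.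
  by rewrite ler_piMl.
have [s sI] := @MVT_line R V f x0 (x - x0) 1 ltr01 (fun s sI => (H _ (seg s sI)).1).
by rewrite (H _ (seg s sI)).2 scale1r [x0 + _]addrC subrK mul0r.
Qed.

(** * Schur's lemma *)

Section Schur.
Variables (R : realType) (n : nat) (U : set 'rV[R]_n) (G : 'rV[R]_n -> 'M[R]_n).
Local Notation V := ('rV[R]_n).
Local Notation e_ i := (delta_mx ord0 i : V).
Hypothesis oU : open U.
Hypothesis sG : forall k, smoothn k U G.
Hypothesis pG : forall x, U x -> posdef (G x).
Hypothesis n3 : (3 <= n)%N.

(** The matrix of [wedge_op], so that identities of curvature operators become identities of
    matrices. *)
Definition wedge (g : 'M[R]_n) (u v : V) : 'M[R]_n := g *m (v^T *m u - u^T *m v).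

Lemma mul_wedge g u v w : w *m wedge g u v = bform g w v *: u - bform g w u *: v.
Proof.
rewrite /wedge mulmxBr mulmxBr !mulmxA -!mul_scalar_mx -!mx11_scalar.
by [].
Qed.

Lemma wedge_skew g u v : wedge g v u = - wedge g u v.
Proof. by apply: (etrans _ (mulmxN _ _)); rewrite opprB. Qed.

Hypothesis cc : forall x, U x -> exists c : R, forall u v, curv G x u v = c *: wedge (G x) u v.

Let i0 : 'I_n := Ordinal (leq_trans (isT : 0 < 3)%N n3).
Let i1 : 'I_n := Ordinal (leq_trans (isT : 1 < 3)%N n3).

(** The hypothesis [cc] gives a coefficient at each point without any regularity. As a quotient of
    components in two basis vectors it is differentiable. *)
Let c x : R := bform (G x) (e_ i1 *m curv G x (e_ i0) (e_ i1)) (e_ i0) *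
  (gram G x (e_ i0) (e_ i1))^-1.

Let gram01 x : U x -> gram G x (e_ i0) (e_ i1) != 0.
Proof.
move=> Ux; rewrite gt_eqF//; apply: (gram_gt0 pG Ux).
  by apply/eqP => /rowP/(_ i1); rewrite !mxE !eqxx => /eqP; rewrite oner_eq0.
move=> t; apply/eqP => /rowP/(_ i0); rewrite !mxE !eqxx /= mulr0 => /eqP.
by rewrite oner_eq0.
Qed.

Lemma schur_coefficient x : U x -> forall u v, curv G x u v = c x *: wedge (G x) u v.
Proof.
move=> Ux; have [k kE] := cc Ux; suff -> : c x = k by [].
rewrite /c kE -scalemxAr bformZl mul_wedge bformBl !bformZl.
rewrite (_ : _ - _ = gram G x (e_ i0) (e_ i1)) ?mulfK ?gram01//.
by rewrite /gram expr2 (bformC (e_ i1) (e_ i0) (pG Ux).1) mulrC.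
Qed.

Lemma diff_schur x : U x -> differentiable c x.
Proof.
move=> Ux; have dG : differentiable G x := smoothn_diff (@sG 0%N) Ux.
have dd (a b : V) := diff_bform_cst a b dG.
have dg : differentiable (fun x => gram G x (e_ i0) (e_ i1)) x.
  apply: (differentiableB (diff_mul (dd (e_ i0) (e_ i0)) (dd (e_ i1) (e_ i1)))).
  by under eq_fun do rewrite expr2; exact: diff_mul.
apply: diff_mul; last exact: (differentiableV dg (gram01 Ux)).
apply: (diff_bform dG); last exact: diff_cst'.
apply: diff_mulmx; first exact: diff_cst'.
exact: smoothn_diff (smoothn_curv oU sG pG (k := 0%N) _ _) Ux.
Qed.

(** The tensor [wedge] is parallel since G is; the right side comes from the vectors u and v, which
    have constant components without being parallel. *)
Lemma deriv_wedge x a u v : U x ->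
  'D_a (fun y => wedge (G y) u v) x + wedge (G x) u v *m gam G x a - gam G x a *m wedge (G x) u v
  = wedge (G x) u (v *m gam G x a) + wedge (G x) (u *m gam G x a) v.
Proof.
move=> Ux; have dG : differentiable G x := smoothn_diff (@sG 0%N) Ux.
have -> : 'D_a (fun y => wedge (G y) u v) x = wedge ('D_a G x) u v.
  rewrite /wedge (deriv_mulmx a dG (diff_cst' _ x)) deriv_cst mulmx0 addr0.
  by [].
rewrite (gam_compat_mx oU sG pG a Ux); generalize (gam G x a) (G x) => ga g.
rewrite /wedge !trmx_mul !(mulmxDl, mulmxDr, mulmxN, mulNmx) !mulmxA.
by apply/matrixP => i j; rewrite !mxE; ring.
Qed.

(** In the second Bianchi identity for curv = c wedge only the derivatives of c survive, by
    [deriv_wedge] and the symmetry of [gam]. Three distinct indices then isolate one derivative. *)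
Lemma schur x : U x -> forall u, 'D_u c x = 0.
Proof.
move=> Ux; have dG : differentiable G x := smoothn_diff (@sG 0%N) Ux.
have dc := diff_schur Ux.
have key u v w : 'D_u c x *: wedge (G x) v w + 'D_v c x *: wedge (G x) w u
    + 'D_w c x *: wedge (G x) u v = 0.
  have B a p q : 'D_a (fun y => curv G y p q) x + curv G x p q *m gam G x a - gam G x a *m curv G x p q
      = 'D_a c x *: wedge (G x) p q
        + c x *: (wedge (G x) p (q *m gam G x a) + wedge (G x) (p *m gam G x a) q).
    rewrite -(deriv_wedge a p q Ux) (schur_coefficient Ux).
    have -> : 'D_a (fun y => curv G y p q) x = 'D_a (fun y => c y *: wedge (G y) p q) x.
      by apply: (derive_eq_on oU _ Ux) => y Uy; exact: schur_coefficient.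
    rewrite (deriv_scale a dc (diff_mulmx dG (diff_cst' _ x))).
    rewrite -scalemxAl -scalemxAr !scalerDr scalerN !addrA.
    by [].
  have := curv_bianchi2 oU sG pG u v w Ux; rewrite /= !B.
  rewrite (gam_sym oU sG pG u w Ux) (gam_sym oU sG pG u v Ux) (gam_sym oU sG pG v w Ux).
  rewrite (wedge_skew _ (u *m gam G x w) v) (wedge_skew _ w (u *m gam G x v)) (wedge_skew _ u (v *m gam G x w)).
  have aux (a b d k : R) (X Y Z P Q S : 'M[R]_n) :
      a *: X + k *: (- P + - Q) + (b *: Y + k *: (Q + - S)) + (d *: Z + k *: (S + P)) = 0 ->
      a *: X + b *: Y + d *: Z = 0.
    by move=> h; apply: (etrans _ h); apply/matrixP => i j; rewrite !mxE; ring.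
  exact: aux.
have key2 u v w : 'D_u c x *: (w^T *m v - v^T *m w) + 'D_v c x *: (u^T *m w - w^T *m u)
    + 'D_w c x *: (v^T *m u - u^T *m v) = 0.
  have := congr1 (mulmx (invmx (G x))) (key u v w).
  by rewrite mulmx0 !mulmxDr -!scalemxAr /wedge !mulKmx//; exact/posdef_unit/pG.
(* In entry (d, b) of [key2] on basis vectors only the first term is nonzero. *)
have basis (a b d : 'I_n) : a != b -> a != d -> b != d -> 'D_(e_ a) c x = 0.
  move=> ab ad bd; have := congr1 (fun A : 'M[R]_n => A d b) (key2 (e_ a) (e_ b) (e_ d)).
  generalize ('D_(e_ a) c x) ('D_(e_ b) c x) ('D_(e_ d) c x) => p q r.
  rewrite !trmx_delta !mul_delta_mx !mxE !eqxx (eq_sym b a) (negPf ab) (eq_sym d a) (negPf ad) (eq_sym d b) (negPf bd) /=.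
  by rewrite ?andbF /= ?subr0 ?subrr ?mulr0 ?addr0 ?mulr1.
move=> u; rewrite (derive_basis u dc) big1// => a _.
suff -> : 'D_(e_ a) c x = 0 by rewrite scaler0.
have [b [d [ab ad bd]]] : exists b d : 'I_n, [/\ a != b, a != d & b != d].
  pose i2 : 'I_n := Ordinal n3.
  have [/eqP a0|a0] := boolP (a == i0); first by exists i1, i2; rewrite a0.
  have [/eqP a1|a1] := boolP (a == i1); first by exists i0, i2; rewrite a1.
  by exists i0, i1.
exact: basis ab ad bd.
Qed.

Lemma schur_local x0 : U x0 -> exists c0 d : R, [/\ 0 < d, ball x0 d `<=` U &
  forall x u v, ball x0 d x -> curv G x u v = c0 *: wedge (G x) u v].
Proof.
move=> Ux0; have /nbhs_ballP[d d0 dU] : nbhs x0 U by exact: open_nbhs_nbhs.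
exists (c x0), d; split=> // x u v xb.
rewrite (schur_coefficient (dU _ xb)); congr (_ *: _).
apply: (@zero_deriv_ball R _ c x0 d) => // y yb.
by split; [exact/diff_schur/dU|exact/schur/dU].
Qed.

End Schur.

(* The curvature identity behind a conformal change of metric: [be] is the gradient
   of the conformal factor and [A], [B] the connection matrices along [u], [v]. *)
Lemma conformal_algebra (R : realType) (n : nat) (g A B : 'M[R]_n) (be w u v du dv : 'rV[R]_n) (c : R) :
  g^T = g -> v *m A = u *m B ->
  du = (c / 2 - bform g be be / 2) *: u + bform g be u *: be - be *m A ->
  dv = (c / 2 - bform g be be / 2) *: v + bform g be v *: be - be *m B ->
  let P (p q : 'rV[R]_n) := bform g be p *: q + bform g q be *: p - bform g q p *: be in
  let DP p q (C : 'M[R]_n) dp := (bform g (be *m C) q + bform g be (q *m C) + bform g dp q) *: w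
   + (bform g (w *m C) be + bform g w (be *m C) + bform g w dp) *: q
   - (bform g (w *m C) q + bform g w (q *m C)) *: be - bform g w q *: dp in
  c *: (bform g w v *: u - bform g w u *: v) + DP u v A du - DP v u B dv
    + P u (w *m B) + P v w *m A + P u (P v w)
    - (P v (w *m A) + P u w *m B + P v (P u w)) = 0.
Proof.
move=> gT S -> -> /=.
have sA (a : R) (x : 'rV[R]_n) (M : 'M[R]_n) : (a *: x) *m M = a *: (x *m M).
  by rewrite scalemxAl.
rewrite !(mulmxDl, mulNmx, sA) S.
have bC p q := bformC p q gT.
generalize (w *m A) (w *m B) (be *m A) (be *m B) (u *m B) => wA wB bA bB uB.
rewrite !(bformDl, bformDr, bformNl, bformNr, bformZl, bformZr).
rewrite (bC u v) (bC wA be) (bC wB be) (bC w be) (bC w v) (bC w u) (bC w bA) (bC w bB) (bC w uB) (bC u be) (bC v be).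
generalize (bform g be be) (bform g be u) (bform g be v) (bform g be w) (bform g v u) (bform g v w) (bform g u w).
move=> b1 b2 b3 b4 b5 b6 b7.
by apply/rowP => j; rewrite !mxE; field.
Qed.

(** * Conformal change to a flat metric *)

Section Conformal.
Variables (R : realType) (n : nat) (U : set 'rV[R]_n) (G : 'rV[R]_n -> 'M[R]_n).
Local Notation V := ('rV[R]_n).
Hypothesis oU : open U.
Hypothesis sG : forall k, smoothn k U G.
Hypothesis pG : forall x, U x -> posdef (G x).

Variables (l : V -> R) (b : V -> V) (c : R).
Hypothesis sl : forall k, smoothn k U l.
Hypothesis sb : forall k, smoothn k U b.
Hypothesis l0 : forall x, U x -> l x != 0.
Hypothesis Dl : forall x u, U x -> 'D_u l x = l x * bform (G x) (b x) u.
Hypothesis Db : forall x u, U x -> 'D_u b x + b x *m gam G x u =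
  (c / 2 - bform (G x) (b x) (b x) / 2) *: u + bform (G x) (b x) u *: b x.
Hypothesis cc : forall x u v, U x -> curv G x u v = c *: wedge (G x) u v.

Let H x := (l x * l x) *: G x.

Let sH k : smoothn k U H.
Proof. by apply: smoothn_scale => //; exact: smoothn_mul. Qed.

Lemma posdef_scale (a : R) (g : 'M[R]_n) : 0 < a -> posdef g -> posdef (a *: g).
Proof.
move=> a0 [gT gp]; split; first by rewrite linearZ /= gT.
by move=> v v0; rewrite bformZm mulr_gt0// gp.
Qed.

Let pH x : U x -> posdef (H x).
Proof.
move=> Ux; apply: posdef_scale (pG Ux).
by rewrite -expr2 exprn_even_gt0//= l0.
Qed.

(** The difference of the Levi-Civita connections of H = l^2 G and G, where b is the gradient of log
    l; compare [gam_conformal]. *)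
Let P x u : 'M[R]_n := (bform (G x) (b x) u)%:M + wedge (G x) u (b x).

Let mulP x u w : w *m P x u = bform (G x) (b x) u *: w + bform (G x) w (b x) *: u - bform (G x) w u *: b x.
Proof.
by rewrite /P mulmxDr mul_mx_scalar mul_wedge addrA.
Qed.

Lemma deriv_conformal x u : U x ->
  'D_u H x = (l x * l x) *: ('D_u G x + (2 * bform (G x) (b x) u) *: G x).
Proof.
move=> Ux; have dG := smoothn_diff (@sG 0%N) Ux; have dl := smoothn_diff (@sl 0%N) Ux.
rewrite (deriv_scale u (diff_mul dl dl) dG) (deriv_mul u dl dl) (Dl u Ux).
generalize ('D_u G x) (G x) (l x) (bform (G x) (b x) u) => A B a p.
by apply/matrixP => i j; rewrite !mxE; ring.
Qed.

Lemma gam_conformal x u : U x -> gam H x u = gam G x u + P x u.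
Proof.
move=> Ux; have [GT _] := pG Ux.
suff E (w : V) : w *m gam H x u = w *m (gam G x u + P x u).
  by apply: bform_eq => w z; rewrite /bform E.
apply: (bform_injl (pH Ux)) => z.
have dG := smoothn_diff (@sG 0%N) Ux.
have dH := smoothn_diff (@sH 0%N) Ux.
have e1 : bform (H x) (w *m gam H x u) z = 2^-1 * (bform ('D_u H x) w z + bform ('D_w H x) u z - bform ('D_z H x) u w).
  exact: (bform_koszul_gam (pH Ux) (fun u => derive_basis u dH)).
have e2 : bform (G x) (w *m gam G x u) z = 2^-1 * (bform ('D_u G x) w z + bform ('D_w G x) u z - bform ('D_z G x) u w).
  exact: (bform_koszul_gam (pG Ux) (fun u => derive_basis u dG)).
apply: (etrans e1); rewrite (deriv_conformal u Ux) (deriv_conformal w Ux) (deriv_conformal z Ux).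
rewrite /H !bformZm mulmxDr bformDl e2 mulP !(bformDl, bformNl, bformZl) !bformDm !bformZm.
rewrite (bformC w (b x) GT) (bformC w u GT).
generalize (bform ('D_u G x) w z) (bform ('D_w G x) u z) (bform ('D_z G x) u w).
generalize (bform (G x) (b x) u) (bform (G x) (b x) w) (bform (G x) (b x) z) (bform (G x) u w) (bform (G x) u z) (bform (G x) w z) (l x).
by move=> *; field.
Qed.

Let diffP v x : U x -> differentiable (P ^~ v) x.
Proof.
move=> Ux; have dG := smoothn_diff (@sG 0%N) Ux; have db := smoothn_diff (@sb 0%N) Ux.
have d1 := diff_bform dG db (diff_cst' v x).
apply: differentiableD.
  by under eq_fun do rewrite -scalemx1; exact: (diff_scale d1 (diff_cst' _ x)).
apply: (diff_mulmx dG); apply: differentiableB.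
  exact: (diff_mulmx (diff_trmx db) (diff_cst' v x)).
exact: (diff_mulmx (diff_cst' v^T x) db).
Qed.

Let Db' x u (Ux : U x) : 'D_u b x =
  (c / 2 - bform (G x) (b x) (b x) / 2) *: u + bform (G x) (b x) u *: b x - b x *m gam G x u.
Proof. by rewrite -(Db u Ux) addrK. Qed.

Let dP x u v : U x -> forall w, w *m 'D_u (P ^~ v) x =
   (bform (G x) (b x *m gam G x u) v + bform (G x) (b x) (v *m gam G x u) + bform (G x) ('D_u b x) v) *: w
   + (bform (G x) (w *m gam G x u) (b x) + bform (G x) w (b x *m gam G x u) + bform (G x) w ('D_u b x)) *: v
   - (bform (G x) (w *m gam G x u) v + bform (G x) w (v *m gam G x u)) *: b x
   - bform (G x) w v *: 'D_u b x.
Proof.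
move=> Ux w; have dG := smoothn_diff (@sG 0%N) Ux; have db := smoothn_diff (@sb 0%N) Ux.
have d1 := diff_bform dG db (diff_cst' v x).
have d2 := diff_bform dG (diff_cst' w x) db.
have d3 := diff_bform_cst w v dG.
have d4 := diff_scale d1 (diff_cst' w x).
have d5 := diff_scale d2 (diff_cst' v x).
have d6 := diff_scale d3 db.
have dPx := diffP v Ux.
have e : w *m 'D_u (P ^~ v) x = 'D_u (fun y => w *m P y v) x.
  by rewrite (deriv_mulmx u (diff_cst' w x) dPx) deriv_cst mul0mx add0r.
have f : (fun y => w *m P y v) = (fun y => bform (G y) (b y) v *: w + bform (G y) w (b y) *: v - bform (G y) w v *: b y).
  by apply/funext => y; exact: mulP.
rewrite e f.
rewrite (derivB u (differentiableD d4 d5) d6) -[X in X - _]/('D_u (fun y => _ + _) x).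
rewrite (derivD u d4 d5) (deriv_scale u d1 (diff_cst' w x)) (deriv_scale u d2 (diff_cst' v x)) (deriv_scale u d3 db).
rewrite !deriv_cst !scaler0 !addr0 (deriv_bform u dG db (diff_cst' v x)) (deriv_bform u dG (diff_cst' w x) db).
rewrite (deriv_bform_cst w v u dG) !deriv_cst bform0l bform0r !addr0.
rewrite !(gam_compat oU sG pG u _ _ Ux).
by rewrite opprD addrA.
Qed.

(** The hypothesis [Db] prescribes the Hessian of log l so that the Schouten tensor of H is zero.
    With constant curvature this kills the whole curvature of [gam G + P], by
    [conformal_algebra]. *)
Lemma curv_conformal x u v : U x -> curv H x u v = 0.
Proof.
move=> Ux; have [GT _] := pG Ux.
suff E (w : V) : w *m curv H x u v = 0.
  by apply: bform_eq => w z; rewrite /bform E mulmx0.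
have dG := smoothn_diff (@sG 0%N) Ux; have db := smoothn_diff (@sb 0%N) Ux.
have DH p q : 'D_p (gam H ^~ q) x = 'D_p (gam G ^~ q) x + 'D_p (P ^~ q) x.
  have -> : 'D_p (gam H ^~ q) x = 'D_p (fun y => gam G y q + P y q) x.
    by apply: (derive_eq_on oU _ Ux) => y Uy; exact: gam_conformal.
  exact: (derivD p (diff_gam oU sG pG q Ux) (diffP q Ux)).
have Cw : w *m curv G x u v = c *: (bform (G x) w v *: u - bform (G x) w u *: v).
  by rewrite (cc u v Ux) -scalemxAr mul_wedge.
have Dbu : 'D_u b x = _ := Db' u Ux; have Dbv : 'D_v b x = _ := Db' v Ux.
have S := gam_sym oU sG pG u v Ux.
have -> : w *m curv H x u v = w *m curv G x u v + w *m 'D_u (P ^~ v) x - w *m 'D_v (P ^~ u) x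
    + (w *m gam G x v) *m P x u + (w *m P x v) *m gam G x u + (w *m P x v) *m P x u
    - ((w *m gam G x u) *m P x v + (w *m P x u) *m gam G x v + (w *m P x u) *m P x v).
  rewrite /curv (DH u v) (DH v u) (gam_conformal u Ux) (gam_conformal v Ux).
  generalize ('D_u (gam G ^~ v) x) ('D_v (gam G ^~ u) x) ('D_u (P ^~ v) x) ('D_v (P ^~ u) x).
  generalize (gam G x u) (gam G x v) (P x u) (P x v) => A B C D E1 E2 E3 E4.
  rewrite !(mulmxDl, mulmxDr, mulNmx, mulmxN) !mulmxA.
  by apply/matrixP => i j; rewrite !mxE; ring.
have cg (a1 a2 a3 a4 a5 a6 a7 a8 a9 b1 b2 b3 b4 b5 b6 b7 b8 b9 : V) :
    a1 = b1 -> a2 = b2 -> a3 = b3 -> a4 = b4 -> a5 = b5 -> a6 = b6 -> a7 = b7 -> a8 = b8 -> a9 = b9 ->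
    a1 + a2 - a3 + a4 + a5 + a6 - (a7 + a8 + a9) = b1 + b2 - b3 + b4 + b5 + b6 - (b7 + b8 + b9).
  by do 9 move=> ->.
pose Q (p q : V) := bform (G x) (b x) p *: q + bform (G x) q (b x) *: p - bform (G x) q p *: b x.
apply: (etrans _ (conformal_algebra w GT S Dbu Dbv)); apply: cg.
- exact: Cw.
- exact: dP.
- exact: dP.
- exact: mulP.
- exact: (congr1 (fun z => z *m gam G x u) (mulP x v w)).
- exact: (etrans (mulP x u _) (congr1 (Q u) (mulP x v w))).
- exact: mulP.
- exact: (congr1 (fun z => z *m gam G x v) (mulP x u w)).
- exact: (etrans (mulP x v _) (congr1 (Q v) (mulP x u w))).
Qed.

End Conformal.

Section Blocks.
Variables (R : realType) (n : nat).

(** Writes a block matrix as a sum of products with constant matrices, which reduces smoothness and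
    derivatives to the product rule. *)
Lemma block_mx_mul (a : 'M[R]_n) (b : 'M[R]_(n, 1)) (c : 'M[R]_(1, n)) (d : 'M[R]_1) :
  block_mx a b c d =
    col_mx 1%:M 0 *m a *m row_mx 1%:M 0 + col_mx 1%:M 0 *m b *m row_mx 0 1%:M
    + (col_mx 0 1%:M *m c *m row_mx 1%:M 0 + col_mx 0 1%:M *m d *m row_mx 0 1%:M).
Proof.
rewrite !mul_col_mx !mul1mx !mul0mx !mul_mx_row !mulmx1 !mulmx0.
by rewrite !add_col_mx !addr0 !add0r !add_row_mx !addr0 !add0r.
Qed.

Variable V : normedModType R.

Lemma smoothn_block k (U : set V) (a : V -> 'M[R]_n) (b : V -> 'M[R]_(n, 1))
    (c : V -> 'M[R]_(1, n)) (d : V -> 'M[R]_1) : open U ->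
  smoothn k U a -> smoothn k U b -> smoothn k U c -> smoothn k U d ->
  smoothn k U (fun y => block_mx (a y) (b y) (c y) (d y)).
Proof.
move=> oU sa sb sc sd; under eq_fun do rewrite block_mx_mul.
have M p q (A : 'M[R]_(n + 1, p)) (B : 'M[R]_(q, n + 1)) (X : V -> 'M[R]_(p, q)) :
    smoothn k U X -> smoothn k U (fun y => A *m X y *m B).
  move=> sX; apply: smoothn_mulmx => //; last exact: smoothn_cst.
  by apply: smoothn_mulmx => //; exact: smoothn_cst.
apply: smoothnD => //; apply: smoothnD => //; exact: M.
Qed.

Lemma deriv_block (a : V -> 'M[R]_n) (b : V -> 'M[R]_(n, 1))
    (c : V -> 'M[R]_(1, n)) (d : V -> 'M[R]_1) x v :
  differentiable a x -> differentiable b x -> differentiable c x -> differentiable d x ->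
  'D_v (fun y => block_mx (a y) (b y) (c y) (d y)) x =
  block_mx ('D_v a x) ('D_v b x) ('D_v c x) ('D_v d x).
Proof.
move=> da db dc dd.
have dM p q (A : 'M[R]_(n + 1, p)) (B : 'M[R]_(q, n + 1)) (X : V -> 'M[R]_(p, q)) :
    differentiable X x -> differentiable (fun y => A *m X y *m B) x.
  by move=> dX; exact: diff_mulmx (diff_mulmx (diff_cst' A x) dX) (diff_cst' B x).
have M p q (A : 'M[R]_(n + 1, p)) (B : 'M[R]_(q, n + 1)) (X : V -> 'M[R]_(p, q)) :
    differentiable X x -> 'D_v (fun y => A *m X y *m B) x = A *m 'D_v X x *m B.
  move=> dX; rewrite (deriv_mulmx v (diff_mulmx (diff_cst' A x) dX) (diff_cst' B x)).
  by rewrite (deriv_mulmx v (diff_cst' A x) dX) !deriv_cst mulmx0 addr0 mul0mx add0r.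
pose L1 : 'M[R]_(n + 1, n) := col_mx 1%:M 0; pose L2 : 'M[R]_(n + 1, 1) := col_mx 0 1%:M.
pose R1 : 'M[R]_(n, n + 1) := row_mx 1%:M 0; pose R2 : 'M[R]_(1, n + 1) := row_mx 0 1%:M.
have d1 := dM _ _ L1 R1 _ da; have d2 := dM _ _ L1 R2 _ db.
have d3 := dM _ _ L2 R1 _ dc; have d4 := dM _ _ L2 R2 _ dd.
have -> : (fun y => block_mx (a y) (b y) (c y) (d y)) =
    (fun y => L1 *m a y *m R1 + L1 *m b y *m R2 + (L2 *m c y *m R1 + L2 *m d y *m R2)).
  by apply/funext => y; exact: block_mx_mul.
apply: (etrans (derivD v (differentiableD d1 d2) (differentiableD d3 d4))).
apply: (etrans (congr2 +%R (derivD v d1 d2) (derivD v d3 d4))).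
rewrite (M _ _ L1 R1 _ da) (M _ _ L1 R2 _ db) (M _ _ L2 R1 _ dc) (M _ _ L2 R2 _ dd).
by rewrite -block_mx_mul.
Qed.

End Blocks.

(** * Metrics of constant curvature are conformally flat *)

Section ConstantCurvatureFlat.
Variables (R : realType) (n : nat) (U : set 'rV[R]_n) (G : 'rV[R]_n -> 'M[R]_n) (c : R).
Local Notation V := ('rV[R]_n).
Local Notation e_ i := (delta_mx ord0 i : V).
Hypothesis oU : open U.
Hypothesis sG : forall k, smoothn k U G.
Hypothesis pG : forall x, U x -> posdef (G x).
Hypothesis cc : forall x u v, U x -> curv G x u v = c *: wedge (G x) u v.

(* The linear system grad chi = a, nabla a = - c chi Id for (a, chi); the functions
   chi are the restrictions of linear functions of the model space. *)
Let A x u : 'M[R]_(n + 1) := block_mx (- gam G x u) (G x *m u^T) (- c *: u) 0.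

Let B j x := A x (e_ j).

Let AP x a u v : U x -> A x (a *: u + v) = a *: A x u + A x v.
Proof.
move=> Ux; rewrite /A (gamP oU sG pG _ _ _ Ux) scale_block_mx add_block_mx.
have -> : (a *: u + v)^T = a *: u^T + v^T by apply/matrixP => i j; rewrite !mxE.
congr block_mx.
- by rewrite opprD scalerN.
- by rewrite mulmxDr scalemxAr.
- by rewrite scalerDr !scalerA mulrC.
- by rewrite scaler0 addr0.
Qed.

Let cformA x u : U x -> cform B x u = A x u.
Proof.
move=> Ux; rewrite {2}(row_sum_delta u) /cform.
have A0 : A x 0 = 0.
  by have := AP (-1) 0 0 Ux; rewrite scaler0 addr0 scaleN1r addNr.
elim: (index_enum _) => [|j r IH]; first by rewrite !big_nil A0.
by rewrite !big_cons (AP _ _ _ Ux) IH.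
Qed.

Let sB k j : smoothn k U (B j).
Proof.
apply: smoothn_block => //.
- by apply: smoothnN => //; exact: smoothn_gam.
- by apply: smoothn_mulmx => //; exact: smoothn_cst.
- exact: smoothn_cst.
- exact: smoothn_cst.
Qed.

(** The upper left block is the hypothesis of constant curvature; the others express symmetry of the
    connection, its compatibility with G, and symmetry of G. *)
Let flatA x u v : U x ->
  'D_u (cform B ^~ v) x + cform B x u *m cform B x v = 'D_v (cform B ^~ u) x + cform B x v *m cform B x u.
Proof.
move=> Ux; have dG : differentiable G x := smoothn_diff (@sG 0%N) Ux.
have dg p := diff_gam oU sG pG p Ux.
have D p q : 'D_p (cform B ^~ q) x = block_mx (- 'D_p (gam G ^~ q) x) ('D_p G x *m q^T) 0 0.
  have -> : 'D_p (cform B ^~ q) x = 'D_p (A ^~ q) x.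
    by apply: (derive_eq_on oU _ Ux) => y Uy; exact: cformA.
  rewrite (deriv_block p (differentiableN (dg q)) (diff_mulmx dG (diff_cst' q^T x)) (diff_cst' _ x) (diff_cst' _ x)).
  rewrite (derivN p (dg q)) (deriv_mulmx p dG (diff_cst' q^T x)) !deriv_cst mulmx0 addr0.
  by [].
have S := gam_sym oU sG pG u v Ux; have C := cc u v Ux.
have GT := (pG Ux).1.
rewrite (D u v) (D v u) (cformA u Ux) (cformA v Ux) /A !mulmx_block !add_block_mx.
rewrite (gam_compat_mx oU sG pG u Ux) (gam_compat_mx oU sG pG v Ux).
have ST : (gam G x u)^T *m v^T = (gam G x v)^T *m u^T by rewrite -!trmx_mul S.
move: S C ST GT; rewrite /curv /wedge.
generalize ('D_u (gam G ^~ v) x) ('D_v (gam G ^~ u) x) (gam G x u) (gam G x v) (G x).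
move=> Duv Dvu gu gv g S C ST GT.
have sA p q r (a : R) (X : 'M[R]_(p, q)) (Y : 'M[R]_(q, r)) : (a *: X) *m Y = a *: (X *m Y).
  by rewrite scalemxAl.
have sA' p q r (a : R) (X : 'M[R]_(p, q)) (Y : 'M[R]_(q, r)) : X *m (a *: Y) = a *: (X *m Y).
  by rewrite scalemxAr.
congr block_mx.
- have Cij i j := congr1 (fun X : 'M[R]_n => X i j) C.
  rewrite !(mulmxN, mulNmx, sA', opprK) -!mulmxA.
  apply/matrixP => i j; have := Cij i j; rewrite mulmxBr; rewrite !mxE => h; lra.
- rewrite !(mulmxDl, mulNmx) -!mulmxA ST !mulmx0 !addr0.
  by apply/matrixP => i j; rewrite !mxE; ring.
- by rewrite !(mulmxN, sA, mul0mx, mulNmx) S !addr0 !add0r.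
- rewrite !(mulmx0, sA, addr0, add0r) !mulmxA.
  congr (_ *: _); apply/matrixP => i j; rewrite !ord1.
  exact: (bformC u v GT).
Qed.

(** The factor is l = 1 / psi with psi = chi + 1/2, and b = - l a is the gradient of log l. The
    equation required by [curv_conformal] holds because the initial values fix the first integral at
    c/4. *)
Lemma conformally_flat_at x0 : U x0 -> exists (U' : set V) (phi : V -> R^o),
  [/\ open U', U' x0, U' `<=` U, smooth_on U' phi &
    forall x u v w, U' x -> Rop (fun y => expR (2 * phi y) *: G y) x u v w = 0].
Proof.
move=> Ux0.
have [d d0 [Y Y0 [dU DY]]] := frobenius (row_mx (0 : V) (2^-1)%:M) oU Ux0 (fun j => @sB 2 j) flatA.
have oB : open (ball x0 d) by exact: ball_open.
have sY k : smoothn k (ball x0 d) Y.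
  (* The system expresses the derivative of Y through Y itself, so each differentiability class
     yields the next. *)
  elim: k => [|k IH]; first by apply/smoothn0 => x /DY[].
  apply/smoothnS; split=> [x /DY[]//|v].
  apply: (smoothn_congr oB (F := fun y => Y y *m cform B y v)).
    by move=> x /DY[_ ->].
  apply: smoothn_mulmx => //; apply: smoothn_sum => // j.
  by apply: smoothn_scale => //; [exact: smoothn_cst|exact: smoothn_sub dU (sB j)].
pose a y : V := lsubmx (Y y).
pose chi y : R := (rsubmx (Y y)) ord0 ord0.
have sa k : smoothn k (ball x0 d) a by exact: (@smoothn_lin R V 1 (n + 1) _ k _ lsubmx Y oB (sY k)).
have schi k : smoothn k (ball x0 d) chi.
  by apply: smoothn_coord => //; exact: (@smoothn_lin R V 1 (n + 1) _ k _ rsubmx Y oB (sY k)).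
have DYE x u : ball x0 d x -> 'D_u Y x = row_mx (- (a x *m gam G x u) - (c * chi x) *: u) (a x *m G x *m u^T).
  move=> xb; rewrite (DY _ xb).2 (cformA u (dU _ xb)) -{1}[Y x]hsubmxK mul_row_block mulmx0 addr0 mulmxA mulmxN.
  congr row_mx; congr (_ + _).
  by rewrite {1}[rsubmx (Y x)]mx11_scalar mul_scalar_mx scalerA mulrN scaleNr mulrC.
have dY x : ball x0 d x -> differentiable Y x by move=> /DY[].
have Da x u : ball x0 d x -> 'D_u a x = - (a x *m gam G x u) - (c * chi x) *: u.
  move=> xb; rewrite (@deriv_lin R V 1 (n + 1) _ lsubmx Y x u (dY _ xb)) (DYE _ _ xb).
  exact: row_mxKl.
have Dchi x u : ball x0 d x -> 'D_u chi x = bform (G x) (a x) u.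
  move=> xb; rewrite (deriv_coord _ _ _ (@diff_lin' R V 1 (n + 1) _ rsubmx Y x (dY _ xb))).
  rewrite (@deriv_lin R V 1 (n + 1) _ rsubmx Y x u (dY _ xb)) (DYE _ _ xb).
  exact: (congr1 (fun X : 'M[R]_1 => X ord0 ord0) (row_mxKr _ _)).
have a0 : a x0 = 0 by rewrite /a Y0 row_mxKl.
have chi0 : chi x0 = 2^-1 by rewrite /chi Y0 row_mxKr !mxE eqxx.
(* The first integral of the system: its derivative vanishes since nabla a = - c chi Id and grad chi
   = a. *)
pose inv y := bform (G y) (a y) (a y) + c * (chi y * chi y).
have invE x : ball x0 d x -> bform (G x) (a x) (a x) = c / 4 - c * (chi x * chi x).
  move=> xb; suff : inv x = inv x0.
    rewrite /inv a0 chi0 bform0l => h; lra.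
  apply: (zero_deriv_ball (d := d)) xb => y yb; have Uy := dU _ yb.
  have dG : differentiable G y := smoothn_diff (@sG 0%N) Uy.
  have da := smoothn_diff (sa 0%N) yb; have dc := smoothn_diff (schi 0%N) yb.
  have d1 := diff_bform dG da da; have d2 := differentiableZ c (diff_mul dc dc).
  split; first exact: differentiableD.
  move=> u; apply: (etrans (derivD u d1 d2)).
  apply: (etrans (congr2 +%R (deriv_bform u dG da da) (derivZ c u (diff_mul dc dc)))).
  rewrite (deriv_mul u dc dc) (Da y u yb) (Dchi y u yb) (gam_compat oU sG pG u _ _ Uy).
  have GT := (pG Uy).1.
  rewrite !(bformBl, bformBr, bformNl, bformNr, bformZl, bformZr) (bformC u (a y) GT).
  rewrite -[c *: _]/(c * (_ + _)).
  move: (bform _ _ _) (bform _ _ _) (bform _ _ _) => p q r; ring.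
pose psi y := chi y + 2^-1.
have [d' d'0 d'P] : exists2 d' : R, 0 < d' & ball x0 d' `<=` [set y | ball x0 d y /\ 0 < psi y].
  apply/nbhs_ballP; apply: filterI; first exact: nbhsx_ballx.
  have cpsi : {for x0, continuous psi}.
    apply: differentiable_continuous; apply: differentiableD; last exact: diff_cst'.
    by apply: smoothn_diff (schi 0%N) _; exact: ballxx.
  have : 0 < psi x0 by rewrite /psi chi0; lra.
  exact: (cvgr_gt (psi x0) cpsi).
pose U' := ball x0 d'.
have oU' : open U' by exact: ball_open.
have U'd : U' `<=` ball x0 d by move=> y /d'P[].
have U'U : U' `<=` U by move=> y /U'd /dU.
have psi0 y : U' y -> 0 < psi y by move=> /d'P[].
pose phi y : R := - ln (psi y).
pose l y : R := expR (phi y).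
pose b y : V := - l y *: a y.
have lE y : U' y -> (psi y)^-1 = l y.
  by move=> Uy; rewrite /l /phi expRN lnK// posrE psi0.
have spsi k : smoothn k U' psi.
  by apply: smoothnD => //; [exact: smoothn_sub U'd (schi k)|exact: smoothn_cst].
have sl k : smoothn k U' l.
  apply: (smoothn_congr oU' lE); apply: smoothn_inv => // x /psi0.
  by move=> /lt0r_neq0.
have sb k : smoothn k U' b.
  apply: smoothn_scale => //; last exact: smoothn_sub U'd (sa k).
  exact: smoothnN.
have Dpsi y u : U' y -> 'D_u psi y = bform (G y) (a y) u.
  move=> Uy; have dc := smoothn_diff (schi 0%N) (U'd _ Uy).
  rewrite -(Dchi y u (U'd _ Uy)); apply: (etrans (derivD u dc (diff_cst' _ y))).
  by rewrite deriv_cst addr0.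
have Dl y u : U' y -> 'D_u l y = l y * bform (G y) (b y) u.
  move=> Uy; have dp := smoothn_diff (spsi 0%N) Uy.
  have -> : 'D_u l y = 'D_u (fun y => (psi y)^-1) y.
    by apply: (derive_eq_on oU' _ Uy) => z Uz; rewrite lE.
  rewrite (deriv_inv u (lt0r_neq0 (psi0 _ Uy)) dp) (Dpsi y u Uy) (lE y Uy) /b bformZl; ring.
have Db x u : U' x -> 'D_u b x + b x *m gam G x u =
    (c / 2 - bform (G x) (b x) (b x) / 2) *: u + bform (G x) (b x) u *: b x.
  move=> Ux; have dl := smoothn_diff (sl 0%N) Ux; have da := smoothn_diff (sa 0%N) (U'd _ Ux).
  rewrite (deriv_scale u (differentiableN dl) da) (derivN u dl) (Dl x u Ux) (Da x u (U'd _ Ux)).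
  rewrite -[(- l) x]/(- l x) /b !bformZl bformZr (invE x (U'd _ Ux)).
  have : l x * (chi x + 2^-1) = 1 by rewrite -(lE _ Ux) mulVf// lt0r_neq0// psi0.
  have sA (s : R) (X : V) (Z : 'M[R]_n) : (s *: X) *m Z = s *: (X *m Z) by rewrite scalemxAl.
  rewrite !sA; move: (a x *m gam G x u) (a x) (l x) (chi x) (bform _ _ _) => ag ax lx cx gau h.
  (* By the first integral |b|^2 = l^2 c (1/2 - chi) (chi + 1/2), and l (chi + 1/2) = 1 removes one
     factor. *)
  have e : c / 2 - - lx * (- lx * (c / 4 - c * (cx * cx))) / 2 = lx * c * cx.
    have -> : c / 4 - c * (cx * cx) = c * (2^-1 - cx) * (cx + 2^-1) by field.
    have -> : - lx * (- lx * (c * (2^-1 - cx) * (cx + 2^-1))) = lx * (c * (2^-1 - cx)) * (lx * (cx + 2^-1)) by ring.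
    have hc : c = c * (lx * (cx + 2^-1)) by rewrite h mulr1.
    by rewrite h mulr1 {1}hc; field.
  rewrite e; apply/rowP => j; rewrite !mxE; ring.
exists U', phi; split => //.
- exact: ballxx.
- apply/smooth_onP => k.
  (* The derivative of phi is given by b, already known to be smooth, so the logarithm needs to be
     differentiated only once. *)
  have dphi x : U' x -> differentiable phi x /\ forall v, 'D_v phi x = bform (G x) (b x) v.
    move=> Ux; have dp := smoothn_diff (spsi 0%N) Ux.
    have [dln Dln] := is_derive1_ln (psi0 _ Ux).
    have {}dln : differentiable (@ln R) (psi x) by exact/derivable1_diffP.
    have dlp := @diff_compose _ _ _ _ psi (@ln R) x dp dln.
    split; first exact: (differentiableN dlp).
    move=> v; apply: (etrans (derivN v dlp)).
    rewrite (@derive_comp _ _ _ _ psi (@ln R) x v dp dln) (Dpsi x v Ux).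
    have -> : 'D_(bform (G x) (a x) v) (@ln R) (psi x) = bform (G x) (a x) v *: 'D_1 (@ln R) (psi x).
      by rewrite !deriveE// -linearZ /= [_ *: 1]mulr1.
    by rewrite Dln (lE x Ux) /b bformZl -[_ *: l x]/(_ * _) mulNr mulrC.
  case: k => [|k]; first by apply/smoothn0 => x /dphi[].
  apply/smoothnS; split=> [x /dphi[]//|v].
  apply: (smoothn_congr oU' (F := fun y => bform (G y) (b y) v)).
    by move=> x /dphi[_ ->].
  by apply: smoothn_bform => //; [exact: smoothn_sub U'U (@sG k)|exact: smoothn_cst].
have sG' k : smoothn k U' G by exact: smoothn_sub U'U (@sG k).
have pG' x : U' x -> posdef (G x) by move=> /U'U; exact: pG.
move=> x u v w Ux.
have -> : (fun y => expR (2 * phi y) *: G y) = (fun y => (l y * l y) *: G y).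
  by apply/funext => y; rewrite /l -expRD mulrDl mul1r.
have l0 y : U' y -> l y != 0 by move=> _; rewrite gt_eqF// expR_gt0.
have oH k : smoothn k U' (fun y => (l y * l y) *: G y).
  by apply: smoothn_scale => //; exact: smoothn_mul.
have pH y : U' y -> posdef ((l y * l y) *: G y).
  by move=> Uy; apply: posdef_scale (pG' _ Uy); rewrite mulr_gt0// expR_gt0.
rewrite (Rop_curv oU' oH pH u v w Ux).
rewrite (curv_conformal oU' sG' pG' sl sb l0 Dl Db) ?mulmx0//.
by move=> y p q /U'U; exact: cc.
Qed.

End ConstantCurvatureFlat.

(** * The spectral theorem *)

Section Spectral.
Variables (R : realType).

Lemma bform1E n (u v : 'rV[R]_n) : bform 1%:M u v = \sum_i u ord0 i * v ord0 i.
Proof. by rewrite /bform mulmx1 mxE; apply: eq_bigr => i _; rewrite mxE. Qed.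

Lemma bform1_ge0 n (u : 'rV[R]_n) : 0 <= bform 1%:M u u.
Proof. by rewrite bform1E; apply: sumr_ge0 => i _; rewrite -expr2 sqr_ge0. Qed.

Lemma bform1_eq0 n (u : 'rV[R]_n) : bform 1%:M u u = 0 -> u = 0.
Proof.
have H0 i : true -> 0 <= u ord0 i * u ord0 i by rewrite -expr2 sqr_ge0.
rewrite bform1E => /(psumr_eq0P H0) H; apply/rowP => i; rewrite mxE; apply/eqP.
by rewrite -sqrf_eq0 expr2 H.
Qed.

Lemma bform1_gt0 n (u : 'rV[R]_n) : u != 0 -> 0 < bform 1%:M u u.
Proof.
move=> u0; rewrite lt_neqAle bform1_ge0 andbT eq_sym.
by apply: contra u0 => /eqP/bform1_eq0 ->.
Qed.

Lemma bform_continuous n (A : 'M[R]_n) : continuous (fun u : 'rV[R]_n => bform A u u).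
Proof.
move=> u; apply: differentiable_continuous.
by apply: (diff_bform (diff_cst' A u)); exact: (@ex_diff _ _ _ _ _ id).
Qed.

(** At v + t y the form is 2 t s + t^2 q, which stays nonnegative for all t only if s = 0. *)
Lemma psd_kernel n (B : 'M[R]_n) v : B^T = B -> (forall u, 0 <= bform B u u) ->
  bform B v v = 0 -> v *m B = 0.
Proof.
move=> BT B0 vv; apply/rowP => j; rewrite -bform_deltar [RHS]mxE.
set y := delta_mx _ _; pose s := bform B v y; rewrite -/s.
have key (t : R) : 0 <= 2 * t * s + t * t * bform B y y.
  have := B0 (v + t *: y); rewrite bformDl !bformDr !bformZl !bformZr vv (bformC y v BT) -/s.
  by move: (bform B y y) => q h; lra.
have q0 := B0 y; move: key q0; move: (bform B y y) => q key q0.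
have q1 : 0 < q + 1 by lra.
(* Near the minimising value - s / q, with q + 1 in place of q because q may be zero. *)
have := key (- s / (q + 1)).
have -> : 2 * (- s / (q + 1)) * s + - s / (q + 1) * (- s / (q + 1)) * q = - (s * s) * (q + 2) / ((q + 1) * (q + 1)).
  by field; rewrite gt_eqF.
rewrite pmulr_lge0 ?invr_gt0 ?mulr_gt0// pmulr_lge0; last by lra.
rewrite oppr_ge0 -expr2 => h.
by apply/eqP; rewrite -sqrf_eq0 eq_le h sqr_ge0.
Qed.

(** The quadratic form of A attains its maximum l on the unit sphere at some v. Then l Id - A is
    positive semidefinite and its form vanishes at v, so [psd_kernel] applies. *)
Lemma real_eigenvector n (A : 'M[R]_n.+1) : A^T = A ->
  exists (v : 'rV[R]_n.+1) (l : R), bform 1%:M v v = 1 /\ v *m A = l *: v.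
Proof.
move=> AT; pose S := [set v : 'rV[R]_n.+1 | bform 1%:M v v = 1].
have e0S : S (delta_mx ord0 ord0) by rewrite /S /= bform_delta mxE eqxx.
have cS : compact S.
  apply: bounded_closed_compact.
    exists 1; split; first exact: num_real.
    move=> M M1 v; rewrite /S /= => vv; apply: mx_norm_le; first by rewrite (le_trans _ (ltW M1)).
    move=> i j; rewrite ord1; apply: le_trans (ltW M1).
    have : v ord0 j ^+ 2 <= 1.
      rewrite -vv bform1E (bigD1 j)//= -expr2 lerDl; apply: sumr_ge0 => k _.
      by rewrite -expr2 sqr_ge0.
    by rewrite -[X in X <= _ -> _]real_normK ?num_real// -[X in _ <= X](expr1n _ 2) ler_pXn2r// ?nnegrE.
  apply: (@closed_comp _ _ (fun v => bform 1%:M v v) [set 1]) => [v _|]; first exact: bform_continuous.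
  exact: closed_eq.
have [v vS vmax] := @EVT_max_rV R n.+1 (fun v => bform A v v) S (ex_intro _ _ e0S) cS
   (continuous_subspaceT (@bform_continuous _ A)).
move: vS; rewrite inE /S /= => vv.
pose l := bform A v v; exists v, l; split=> //.
have : v *m (l *: 1%:M - A) = 0.
  apply: psd_kernel; first by rewrite linearB linearZ /= trmx1 AT.
    move=> u; rewrite bformDm bformNm bformZm subr_ge0.
    have [->|u0] := eqVneq u 0; first by rewrite !bform0l mulr0.
    have uu := bform1_gt0 u0; pose s := Num.sqrt (bform 1%:M u u).
    have s0 : s != 0 by rewrite gt_eqF// sqrtr_gt0.
    have ss : s * s = bform 1%:M u u by rewrite -expr2 sqr_sqrtr// ltW.
    have := vmax (s^-1 *: u); rewrite !inE /S /= !bformZl !bformZr -/l.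
    rewrite !mulrA -!invfM ss mulVf ?gt_eqF// => /(_ erefl).
    by rewrite mulrC ler_pdivrMr.
  by rewrite bformDm bformNm bformZm vv mulr1 subrr.
rewrite mulmxBr -scalemxAr mulmx1 => /eqP; rewrite subr_eq0 => /eqP <-.
by [].
Qed.

Definition orthogonal n (Q : 'M[R]_n) := Q *m Q^T = 1%:M.

Lemma orthogonalT n (Q : 'M[R]_n) : orthogonal Q -> Q^T *m Q = 1%:M.
Proof. exact: mulmx1C. Qed.

Lemma orthogonalM n (P Q : 'M[R]_n) : orthogonal P -> orthogonal Q -> orthogonal (P *m Q).
Proof. by rewrite /orthogonal => oP oQ; rewrite trmx_mul mulmxA -(mulmxA P) oQ mulmx1. Qed.

(** The reflection in the hyperplane orthogonal to e - v exchanges the first basis vector e with v;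
    if they coincide the identity serves. *)
Lemma householder n (v : 'rV[R]_n.+1) : bform 1%:M v v = 1 ->
  exists2 Q : 'M[R]_n.+1, orthogonal Q & row ord0 Q = v.
Proof.
move=> vv; pose e : 'rV[R]_n.+1 := delta_mx ord0 ord0; pose w := e - v.
have ee : bform 1%:M e e = 1 by rewrite bform_delta mxE eqxx.
have [w0|w0] := eqVneq w 0.
  exists 1%:M; first by rewrite /orthogonal trmx1 mulmx1.
  by rewrite row1; apply/eqP; rewrite -subr_eq0; apply/eqP.
have ww := bform1_gt0 w0; set s := bform 1%:M w w in ww.
have sE : s = 2 - 2 * bform 1%:M e v.
  by rewrite /s /w bformBl !bformBr (bformC v e (trmx1 _ _)) ee vv; ring.
have wwT : w *m w^T = s%:M by rewrite [LHS]mx11_scalar /s /bform mulmx1.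
pose Q := 1%:M - (2 / s) *: (w^T *m w).
have QT : Q^T = Q by rewrite /Q linearB linearZ /= trmx1 trmx_mul trmxK.
exists Q.
  have XX : (w^T *m w) *m (w^T *m w) = s *: (w^T *m w).
    by rewrite mulmxA -[w^T *m w *m w^T]mulmxA wwT mul_mx_scalar scalemxAl.
  rewrite /orthogonal QT /Q; move: (w^T *m w) XX => X XX.
  have -> : (1%:M - (2 / s) *: X) *m (1%:M - (2 / s) *: X) =
      1%:M - (2 / s) *: X - ((2 / s) *: X - (2 / s * (2 / s)) *: (X *m X)).
    by rewrite mulmxBl !mulmxBr !(mul1mx, mulmx1) -scalemxAl -scalemxAr scalerA.
  rewrite XX; apply/matrixP => i j; rewrite !mxE.
  by field; rewrite gt_eqF.
rewrite rowE /Q mulmxBr mulmx1 -scalemxAr mulmxA -/e.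
have -> : e *m w^T = (s / 2)%:M.
  rewrite [LHS]mx11_scalar; congr (_%:M).
  have -> : (e *m w^T) 0 0 = bform 1%:M e w by rewrite /bform mulmx1.
  by rewrite /w bformBr ee sE; field.
rewrite mul_scalar_mx scalerA (_ : 2 / s * (s / 2) = 1); last by field; rewrite gt_eqF.
by rewrite scale1r /w subKr.
Qed.

Theorem spectral_theorem n (A : 'M[R]_n) : A^T = A ->
  exists (Q : 'M[R]_n) (d : 'rV[R]_n), orthogonal Q /\ Q *m A *m Q^T = diag_mx d.
Proof.
elim: n A => [|n IH] A AT.
  by exists 1%:M, 0; split; [rewrite /orthogonal trmx1 mulmx1|apply/matrixP => -[]].
have [v [l [vv vA]]] := real_eigenvector AT.
have [P oP Pv] := householder vv.
have [B BE] : exists B : 'M[R]_(1 + n), B = P *m A *m P^T by eexists.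
have BT : B^T = B by rewrite BE !trmx_mul trmxK AT mulmxA.
have rB : row ord0 B = l *: delta_mx ord0 ord0.
  rewrite BE !row_mul Pv vA -scalemxAl -Pv rowE -mulmxA oP mulmx1.
  by [].
have dT : (drsubmx B)^T = drsubmx B by rewrite trmx_drsub BT.
have [Q [d [oQ QB]]] := IH _ dT.
have Bblock : B = block_mx l%:M 0 0 (drsubmx B).
  have B0 j : B ord0 j = l * (ord0 == j :> 'I_(1 + n))%:R.
    have := congr1 (fun X : 'rV[R]_(1 + n) => X ord0 j) rB; rewrite !mxE => ->.
    by rewrite eq_sym.
  have lsh i : lshift n i = ord0 :> 'I_(1 + n) by apply/val_inj; rewrite /= (ord1 i).
  have ur i j : B (lshift n i) (rshift 1 j) = 0 by rewrite lsh B0 mulr0.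
  rewrite -{1}[B]submxK; congr block_mx; apply/matrixP => i j; rewrite !mxE.
  - by rewrite !lsh B0 !ord1 !eqxx mulr1.
  - exact: ur.
  - by rewrite -BT mxE ur.
pose O : 'M[R]_(1 + n) := block_mx 1%:M 0 0 Q.
have oO : orthogonal O.
  rewrite /orthogonal /O tr_block_mx mulmx_block !trmx0 trmx1 !(mulmx0, mul0mx, mulmx1, addr0, add0r) oQ.
  by rewrite -scalar_mx_block.
exists (O *m P), (row_mx l%:M d); split; first exact: orthogonalM.
have -> : O *m P *m A *m (O *m P)^T = O *m B *m O^T by rewrite trmx_mul BE !mulmxA.
rewrite Bblock /O tr_block_mx !mulmx_block !trmx0 trmx1 !(mulmx0, mul0mx, mulmx1, mul1mx, addr0, add0r) QB.
have e := diag_mx_row (l%:M : 'rV[R]_1) d.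
have E : l%:M = diag_mx (l%:M : 'rV[R]_1) by apply/matrixP => i j; rewrite !mxE !ord1.
exact: (etrans (congr1 (fun X : 'M[R]_1 => block_mx X 0 0 (diag_mx d)) E) (esym e)).
Qed.

End Spectral.

(** * The equality case of the DDVV inequality *)

(* a : eigenvalues of a symmetric matrix A of norm 1; q i j : sum of the squares of the
   (i, j) entries of an orthonormal family C_be, in an eigenbasis of A.  Then the sum of
   ((a i - a j)^2 - 1) q i j is the sum of the |[A, C_be]|^2 - 1.  The pairs with a
   positive coefficient all contain a common index i0. *)
Section Star.
Variables (R : realFieldType) (n : nat) (a : 'I_n -> R).
Hypothesis a1 : \sum_i a i ^+ 2 = 1.

Lemma sum_distinct_le (s : seq 'I_n) : uniq s -> \sum_(i <- s) a i ^+ 2 <= 1.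
Proof.
move=> us; rewrite -a1 big_uniq//= [leRHS](bigID (mem s))/= lerDl.
by apply: sumr_ge0 => i _; exact: sqr_ge0.
Qed.

(** Since (a_i - a_j)^2 <= 2 (a_i^2 + a_j^2), each such pair takes more than half of the total 1. *)
Lemma star_disjoint i j k l : uniq [:: i; j; k; l] ->
  1 < (a i - a j) ^+ 2 -> 1 < (a k - a l) ^+ 2 -> False.
Proof.
move=> /sum_distinct_le; rewrite !big_cons big_nil => h h1 h2.
have := sqr_ge0 (a i + a j); have := sqr_ge0 (a k + a l); nra.
Qed.

(** The three squared differences add up to three times the sum of squares minus the square of the
    sum, hence to at most 3. *)
Lemma star_triangle i j k : uniq [:: i; j; k] ->
  1 < (a i - a j) ^+ 2 -> 1 < (a j - a k) ^+ 2 -> 1 < (a i - a k) ^+ 2 -> False.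
Proof.
move=> /sum_distinct_le; rewrite !big_cons big_nil => h h1 h2 h3.
have := sqr_ge0 (a i + a j + a k); nra.
Qed.

(** A graph without two disjoint edges and without triangles is a star. If there is no edge any
    index serves as centre. *)
Lemma star_center : exists i0, forall i j, 1 < (a i - a j) ^+ 2 -> i = i0 \/ j = i0.
Proof.
pose E i j := 1 < (a i - a j) ^+ 2.
have Esym i j : E i j -> E j i by rewrite /E -sqrrN opprB.
have Eneq i j : E i j -> i != j.
  by move=> h; apply/eqP => ij; move: h; rewrite /E ij subrr expr0n /= ltNge ler01.
have [[i0 [j0 e0]]|ne] := pselect (exists i j, E i j); last first.
  have [i _|n0] := pickP (fun i : 'I_n => true).
    by exists i => j k jk; case: ne; exists j, k.
  by move: a1; rewrite big_pred0 => [/eqP|//]; rewrite eq_sym oner_eq0.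
have [all_i|] := pselect (forall i j, E i j -> i = i0 \/ j = i0); first by exists i0.
move=> /existsNP[k /existsNP[l /not_implyP[kl /not_orP[/eqP ki /eqP li]]]].
exists j0 => p q pq; apply: contrapT => /not_orP[/eqP pj /eqP qj].
have ij := Eneq _ _ e0; have kl' := Eneq _ _ kl; have pq' := Eneq _ _ pq.
(* an edge avoiding i0 passes through j0, an edge avoiding j0 passes through i0 *)
have [k1 [e1 k1i]] : exists k1, E j0 k1 /\ k1 != i0.
  have [->|kj] := eqVneq j0 k; first by exists l.
  have [->|lj] := eqVneq j0 l; first by exists k; split; first exact: Esym.
  case: (@star_disjoint i0 j0 k l) => //.
  by rewrite /= !inE !negb_or ij (eq_sym i0 k) ki (eq_sym i0 l) li kj lj kl'.
have [p1 [e2 p1j]] : exists p1, E i0 p1 /\ p1 != j0.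
  have [->|ip] := eqVneq i0 p; first by exists q.
  have [->|iq] := eqVneq i0 q; first by exists p; split; first exact: Esym.
  case: (@star_disjoint i0 j0 p q) => //.
  by rewrite /= !inE !negb_or ij ip iq (eq_sym j0 p) pj (eq_sym j0 q) qj pq'.
have jk := Eneq _ _ e1; have ip := Eneq _ _ e2.
have [kp|kp] := eqVneq k1 p1.
  apply: (@star_triangle i0 j0 k1) => //; last by rewrite kp.
  by rewrite /= !inE !negb_or ij (eq_sym i0 k1) k1i jk.
apply: (@star_disjoint j0 k1 i0 p1) => //.
by rewrite /= !inE !negb_or jk (eq_sym j0 i0) ij (eq_sym j0 p1) p1j k1i kp ip.
Qed.

Variable q : 'I_n -> 'I_n -> R.
Hypothesis q_ge0 : forall i j, 0 <= q i j.
Hypothesis q_sym : forall i j, q i j = q j i.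
Hypothesis q_half : forall i j, i != j -> q i j <= 1 / 2.

Let w i j := (a i - a j) ^+ 2 - 1.

Section Center.
Variable i0 : 'I_n.
Hypothesis center : forall i j, 1 < (a i - a j) ^+ 2 -> i = i0 \/ j = i0.

Let r j := 2 * q i0 j.
Let P := fun j : 'I_n => j != i0.
Let RR := \sum_(j | P j) r j.
Let X := \sum_(j | P j) r j * a j.
Let Y := \sum_(j | P j) r j * a j ^+ 2.
Let S := \sum_(j | P j) a j ^+ 2.

Let r_ge0 j : 0 <= r j.
Proof. by rewrite mulr_ge0. Qed.

Let r_le1 j : P j -> r j <= 1.
Proof.
by rewrite /P eq_sym => /q_half h; rewrite /r; lra.
Qed.

Let SE : a i0 ^+ 2 + S = 1.
Proof. by rewrite -a1 (bigD1 i0). Qed.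

Let YS : 0 <= S - Y.
Proof.
rewrite -sumrB; apply: sumr_ge0 => j Pj.
have := r_le1 Pj; have := sqr_ge0 (a j); nra.
Qed.

Let gen (A B C : R) : \sum_(j | P j) (A * (r j * a j ^+ 2) - B * (r j * a j) + C * r j) =
  A * Y - B * X + C * RR.
Proof. by rewrite big_split sumrB /X /Y /RR !mulr_sumr. Qed.

(** Weighted Cauchy-Schwarz: times RR, the defect is the weighted sum of the squares of RR a_j - X,
    which also yields the equality case. *)
Let CS : 0 <= RR * Y - X ^+ 2 /\ (RR * Y - X ^+ 2 = 0 -> forall j, P j -> r j * (RR * a j - X) ^+ 2 = 0).
Proof.
have sE : \sum_(j | P j) r j * (RR * a j - X) ^+ 2 = RR * (RR * Y - X ^+ 2).
  transitivity (RR ^+ 2 * Y - 2 * RR * X * X + X ^+ 2 * RR); last by ring.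
  by rewrite -gen; apply: eq_bigr => j _; ring.
have s0 : 0 <= \sum_(j | P j) r j * (RR * a j - X) ^+ 2.
  by apply: sumr_ge0 => j _; rewrite mulr_ge0// sqr_ge0.
have RR0 : 0 <= RR by apply: sumr_ge0.
split; last first.
  move=> e; apply: psumr_eq0P => [j _|]; first by rewrite mulr_ge0// sqr_ge0.
  by rewrite sE e mulr0.
have [R0|R0] := eqVneq RR 0.
  have rj j : P j -> r j = 0 by apply: psumr_eq0P.
  rewrite R0 mul0r sub0r /X big1 ?expr0n ?oppr0// => j Pj.
  by rewrite rj// mul0r.
have Rp : 0 < RR by rewrite lt_neqAle eq_sym R0.
by move: s0; rewrite sE pmulr_rge0.
Qed.

(** The subtracted terms are all nonnegative: the first since r_j <= 1, the second by
    Cauchy-Schwarz, the third as a square. *)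
Let star_row : \sum_(j | P j) w i0 j * r j =
  1 - ((RR + 1) * (S - Y) + (RR * Y - X ^+ 2) + (a i0 + X) ^+ 2).
Proof.
transitivity (1 * Y - (2 * a i0) * X + (a i0 ^+ 2 - 1) * RR).
  by rewrite -gen; apply: eq_bigr => j _; rewrite /w; ring.
have e : a i0 ^+ 2 = 1 - S by have := SE; lra.
by rewrite sqrrD e; ring.
Qed.

Let split_sum : \sum_i \sum_j w i j * q i j =
  \sum_(j | P j) w i0 j * r j + (- q i0 i0 + \sum_(i | P i) \sum_(j | P j) w i j * q i j).
Proof.
rewrite (bigD1 i0)//= (bigD1 i0)//=.
have -> : \sum_(i | i != i0) \sum_j w i j * q i j =
    \sum_(i | P i) (w i i0 * q i i0 + \sum_(j | P j) w i j * q i j).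
  by apply: eq_bigr => i _; rewrite (bigD1 i0).
rewrite big_split /=.
have -> : \sum_(j | P j) w i0 j * r j = \sum_(j | P j) w i0 j * q i0 j + \sum_(j | P j) w j i0 * q j i0.
  rewrite -big_split /=; apply: eq_bigr => j _; rewrite /r (q_sym j i0) /w; ring.
have -> : w i0 i0 * q i0 i0 = - q i0 i0 by rewrite /w subrr; ring.
by rewrite /P; ring.
Qed.

Let off_le0 i j : P i -> P j -> w i j * q i j <= 0.
Proof.
move=> Pi Pj; rewrite mulr_le0_ge0// /w subr_le0 leNgt; apply/negP => /center[e|e].
  by move: Pi; rewrite /P e eqxx.
by move: Pj; rewrite /P e eqxx.
Qed.

Let RR0 : 0 <= RR. Proof. by apply: sumr_ge0. Qed.

Lemma star_le : \sum_i \sum_j w i j * q i j <= 1.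
Proof.
rewrite split_sum star_row.
have : \sum_(i | P i) \sum_(j | P j) w i j * q i j <= 0.
  by apply: sumr_le0 => i Pi; apply: sumr_le0 => j Pj; exact: off_le0.
have := q_ge0 i0 i0; have := sqr_ge0 (a i0 + X); have [+ _] := CS.
have : 0 <= (RR + 1) * (S - Y) by rewrite mulr_ge0// addr_ge0.
lra.
Qed.

(** All nonnegative terms of [star_row] vanish, as do the entries off the star. The first two give
    (1 - r_j) a_j^2 = 0 and r_j (RR a_j - X)^2 = 0, which leave two kinds of leaves. *)
Lemma star_eq : \sum_i \sum_j w i j * q i j = 1 ->
  [/\ forall i j, (i == i0) = (j == i0) -> q i j = 0,
      0 < RR, a i0 != 0 &
      forall j, j != i0 -> (r j = 1 /\ RR * a j = - a i0) \/ (r j = 0 /\ a j = 0)].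
Proof.
rewrite split_sum star_row => e.
have O0 : \sum_(i | P i) \sum_(j | P j) w i j * q i j <= 0.
  by apply: sumr_le0 => i Pi; apply: sumr_le0 => j Pj; exact: off_le0.
have [cs0 csE] := CS; have s0 := sqr_ge0 (a i0 + X); have q0 := q_ge0 i0 i0.
have y0 : 0 <= (RR + 1) * (S - Y) by rewrite mulr_ge0// addr_ge0.
have eX : (a i0 + X) ^+ 2 = 0 by lra.
have eC : RR * Y - X ^+ 2 = 0 by lra.
have eY : (RR + 1) * (S - Y) = 0 by lra.
have eq0 : q i0 i0 = 0 by lra.
have eO : \sum_(i | P i) \sum_(j | P j) w i j * q i j = 0 by lra.
have Xa : X = - a i0.
  by move/eqP: eX; rewrite sqrf_eq0 addr_eq0 => /eqP ->; rewrite opprK.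
have SY : S = Y.
  move/eqP: eY; rewrite mulf_eq0 gt_eqF ?ltr_wpDl//= subr_eq0 => /eqP.
  by [].
have ra j : P j -> r j = 1 \/ a j = 0.
  move=> Pj; have : (1 - r j) * a j ^+ 2 = 0.
    have : \sum_(j | P j) (1 - r j) * a j ^+ 2 = 0.
      rewrite -[RHS](subrr S) {2}SY /S /Y -sumrB; apply: eq_bigr => k _; ring.
    move=> /psumr_eq0P; apply => // k Pk.
    by rewrite mulr_ge0 ?sqr_ge0// subr_ge0 r_le1.
  move=> /eqP; rewrite mulf_eq0 sqrf_eq0 subr_eq0 => /orP[/eqP ->|/eqP ->]; by [left|right].
have rX j : P j -> r j = 0 \/ RR * a j = - a i0.
  move=> Pj; have /eqP := csE eC _ Pj; rewrite mulf_eq0 sqrf_eq0 subr_eq0 Xa.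
  by move=> /orP[/eqP ->|/eqP ->]; [left|right].
have RRz : RR != 0.
  apply/eqP => R0.
  have rj j : P j -> r j = 0 by apply: psumr_eq0P.
  have X0 : X = 0 by rewrite /X big1// => j Pj; rewrite rj// mul0r.
  have Y0 : Y = 0 by rewrite /Y big1// => j Pj; rewrite rj// mul0r.
  have := SE; rewrite SY Y0 -[a i0]opprK -Xa X0 oppr0 expr0n /= addr0 => /eqP.
  by rewrite eq_sym oner_eq0.
have ai0 : a i0 != 0.
  apply/eqP => a0; have := SE; rewrite SY.
  move: eC; rewrite Xa a0 oppr0 expr0n /= subr0 => /eqP; rewrite mulf_eq0 (negPf RRz) /= => /eqP ->.
  by rewrite addr0 => /eqP; rewrite eq_sym oner_eq0.
have cases j : j != i0 -> (r j = 1 /\ RR * a j = - a i0) \/ (r j = 0 /\ a j = 0).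
  move=> Pj; have [r1|aj] := ra j Pj.
    left; split=> //; have [r0|//] := rX j Pj.
    by move: r0; rewrite r1 => /eqP; rewrite oner_eq0.
  right; split=> //; have [//|h] := rX j Pj.
  by move: h; rewrite aj mulr0 => /esym/eqP; rewrite oppr_eq0 (negPf ai0).
split=> //; last by rewrite lt_neqAle eq_sym RRz.
move=> i j; have [->|Pi] := eqVneq i i0.
  by move=> /esym/eqP ->.
move=> /esym/negbT Pj.
have wq : w i j * q i j = 0.
  have := @psumr_eq0P _ _ (fun i => P i) (fun i => - \sum_(j | P j) w i j * q i j).
  have h k : P k -> 0 <= - \sum_(j | P j) w k j * q k j.
    by move=> Pk; rewrite oppr_ge0; apply: sumr_le0 => l Pl; exact: off_le0.
  move=> /(_ h); rewrite sumrN eO oppr0 => /(_ erefl i Pi) /eqP; rewrite oppr_eq0 => /eqP e1.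
  have := @psumr_eq0P _ _ (fun j => P j) (fun j => - (w i j * q i j)).
  have h' k : P k -> 0 <= - (w i k * q i k) by move=> Pk; rewrite oppr_ge0 off_le0.
  by move=> /(_ h'); rewrite sumrN e1 oppr0 => /(_ erefl j Pj) /eqP; rewrite oppr_eq0 => /eqP.
move/eqP: wq; rewrite mulf_eq0 => /orP[/eqP w0|/eqP //].
(* Remaining case w i j = 0 off the star: the leaves with a nonzero value all share it, and its
   square is less than 1 because the centre also has a share, so (a_i - a_j)^2 < 1. *)
have lt1 k : P k -> a k ^+ 2 < 1.
  move=> Pk; have := SE; rewrite /S (bigD1 k)//=.
  have : 0 <= \sum_(i | P i && (i != k)) a i ^+ 2 by apply: sumr_ge0 => ? _; exact: sqr_ge0.
  have : 0 < a i0 ^+ 2 by rewrite exprn_even_gt0.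
  lra.
have : (a i - a j) ^+ 2 < 1.
  have l1 := lt1 _ Pi; have l2 := lt1 _ Pj.
  have [[_ ei]|[_ ei]] := cases i Pi; have [[_ ej]|[_ ej]] := cases j Pj.
  - have -> : a i = a j by apply: (mulfI RRz); rewrite ei ej.
    by rewrite subrr expr0n /= ltr01.
  - by rewrite ej subr0.
  - by rewrite ei sub0r sqrrN.
  - by rewrite ei ej subrr expr0n /= ltr01.
by move: w0; rewrite /w => /eqP; rewrite subr_eq0 => /eqP ->; rewrite ltxx.
Qed.

End Center.
End Star.

(** * The Frobenius product, commutators and rotations of a family of matrices *)

Section Frobenius.
Variables (R : realType).

Definition fro n (A C : 'M[R]_n) := \sum_i \sum_j A i j * C i j.
Definition brk n (A C : 'M[R]_n) := A *m C - C *m A.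

Lemma fro_tr n (A C : 'M[R]_n) : fro A C = \tr (A *m C^T).
Proof.
by rewrite /fro /mxtrace; apply: eq_bigr => i _; rewrite mxE; apply: eq_bigr => j _; rewrite mxE.
Qed.

Lemma fro_conj n (Q A C : 'M[R]_n) : orthogonal Q ->
  fro (Q *m A *m Q^T) (Q *m C *m Q^T) = fro A C.
Proof.
move=> oQ; rewrite !fro_tr !trmx_mul trmxK !mulmxA -(mulmxA _ Q^T Q) (orthogonalT oQ) mulmx1.
by rewrite -!mulmxA mxtrace_mulC !mulmxA -(mulmxA _ Q^T Q) (orthogonalT oQ) mulmx1.
Qed.

Lemma fro_ge0 n (A : 'M[R]_n) : 0 <= fro A A.
Proof. by apply: sumr_ge0 => i _; apply: sumr_ge0 => j _; rewrite -expr2 sqr_ge0. Qed.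

Lemma fro_eq0 n (A : 'M[R]_n) : fro A A = 0 -> A = 0.
Proof.
have h i : 0 <= \sum_j A i j * A i j by apply: sumr_ge0 => j _; rewrite -expr2 sqr_ge0.
move=> /(psumr_eq0P (fun i _ => h i)) e; apply/matrixP => i j; rewrite mxE; apply/eqP.
have h' k : 0 <= A i k * A i k by rewrite -expr2 sqr_ge0.
by rewrite -sqrf_eq0 expr2 (psumr_eq0P (fun k _ => h' k) (e i isT)).
Qed.

Lemma froC n (A C : 'M[R]_n) : fro A C = fro C A.
Proof. by apply: eq_bigr => i _; apply: eq_bigr => j _; rewrite mulrC. Qed.

Lemma froZl n a (A C : 'M[R]_n) : fro (a *: A) C = a * fro A C.
Proof.
rewrite /fro mulr_sumr; apply: eq_bigr => i _; rewrite mulr_sumr; apply: eq_bigr => j _.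
by rewrite mxE mulrA.
Qed.

Lemma froZr n a (A C : 'M[R]_n) : fro A (a *: C) = a * fro A C.
Proof. by rewrite froC froZl froC. Qed.

Lemma fro_suml n (I : finType) (P : pred I) (A : I -> 'M[R]_n) C :
  fro (\sum_(k | P k) A k) C = \sum_(k | P k) fro (A k) C.
Proof.
rewrite fro_tr mulmx_suml raddf_sum; apply: eq_bigr => k _.
by rewrite fro_tr.
Qed.

Lemma fro_sumr n (I : finType) (P : pred I) (A : I -> 'M[R]_n) C :
  fro C (\sum_(k | P k) A k) = \sum_(k | P k) fro C (A k).
Proof. by rewrite froC fro_suml; apply: eq_bigr => k _; rewrite froC. Qed.

Lemma froDl n (A C D : 'M[R]_n) : fro (A + C) D = fro A D + fro C D.
Proof. by rewrite !fro_tr mulmxDl linearD. Qed.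

Lemma fro_delta n i j (A : 'M[R]_n) : fro (delta_mx i j) A = A i j.
Proof.
rewrite /fro (bigD1 i)//= (bigD1 j)//= !big1 => [|k /negPf ki|k /negPf kj].
- by rewrite mxE !eqxx mul1r !addr0.
- by rewrite big1// => l _; rewrite mxE ki mul0r.
- by rewrite mxE kj andbF mul0r.
Qed.

Lemma brk_conj n (Q A C : 'M[R]_n) : orthogonal Q ->
  brk (Q *m A *m Q^T) (Q *m C *m Q^T) = Q *m brk A C *m Q^T.
Proof.
move=> oQ; rewrite /brk mulmxBr mulmxBl.
by congr (_ - _); rewrite !mulmxA -(mulmxA _ Q^T Q) (orthogonalT oQ) mulmx1.
Qed.

Lemma brkZ n a c (A C : 'M[R]_n) : brk (a *: A) (c *: C) = (a * c) *: brk A C.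
Proof. by rewrite /brk -!scalemxAl -!scalemxAr !scalerA scalerBr (mulrC c). Qed.

Lemma fro_brk_diag n (a : 'rV[R]_n) (C : 'M[R]_n) :
  fro (brk (diag_mx a) C) (brk (diag_mx a) C) =
  \sum_i \sum_j (a ord0 i - a ord0 j) ^+ 2 * C i j ^+ 2.
Proof.
apply: eq_bigr => i _; apply: eq_bigr => j _.
by rewrite /brk mul_diag_mx mul_mx_diag !mxE; ring.
Qed.

Section Rotate.
Variables (n m : nat) (Q : 'M[R]_m) (B : 'I_m -> 'M[R]_n).
Hypothesis oQ : orthogonal Q.
Definition rotate al := \sum_de Q al de *: B de.

Lemma fro_rotate al be :
  fro (rotate al) (rotate be) = (Q *m (\matrix_(d, e) fro (B d) (B e)) *m Q^T) al be.
Proof.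
rewrite /rotate fro_suml -mulmxA mxE; apply: eq_bigr => d _; rewrite froZl; congr (_ * _).
rewrite fro_sumr mxE; apply: eq_bigr => e _.
by rewrite froZr !mxE mulrC.
Qed.

Lemma brk_rotate al be i j :
  brk (rotate al) (rotate be) i j = (Q *m (\matrix_(d, e) brk (B d) (B e) i j) *m Q^T) al be.
Proof.
have -> : brk (rotate al) (rotate be) =
    \sum_d \sum_e (Q al d * Q be e) *: brk (B d) (B e).
  rewrite /brk /rotate mulmx_suml mulmx_sumr -sumrB; apply: eq_bigr => d _.
  rewrite mulmx_sumr mulmx_suml -sumrB; apply: eq_bigr => e _.
  exact: brkZ.
rewrite summxE -mulmxA mxE; apply: eq_bigr => d _; rewrite summxE mxE mulr_sumr.
by apply: eq_bigr => e _; rewrite !mxE; ring.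
Qed.

Lemma sum_fro_rotate :
  \sum_al fro (rotate al) (rotate al) = \sum_al fro (B al) (B al).
Proof.
transitivity (\tr (Q *m (\matrix_(d, e) fro (B d) (B e)) *m Q^T)).
  by apply: eq_bigr => al _; exact: fro_rotate.
rewrite mxtrace_mulC mulmxA (orthogonalT oQ) mul1mx.
by apply: eq_bigr => al _; rewrite mxE.
Qed.

(** For fixed matrix indices i, j, the entries of all commutators form an m by m matrix that Q
    conjugates, and conjugation preserves the Frobenius norm. *)
Lemma sum_brk_rotate :
  \sum_al \sum_be fro (brk (rotate al) (rotate be)) (brk (rotate al) (rotate be)) =
  \sum_al \sum_be fro (brk (B al) (B be)) (brk (B al) (B be)).
Proof.
have swap (F : 'I_m -> 'I_m -> 'I_n -> 'I_n -> R) :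
    \sum_a \sum_b \sum_i \sum_j F a b i j = \sum_i \sum_j \sum_a \sum_b F a b i j.
  transitivity (\sum_a \sum_i \sum_j \sum_b F a b i j).
    apply: eq_bigr => a _; rewrite exchange_big; apply: eq_bigr => i _.
    by rewrite exchange_big.
  rewrite exchange_big; apply: eq_bigr => i _; by rewrite exchange_big.
rewrite /fro !swap; apply: eq_bigr => i _; apply: eq_bigr => j _.
have := fro_conj (\matrix_(d, e) brk (B d) (B e) i j) (\matrix_(d, e) brk (B d) (B e) i j) oQ.
rewrite /fro => e.
transitivity (\sum_a \sum_b (Q *m (\matrix_(d, e) brk (B d) (B e) i j) *m Q^T) a b *
   (Q *m (\matrix_(d, e) brk (B d) (B e) i j) *m Q^T) a b).
  by apply: eq_bigr => a _; apply: eq_bigr => b _; rewrite brk_rotate.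
by rewrite e; apply: eq_bigr => a _; apply: eq_bigr => b _; rewrite !mxE.
Qed.

End Rotate.

Section RowBound.
Variables (n m : nat) (A : 'M[R]_n) (C : 'I_m -> 'M[R]_n) (S : pred 'I_m).
Hypothesis AT : A^T = A.
Hypothesis A1 : fro A A = 1.
Hypothesis CT : forall be, (C be)^T = C be.
Hypothesis C1 : forall be ga, S be -> S ga -> fro (C be) (C ga) = (be == ga)%:R.

(** In an eigenbasis of A the sum becomes that of the star estimate. The subset S is free because
    the bound is used for the partners with commutator above 1, but the equality case for all
    partners. *)
Lemma brk_row_bound :
  \sum_(be | S be) (fro (brk A (C be)) (brk A (C be)) - 1) <= 1 /\
  (\sum_(be | S be) (fro (brk A (C be)) (brk A (C be)) - 1) = 1 ->
   exists (O : 'M[R]_n) (a : 'rV[R]_n) (i0 : 'I_n),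
    let q j := 2 * \sum_(be | S be) (O *m C be *m O^T) i0 j ^+ 2 in
    [/\ orthogonal O, O *m A *m O^T = diag_mx a,
      forall be i j, S be -> (i == i0) = (j == i0) -> (O *m C be *m O^T) i j = 0,
      0 < \sum_(j | j != i0) q j /\ a ord0 i0 != 0 &
      forall j, j != i0 ->
        (q j = 1 /\ (\sum_(j | j != i0) q j) * a ord0 j = - a ord0 i0) \/
        (q j = 0 /\ a ord0 j = 0)]).
Proof.
have [ O [a [oO OA]]] := spectral_theorem AT.
pose D be := O *m C be *m O^T.
have DT (be : 'I_m) i j : D be i j = D be j i.
  by rewrite -[in LHS](trmxK (D be)) mxE /D !trmx_mul trmxK CT mulmxA.
have D1 (be ga : 'I_m) : S be -> S ga -> fro (D be) (D ga) = (be == ga)%:R.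
  by move=> Sb Sg; rewrite fro_conj// C1.
pose q i j := \sum_(be | S be) D be i j ^+ 2.
have q0 i j : 0 <= q i j by apply: sumr_ge0 => be _; exact: sqr_ge0.
have qC i j : q i j = q j i by apply: eq_bigr => be _; rewrite DT.
(* Bessel: q i j is the squared norm of the projection M of E_ij, and M i j = M j i *)
have qh i j : i != j -> q i j <= 1 / 2.
  move=> ij; pose M := \sum_(be | S be) D be i j *: D be.
  have M2 : fro M M = q i j.
    rewrite /M fro_suml; apply: eq_bigr => be Sb; rewrite froZl fro_sumr expr2; congr (_ * _).
    rewrite (bigD1 be)//= froZr D1// eqxx mulr1 big1 ?addr0// => ga /andP[Sg gb].
    by rewrite froZr D1// eq_sym (negPf gb) mulr0.
  have Mij : M i j = q i j.
    by rewrite /M summxE; apply: eq_bigr => be _; rewrite mxE expr2.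
  have Mji : M j i = q i j.
    by rewrite /M summxE; apply: eq_bigr => be _; rewrite mxE DT expr2.
  have : q i j * q i j + q i j * q i j <= fro M M.
    rewrite -{1 2}Mij -Mji /fro (bigD1 i)//= (bigD1 j)//= [X in _ <= _ + _ + X](bigD1 j) /=; last by rewrite eq_sym.
    rewrite [X in _ <= _ + _ + (X + _)](bigD1 i)//=.
    have s0 (P : pred 'I_n) (k : 'I_n) : 0 <= \sum_(l | P l) M k l * M k l.
      by apply: sumr_ge0 => l _; rewrite -expr2 sqr_ge0.
    have s1 : 0 <= \sum_(k | (k != i) && (k != j)) \sum_l M k l * M k l.
      by apply: sumr_ge0 => k _; exact: s0.
    by have := s0 (fun l => l != j) i; have := s0 (fun l => l != i) j; lra.
  by rewrite M2; have := q0 i j; nra.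
have a1 : \sum_i a ord0 i ^+ 2 = 1.
  have := fro_conj A A oO; rewrite OA A1 => <-.
  apply: eq_bigr => i _; rewrite (bigD1 i)//= !mxE eqxx mulr1n -expr2 big1 ?addr0// => j ji.
  by rewrite !mxE eq_sym (negPf ji) mulr0n mul0r.
have sE : \sum_(be | S be) (fro (brk A (C be)) (brk A (C be)) - 1) =
    \sum_i \sum_j ((a ord0 i - a ord0 j) ^+ 2 - 1) * q i j.
  transitivity (\sum_(be | S be) \sum_i \sum_j ((a ord0 i - a ord0 j) ^+ 2 - 1) * D be i j ^+ 2).
    apply: eq_bigr => be Sb.
    rewrite -(fro_conj _ _ oO) -brk_conj// OA fro_brk_diag -/(D be).
    have f1 : fro (D be) (D be) = 1 by rewrite D1// eqxx.
    rewrite -[X in _ - X = _]f1.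
    rewrite /fro -sumrB; apply: eq_bigr => i _; rewrite -sumrB; apply: eq_bigr => j _; ring.
  rewrite exchange_big; apply: eq_bigr => i _; rewrite exchange_big; apply: eq_bigr => j _.
  by rewrite /q mulr_sumr.
have [i0 ci0] := star_center a1.
have b := star_le a1 q0 qC qh ci0; have e := star_eq a1 q0 qC qh ci0.
rewrite sE; split=> // /e[e1 e2 e3 e4].
exists O, a, i0; split=> // be i j Sb ij.
have : q i j = 0 by exact: e1.
move=> /psumr_eq0P h; have /eqP := h (fun _ _ => sqr_ge0 _) be Sb.
by rewrite sqrf_eq0 => /eqP.
Qed.

End RowBound.

End Frobenius.

(** * Combining the row bounds *)

Section Combine.
Variables (R : realFieldType) (m : nat) (x : 'I_m -> R) (c : 'I_m -> 'I_m -> R).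
Hypothesis x0 : forall al, 0 <= x al.
Hypothesis cC : forall al be, c al be = c be al.
Hypothesis c0 : forall al, c al al = 0.
Hypothesis cN : forall al be, x be = 0 -> c al be = 0.
Hypothesis row : forall al (S : pred 'I_m), 0 < x al ->
  (forall be, S be -> 0 < x be) -> \sum_(be | S be) (c al be - 1) <= 1.

(** Here x al is the squared norm of the al-th matrix and c the squared norms of the normalised
    commutators. The product x_al x_be is half of x_al^2 + x_be^2 - (x_al - x_be)^2; where c exceeds
    1 the squares are absorbed by the row bound. *)
Lemma row_combine :
  (\sum_al x al) ^+ 2 = \sum_al \sum_be x al * x be * c al be ->
  forall al, 0 < x al ->
  \sum_(be | (0 < x be) && (be != al)) (c al be - 1) = 1 /\
  forall be, be != al -> 0 < x be -> 1 < c al be -> x be = x al.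
Proof.
move=> eqx.
(* The positive and negative parts of c - 1; only the positive one is harmful. *)
pose d al be := Num.max (c al be - 1) 0; pose e al be := Num.max (1 - c al be) 0.
have d0 al be : 0 <= d al be by rewrite le_max lexx orbT.
have e0 al be : 0 <= e al be by rewrite le_max lexx orbT.
have dC al be : d al be = d be al by rewrite /d cC.
have cde al be : 1 - c al be = e al be - d al be.
  by rewrite /e /d /Num.max; do 2 case: ifPn; rewrite -?leNgt => ? ?; lra.
pose Dl al := \sum_be d al be.
have Dl1 al : 0 < x al -> Dl al <= 1.
  move=> xa; rewrite /Dl (bigID (fun be => 1 < c al be))/= [X in _ + X]big1 ?addr0; last first.
    by move=> be h; apply/max_idPr; move: h; rewrite -leNgt; lra.
  rewrite (eq_bigr (fun be => c al be - 1)); last by move=> be h; apply/max_idPl; lra.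
  apply: row => // be h; rewrite lt_neqAle x0 andbT eq_sym; apply/eqP => /(cN al) e1.
  by move: h; rewrite e1 ltr10.
(* The diagonal of e is 1, which provides the sum of x_al^2 in the first term. *)
have id : 0 = \sum_al x al ^+ 2 * (1 - Dl al) +
    \sum_al \sum_(be | be != al) (x al * x be * e al be) +
    2^-1 * \sum_al \sum_be (x al - x be) ^+ 2 * d al be.
  have e1 : \sum_al x al ^+ 2 * Dl al = \sum_al \sum_be x al ^+ 2 * d al be.
    by apply: eq_bigr => al _; rewrite mulr_sumr.
  have e2 : \sum_al x al ^+ 2 * Dl al = \sum_al \sum_be x be ^+ 2 * d al be.
    rewrite e1 exchange_big; apply: eq_bigr => al _; apply: eq_bigr => be _.
    by rewrite dC.
  have e3 : \sum_al \sum_be (x al - x be) ^+ 2 * d al be =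
      \sum_al \sum_be x al ^+ 2 * d al be + \sum_al \sum_be x be ^+ 2 * d al be
      - 2 * \sum_al \sum_be x al * x be * d al be.
    rewrite mulr_sumr -big_split -sumrB; apply: eq_bigr => al _ /=.
    rewrite mulr_sumr -big_split -sumrB; apply: eq_bigr => be _ /=; ring.
  have e4 : \sum_al \sum_(be | be != al) (x al * x be * e al be) =
      \sum_al \sum_be x al * x be * e al be - \sum_al x al ^+ 2.
    rewrite -sumrB; apply: eq_bigr => al _; rewrite [in RHS](bigD1 al)//=.
    have -> : e al al = 1 by rewrite /e c0 subr0; apply/max_idPl/ler01.
    by rewrite mulr1 expr2 addrAC subrr add0r.
  have e5 : \sum_al x al ^+ 2 * (1 - Dl al) = \sum_al x al ^+ 2 - \sum_al x al ^+ 2 * Dl al.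
    by rewrite -sumrB; apply: eq_bigr => al _; ring.
  have e6 : (\sum_al x al) ^+ 2 - \sum_al \sum_be x al * x be * c al be =
      \sum_al \sum_be x al * x be * e al be - \sum_al \sum_be x al * x be * d al be.
    rewrite expr2 mulr_suml -!sumrB; apply: eq_bigr => al _; rewrite mulr_sumr -!sumrB.
    by apply: eq_bigr => be _; rewrite -mulrBr -cde; ring.
  rewrite e5 e4 e3 -e1 -e2; move: e6; rewrite eqx subrr.
  by move: (\sum_al \sum_be x al * x be * e al be) => E; lra.
have s1 al : 0 <= x al ^+ 2 * (1 - Dl al).
  have := x0 al; rewrite le_eqVlt => /orP[/eqP <-|h]; first by rewrite expr0n mul0r.
  by rewrite mulr_ge0 ?sqr_ge0// subr_ge0 Dl1.
have s2' al be : 0 <= x al * x be * e al be by rewrite !mulr_ge0.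
have s2 al : 0 <= \sum_(be | be != al) (x al * x be * e al be) by apply: sumr_ge0.
have s3' al be : 0 <= (x al - x be) ^+ 2 * d al be by rewrite mulr_ge0// sqr_ge0.
have s3 al : 0 <= \sum_be (x al - x be) ^+ 2 * d al be by apply: sumr_ge0.
have t1 := sumr_ge0 (index_enum 'I_m) (fun al (_ : true) => s1 al).
have t2 := sumr_ge0 (index_enum 'I_m) (fun al (_ : true) => s2 al).
have t3 := sumr_ge0 (index_enum 'I_m) (fun al (_ : true) => s3 al).
have z1 : \sum_al x al ^+ 2 * (1 - Dl al) = 0 by lra.
have z2 : \sum_al \sum_(be | be != al) (x al * x be * e al be) = 0 by lra.
have z3 : \sum_al \sum_be (x al - x be) ^+ 2 * d al be = 0 by lra.
move=> al xa.
have y1 : Dl al = 1.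
  have /eqP := psumr_eq0P (fun i _ => s1 i) z1 (i := al) isT.
  rewrite mulf_eq0 expf_eq0 (gt_eqF xa) /= subr_eq0 => /eqP; exact: esym.
have y2 be : be != al -> 0 < x be -> e al be = 0.
  move=> ba xb; have h := psumr_eq0P (fun i _ => s2 i) z2 (i := al) isT.
  have /eqP := psumr_eq0P (fun i _ => s2' al i) h ba.
  by rewrite !mulf_eq0 (gt_eqF xa) (gt_eqF xb) => /eqP.
have y3 be : (x al - x be) ^+ 2 * d al be = 0.
  have h := psumr_eq0P (fun i _ => s3 i) z3 (i := al) isT.
  by have := psumr_eq0P (fun i _ => s3' al i) h (i := be) isT.
split.
  rewrite -[RHS]y1 /Dl [RHS](bigID (fun be => (0 < x be) && (be != al)))/= [X in _ = _ + X]big1 ?addr0.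
    apply: eq_bigr => be /andP[xb ba]; have := cde al be; rewrite (y2 be ba xb); lra.
  move=> be; rewrite negb_and negbK => /orP[h|/eqP ->]; last first.
    by rewrite /d c0; apply/max_idPr; lra.
  have xb : x be = 0 by apply/eqP; rewrite eq_le x0 leNgt h.
  by rewrite /d cN//; apply/max_idPr; lra.
move=> be ba xb cab; have /eqP := y3 be; rewrite mulf_eq0 => /orP[|/eqP].
  by rewrite sqrf_eq0 subr_eq0 => /eqP.
by rewrite /d => h; have : c al be - 1 <= 0; [rewrite -h le_max lexx | lra].
Qed.

End Combine.

(** * Equality in the DDVV inequality *)

Section DDVV.
Variables (R : realType) (n m : nat).

(** D connects only i0 with other indices, a bipartite pattern, and a bipartite graph has no closed
    walk of length 3. *)
Lemma tr_cross (D : 'M[R]_n) i0 :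
  (forall i j, (i == i0) = (j == i0) -> D i j = 0) -> \tr (D *m D *m D) = 0.
Proof.
move=> h; rewrite /mxtrace big1// => i _; rewrite mxE big1// => j _.
rewrite mxE mulr_suml big1// => k _.
have [e|e] := eqVneq (i == i0) (k == i0); first by rewrite (h _ _ e) !mul0r.
have [e'|e'] := eqVneq (k == i0) (j == i0); first by rewrite (h _ _ e') mulr0 mul0r.
rewrite (h j i) ?mulr0//.
by move: e e'; do 3 case: (_ == i0).
Qed.

Lemma tr_conj3 (Q D : 'M[R]_n) : orthogonal Q ->
  \tr ((Q *m D *m Q^T) *m (Q *m D *m Q^T) *m (Q *m D *m Q^T)) = \tr (D *m D *m D).
Proof.
move=> oQ; rewrite !mulmxA -!(mulmxA _ Q^T Q) !(orthogonalT oQ) !mulmx1.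
by rewrite -!mulmxA mxtrace_mulC !mulmxA -!(mulmxA _ Q^T Q) !(orthogonalT oQ) !mulmx1.
Qed.

Lemma tr_diag3 (a : 'rV[R]_n) :
  \tr (diag_mx a *m diag_mx a *m diag_mx a) = \sum_i a ord0 i ^+ 3.
Proof.
apply: eq_bigr => i _.
by rewrite !mul_mx_diag !mxE eqxx mulr1n; ring.
Qed.

(** N leaves with the value - a0 / N contribute - a0^3 / N^2 to the sum of cubes, so it vanishes
    only for N = 1. *)
Lemma star_trace (a : 'rV[R]_n) i0 (q : 'I_n -> R) :
  let N := \sum_(j | j != i0) q j in
  0 < N -> a ord0 i0 != 0 ->
  (forall j, j != i0 -> (q j = 1 /\ N * a ord0 j = - a ord0 i0) \/ (q j = 0 /\ a ord0 j = 0)) ->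
  \sum_i a ord0 i ^+ 3 = 0 -> N = 1.
Proof.
move=> N N0 a0 h; rewrite (bigD1 i0)//= => s0.
have e : N ^+ 3 * \sum_(j | j != i0) a ord0 j ^+ 3 = - a ord0 i0 ^+ 3 * N.
  rewrite [in RHS]/N !mulr_sumr; apply: eq_bigr => j ji.
  have [[-> e]|[-> ->]] := h j ji; last by rewrite mulr0 expr0n mulr0.
  by rewrite -exprMn e; ring.
have : a ord0 i0 ^+ 3 * N * (N ^+ 2 - 1) = 0.
  transitivity (N ^+ 3 * (a ord0 i0 ^+ 3 + \sum_(j | j != i0) a ord0 j ^+ 3) -
      (N ^+ 3 * \sum_(j | j != i0) a ord0 j ^+ 3 + a ord0 i0 ^+ 3 * N)); first by ring.
  by rewrite s0 e; ring.
move/eqP; rewrite mulf_eq0 (negPf (mulf_neq0 (expf_neq0 3 a0) (lt0r_neq0 N0))) /= subr_eq0 sqrf_eq1.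
by move=> /orP[/eqP //|/eqP e1]; move: N0; rewrite e1; lra.
Qed.

Variable B : 'I_m -> 'M[R]_n.
Hypothesis BT : forall al, (B al)^T = B al.
Hypothesis Beq : (\sum_al fro (B al) (B al)) ^+ 2 =
  \sum_al \sum_be fro (brk (B al) (B be)) (brk (B al) (B be)).

(** Equality in every row gives each normalised matrix of the rotated family a partner. In the
    eigenbasis of its partner each has the cross pattern of [tr_cross]; its vanishing cubic trace
    reduces its own star to a single leaf, and that leaf has room for one partner only. *)
Theorem ddvv_equality : (forall al, B al = 0) \/
  exists (O : 'M[R]_n) (Q : 'M[R]_m) (mu nu : R) (al be : 'I_m) (i j : 'I_n),
  let B' ga := O *m (\sum_de Q ga de *: B de) *m O^T in
  [/\ orthogonal O, orthogonal Q, (mu != 0) && (nu ^+ 2 == mu ^+ 2), (al != be) && (i != j) &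
   [/\ B' al = mu *: (delta_mx i i - delta_mx j j), B' be = nu *: (delta_mx i j + delta_mx j i) &
       forall ga, ga != al -> ga != be -> B' ga = 0]].
Proof.
have GT : (\matrix_(d, e) fro (B d) (B e))^T = \matrix_(d, e) fro (B d) (B e).
  by apply/matrixP => d e; rewrite !mxE froC.
have [Q [x [oQ QG]]] := spectral_theorem GT.
pose B' := rotate Q B.
have fB al be : fro (B' al) (B' be) = (al == be)%:R * x ord0 al.
  by rewrite fro_rotate QG mxE mulr_natl.
have x0 al : 0 <= x ord0 al by have := fro_ge0 (B' al); rewrite fB eqxx mul1r.
have B'T al : (B' al)^T = B' al.
  by rewrite /B' /rotate linear_sum; apply: eq_bigr => d _; rewrite linearZ /= BT.
(* For x = 0 the inverse of zero is zero, so C al = 0 and [BC] and [cN] hold without exception. *)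
pose s al := (Num.sqrt (x ord0 al))^-1.
pose C al := s al *: B' al.
have CT al : (C al)^T = C al by rewrite /C linearZ /= B'T.
have BC al : B' al = Num.sqrt (x ord0 al) *: C al.
  have [xa|xa] := eqVneq (x ord0 al) 0.
    rewrite xa sqrtr0 scale0r; apply: fro_eq0; by rewrite fB xa mulr0.
  by rewrite /C /s scalerA mulfV ?scale1r// sqrtr_eq0 -ltNge lt_neqAle eq_sym xa x0.
have C1 al be : 0 < x ord0 al -> 0 < x ord0 be -> fro (C al) (C be) = (al == be)%:R.
  move=> xa xb; rewrite froZl froZr fB /s.
  have [<-|] := eqVneq al be; last by rewrite mul0r !mulr0.
  rewrite -{3}(sqr_sqrtr (x0 al)) /=; field.
  by rewrite gt_eqF// sqrtr_gt0.
have C1' al : 0 < x ord0 al -> fro (C al) (C al) = 1 by move=> xa; rewrite C1// eqxx.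
pose c al be := fro (brk (C al) (C be)) (brk (C al) (C be)).
have cE al be : fro (brk (B' al) (B' be)) (brk (B' al) (B' be)) = x ord0 al * x ord0 be * c al be.
  rewrite {1 2}(BC al) {1 2}(BC be) brkZ froZl froZr -/(c al be).
  by rewrite -[in RHS](sqr_sqrtr (x0 al)) -[in RHS](sqr_sqrtr (x0 be)); ring.
have cC al be : c al be = c be al.
  by rewrite /c /brk -opprB -scaleN1r froZl froZr !mulN1r opprK.
have c0 al : c al al = 0.
  by rewrite /c /brk subrr /fro big1// => i _; rewrite big1// => j _; rewrite mxE mul0r.
have cN al be : x ord0 be = 0 -> c al be = 0.
  move=> xb; have Cb : C be = 0 by rewrite /C /s xb sqrtr0 invr0 scale0r.
  by rewrite /c /brk Cb mulmx0 mul0mx subrr /fro big1// => i _; rewrite big1// => j _; rewrite mxE mul0r.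
have rowb al (S : pred 'I_m) : 0 < x ord0 al -> (forall be, S be -> 0 < x ord0 be) ->
    \sum_(be | S be) (c al be - 1) <= 1.
  move=> xa xS; have [+ _] := @brk_row_bound R n m (C al) C S (CT al) (C1' al xa) CT
    (fun be ga Sb Sg => C1 be ga (xS be Sb) (xS ga Sg)).
  by [].
have eqx : (\sum_al x ord0 al) ^+ 2 = \sum_al \sum_be x ord0 al * x ord0 be * c al be.
  transitivity ((\sum_al fro (B al) (B al)) ^+ 2).
    rewrite -(sum_fro_rotate B oQ); congr (_ ^+ 2); apply: eq_bigr => al _.
    by rewrite fB eqxx mul1r.
  rewrite Beq -(sum_brk_rotate B oQ); apply: eq_bigr => al _; apply: eq_bigr => be _.
  exact: cE.
have comb := row_combine x0 cC c0 cN rowb eqx.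
have star al (xa : 0 < x ord0 al) := (@brk_row_bound R n m (C al) C
    (fun be => (0 < x ord0 be) && (be != al)) (CT al)
    (C1' al xa) CT
    (fun be ga Sb Sg => C1 be ga (proj1 (andP Sb)) (proj1 (andP Sg)))).2 (comb al xa).1.
have [al xa|nx] := pickP (fun al => 0 < x ord0 al); last first.
  left; have B'0 al : B' al = 0.
    by apply: fro_eq0; rewrite fB; apply/eqP; rewrite mulf_eq0; apply/orP; right; rewrite eq_le x0 andbT leNgt nx.
  have : \sum_al fro (B al) (B al) = 0.
    rewrite -(sum_fro_rotate B oQ) big1// => al _.
    by rewrite -/B' B'0 /fro big1// => i _; rewrite big1// => j _; rewrite mxE mul0r.
  by move=> /(psumr_eq0P (fun i _ => fro_ge0 _)) h al; apply: fro_eq0; exact: h.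
right.
have [S1 S2] := comb al xa.
have tr0 ga be : 0 < x ord0 ga -> 0 < x ord0 be -> ga != be -> \tr (C ga *m C ga *m C ga) = 0.
  move=> xg xb gb; have [ O [a [i0 [oO _ h _ _]]]] := star be xb.
  rewrite -(tr_conj3 _ oO); apply: (@tr_cross _ i0) => i j ij; apply: h => //.
  by rewrite xg gb.
have [be0 /andP[xb0 ba0]|nb] := pickP (fun be => (0 < x ord0 be) && (be != al)); last first.
  by move: S1; rewrite big_pred0// => /eqP; rewrite eq_sym oner_eq0.
have [ O [a [i0 [oO OA cr [N0' a0] cs']]]] := star al xa.
pose q j := 2 * \sum_(be | (0 < x ord0 be) && (be != al)) (O *m C be *m O^T) i0 j ^+ 2.
have N0 : 0 < \sum_(j | j != i0) q j := N0'.
have cs j : j != i0 -> (q j = 1 /\ (\sum_(j | j != i0) q j) * a ord0 j = - a ord0 i0) \/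
  (q j = 0 /\ a ord0 j = 0) := cs' j.
have N1 : \sum_(j | j != i0) q j = 1.
  apply: (star_trace N0 a0 cs).
  rewrite -tr_diag3 -OA tr_conj3//; apply: (tr0 al be0) => //; by rewrite eq_sym.
rewrite N1 in cs.
have q0 j : 0 <= q j by rewrite mulr_ge0// sumr_ge0// => ? _; exact: sqr_ge0.
have [j0 /andP[ji0 qj0]|nj] := pickP (fun j => (j != i0) && (q j != 0)); last first.
  move: N1; rewrite big1 => [/eqP|j ji]; first by rewrite eq_sym oner_eq0.
  by have := nj j; rewrite ji /= => /negbFE/eqP.
have qj1 : q j0 = 1 by have [[]|[e _]] := cs j0 ji0 => //; move: qj0; rewrite e eqxx.
have qo j : j != i0 -> j != j0 -> q j = 0.
  move=> ji jj; move: N1; rewrite (bigD1 j0)//= qj1 => e.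
  have : \sum_(i | (i != i0) && (i != j0)) q i = 0 by lra.
  by move=> /psumr_eq0P; apply=> //; rewrite ji jj.
have aj0 : a ord0 j0 = - a ord0 i0.
  have [[_]|[e _]] := cs j0 ji0; first by rewrite mul1r.
  by move: qj0; rewrite e eqxx.
have ao j : j != i0 -> j != j0 -> a ord0 j = 0.
  by move=> ji jj; have [[e _]|[_ //]] := cs j ji; move: (qo j ji jj); rewrite e => /eqP; rewrite oner_eq0.
have aE : diag_mx a = a ord0 i0 *: (delta_mx i0 i0 - delta_mx j0 j0).
  apply/matrixP => i j; rewrite !mxE.
  have [->|ii] := eqVneq i i0.
    by rewrite (eq_sym i0 j0) (negPf ji0) /= subr0 (eq_sym j i0); case: (_ == _); rewrite ?mulr1 ?mulr0.
  have [->|ij] := eqVneq i j0.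
    rewrite /= sub0r (eq_sym j j0) aj0; case: (_ == _); by rewrite ?mulrN1 ?mulr1n ?oppr0 ?mulr0.
  by rewrite /= subr0 mulr0 ao// mul0rn.
pose D be := O *m C be *m O^T.
have DT be : (D be)^T = D be by rewrite /D !trmx_mul trmxK CT mulmxA.
have DE be : 0 < x ord0 be -> be != al -> D be = D be i0 j0 *: (delta_mx i0 j0 + delta_mx j0 i0).
  move=> xb ba; have Sb : (0 < x ord0 be) && (be != al) by rewrite xb ba.
  have Di j : j != j0 -> D be i0 j = 0.
    move=> jj; have [->|ji] := eqVneq j i0; first by rewrite /D cr.
    have /eqP := qo j ji jj; rewrite /q mulf_eq0 pnatr_eq0 /= => /eqP.
    by move=> /(psumr_eq0P (fun k _ => sqr_ge0 _))/(_ be Sb)/eqP; rewrite sqrf_eq0 => /eqP.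
  apply/matrixP => i j.
  rewrite [RHS]mxE [X in _ * X]mxE [X in _ * (X + _)]mxE [X in _ * (_ + X)]mxE.
  have [->|ii] := eqVneq i i0.
    rewrite (eq_sym i0 j0) (negPf ji0) /= addr0.
    by have [->|/Di ->] := eqVneq j j0; rewrite ?mulr1 ?mulr0.
  have [->|ji] := eqVneq j i0.
    have -> : D be i i0 = D be i0 i by rewrite -[in LHS]DT [LHS]mxE.
    rewrite (eq_sym i0 j0) (negPf ji0) andbF add0r andbT.
    by have [->|/Di ->] := eqVneq i j0; rewrite ?mulr1 ?mulr0.
  by rewrite /D cr ?(negPf ii) ?(negPf ji)// andbF addr0 mulr0.
have D1 be : 0 < x ord0 be -> be != al -> 2 * D be i0 j0 ^+ 2 = 1.
  move=> xb ba; rewrite -[RHS](C1' be xb) -(fro_conj _ _ oO) -/(D be).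
  rewrite [in RHS](DE be xb ba) froZl froZr.
  have -> : fro (delta_mx i0 j0 + delta_mx j0 i0) (delta_mx i0 j0 + delta_mx j0 i0) = 2 :> R.
    by rewrite froDl !fro_delta !mxE !eqxx (negPf ji0) (eq_sym i0 j0) (negPf ji0) /=; ring.
  by move: (D be i0 j0) => t; ring.
(* Each partner contributes exactly 1 to q j0 = 1. *)
have only be : 0 < x ord0 be -> be != al -> be = be0.
  move=> xb ba; apply/eqP/negP => /negP bb; move: qj1; rewrite /q (bigD1 be0) ?xb0//= (bigD1 be) ?xb ?ba//=.
  have := D1 be xb ba; have := D1 be0 xb0 ba0; rewrite /D.
  have : 0 <= \sum_(k | (0 < x ord0 k) && (k != al) && (k != be0) && (k != be)) (O *m C k *m O^T) i0 j0 ^+ 2.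
    by apply: sumr_ge0 => k _; exact: sqr_ge0.
  lra.
(* With a single partner the row sum reads c - 1 = 1, so c = 2 > 1 and the equality case of
   [row_combine] makes the norms equal. *)
have xx : x ord0 be0 = x ord0 al.
  apply: S2 => //; move: S1; rewrite (bigD1 be0) ?xb0//= big1; first by rewrite addr0; lra.
  by move=> k /andP[/andP[xk ka] kb]; move: kb; rewrite (only k xk ka) eqxx.
have a2 : 2 * a ord0 i0 ^+ 2 = 1.
  rewrite -[RHS](C1' al xa) -(fro_conj _ _ oO) OA.
  rewrite fro_tr tr_diag_mx mulmx_diag /mxtrace (bigD1 i0)//= (bigD1 j0)//= big1.
    by rewrite !mxE !eqxx aj0 /=; ring.
  by move=> i /andP[ii ij]; rewrite !mxE eqxx ao// mul0r.
exists O, Q, (Num.sqrt (x ord0 al) * a ord0 i0), (Num.sqrt (x ord0 al) * D be0 i0 j0), al, be0, i0, j0.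
have OB ga : O *m B' ga *m O^T = Num.sqrt (x ord0 ga) *: D ga by rewrite BC -scalemxAr -scalemxAl.
rewrite /=; split=> //.
- apply/andP; split; first by rewrite mulf_neq0// gt_eqF// sqrtr_gt0.
  rewrite !exprMn; apply/eqP; congr (_ * _).
  by have := D1 _ xb0 ba0; lra.
- by rewrite eq_sym ba0 eq_sym ji0.
split.
- by rewrite OB /D OA aE scalerA.
- by rewrite OB [in LHS](DE _ xb0 ba0) xx scalerA.
move=> ga ga_al ga_be; rewrite OB; have : ~~ (0 < x ord0 ga).
  by apply/negP => xg; move: ga_be; rewrite (only ga xg ga_al) eqxx.
by rewrite -leNgt => /ler0_sqrtr ->; rewrite scale0r.
Qed.

End DDVV.

(** * Curvature normal form *)

Section Frames.
Variable R : realType.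

Lemma bform_congr m n (A : 'M[R]_n) (B : 'M[R]_(m, n)) u v :
  bform A (u *m B) (v *m B) = bform (B *m A *m B^T) u v.
Proof. by rewrite /bform trmx_mul !mulmxA. Qed.

Lemma posdef_frame n (g : 'M[R]_n) : posdef g -> exists P : 'M[R]_n, P *m g *m P^T = 1%:M.
Proof.
move=> [gT gp]; have [Q [d [oQ Qd]]] := spectral_theorem gT.
have d0 i : 0 < d ord0 i.
  have -> : d ord0 i = bform g (row i Q) (row i Q).
    by rewrite !rowE bform_mull bform_mulr Qd bform_delta mxE eqxx.
  apply: gp; apply/eqP => r0; have := oQ; move=> /(congr1 (fun M : 'M[R]_n => M i i)).
  rewrite !mxE eqxx big1 => [/eqP|j _]; first by rewrite eq_sym oner_eq0.
  by have := congr1 (fun r : 'rV[R]_n => r ord0 j) r0; rewrite !mxE => ->; rewrite mul0r.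
pose D : 'M[R]_n := diag_mx (\row_i (Num.sqrt (d ord0 i))^-1).
exists (D *m Q); rewrite trmx_mul !mulmxA -(mulmxA D) -(mulmxA D) Qd tr_diag_mx !mulmx_diag.
apply/matrixP => i j; rewrite !mxE.
have s0 : Num.sqrt (d ord0 i) != 0 by rewrite gt_eqF// sqrtr_gt0.
rewrite -[X in _ * X * _](sqr_sqrtr (ltW (d0 i))); congr (_ *+ _).
by field.
Qed.

Lemma frame_inv n (g P : 'M[R]_n) : P *m g *m P^T = 1%:M ->
  [/\ g *m P^T *m P = 1%:M, P^T *m P *m g = 1%:M & invmx g = P^T *m P].
Proof.
move=> e; have e1 : g *m P^T *m P = 1%:M by apply: mulmx1C; rewrite mulmxA.
have e2 : P^T *m P *m g = 1%:M by apply: mulmx1C; rewrite mulmxA.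
split=> //; have [gu _] := mulmx1_unit e2; have [_ gU] := mulmx1_unit e2.
by rewrite -[LHS]mul1mx -e2 -!mulmxA mulmxV// mulmx1.
Qed.

Lemma normal_complement n m (g : 'M[R]_(n + m)) (T : 'M[R]_(n, n + m)) :
  posdef g -> T *m g *m T^T = 1%:M ->
  exists X : 'M[R]_(m, n + m), X *m g *m T^T = 0 /\ X *m g *m X^T = 1%:M.
Proof.
move=> pg TT; pose A := g *m T^T.
have rA : \rank A = n.
  apply/eqP; rewrite eqn_leq rank_leq_col /=.
  have := mxrankM_maxr T A; rewrite /A mulmxA TT mxrank1; exact.
have rK : \rank (kermx A) = m by rewrite mxrank_ker rA addKn.
have [K [fK KA]] : exists K : 'M[R]_(m, n + m), row_free K /\ K *m A = 0.
  have h : row_base (kermx A) *m A = 0.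
    by apply/sub_kermxP; rewrite eq_row_base.
  by move: (row_base _) (row_base_free (kermx A)) h; rewrite rK => K; exists K.
have pK : posdef (K *m g *m K^T).
  case: pg => gT gp; split; first by rewrite !trmx_mul trmxK gT mulmxA.
  move=> v v0; rewrite -bform_congr; apply: gp; apply: contra v0.
  by rewrite mulmx_free_eq0.
have [P PP] := posdef_frame pK.
exists (P *m K); split; first by rewrite -!mulmxA -/A KA mulmx0.
by rewrite trmx_mul -PP !mulmxA.
Qed.

End Frames.

Lemma fresh_ord n (s : seq 'I_n) : (size s < n)%N -> exists k, k \notin s.
Proof.
move=> sn; have [k ks|h] := pickP (fun k => k \notin s); first by exists k.
have : (size (enum 'I_n) <= size s)%N.
  by apply: uniq_leq_size; [exact: enum_uniq | move=> k _; apply/negbNE/negbT/h].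
by rewrite size_enum_ord leqNgt sn.
Qed.

Lemma bformBm (R : realType) n (A B : 'M[R]_n) u v :
  bform (A - B) u v = bform A u v - bform B u v.
Proof. by rewrite bformDm bformNm. Qed.

Lemma bform0m (R : realType) n (u v : 'rV[R]_n) : bform 0 u v = 0.
Proof. by rewrite /bform mulmx0 mul0mx mxE. Qed.

Section NormalForm.
Variables (R : realType) (n m : nat) (G P : 'M[R]_n) (H : 'I_m -> 'M[R]_n) (k : R).
Local Notation V := 'rV[R]_n.
Local Notation g := (bform G).
Variable K : V -> V -> 'M[R]_n.
Hypothesis n4 : (4 <= n)%N.
Hypothesis GT : G^T = G.
Hypothesis PG : P *m G *m P^T = 1%:M.
Hypothesis HT : forall ga, (H ga)^T = H ga.
Hypothesis gaussK : forall u v w z, g (w *m K u v) z =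
  k * (g v w * g u z - g u w * g v z) +
  \sum_ga (bform (H ga) v w * bform (H ga) u z - bform (H ga) u w * bform (H ga) v z).

(** The rows of P are a G-orthonormal frame, so this is also the matrix of the shape operator in
    that frame. *)
Definition frame_mx ga := P *m H ga *m P^T.
Definition mean_coef ga := \tr (frame_mx ga) / n%:R.
Definition traceless ga := frame_mx ga - (mean_coef ga)%:M.

Hypothesis wintgen : (\sum_ga fro (traceless ga) (traceless ga)) ^+ 2 =
  \sum_ga \sum_de fro (brk (traceless ga) (traceless de)) (brk (traceless ga) (traceless de)).

Let tlT ga : (traceless ga)^T = traceless ga.
Proof. by rewrite /traceless /frame_mx linearB /= tr_scalar_mx !trmx_mul trmxK HT mulmxA. Qed.

Lemma bform_frame ga u v :
  bform (H ga) u v = bform (frame_mx ga) (u *m (G *m P^T)) (v *m (G *m P^T)).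
Proof.
rewrite bform_congr /frame_mx; congr (bform _ u v).
have [e1 e2 _] := frame_inv PG.
by rewrite trmx_mul trmxK GT !mulmxA e1 mul1mx -!mulmxA (mulmxA P^T) e2 mulmx1.
Qed.

Lemma bform_delta_mx p (i j : 'I_p) (u v : 'rV[R]_p) :
  bform (delta_mx i j) u v = u ord0 i * v ord0 j.
Proof.
rewrite bform_sumE (bigD1 i)//= (bigD1 j)//= !big1 => [|a /negPf ai|b /negPf bj].
- by rewrite mxE !eqxx mulr1 !addr0.
- by rewrite big1// => b _; rewrite mxE ai mulr0.
- by rewrite mxE bj andbF mulr0.
Qed.

Lemma orthogonal_sum (Q : 'M[R]_m) (x y : 'I_m -> R) : orthogonal Q ->
  \sum_ga (\sum_de Q ga de * x de) * (\sum_de Q ga de * y de) = \sum_ga x ga * y ga.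
Proof.
move=> oQ; have E (z : 'I_m -> R) ga : \sum_de Q ga de * z de = ((\row_de z de) *m Q^T) ord0 ga.
  by rewrite mxE; apply: eq_bigr => d _; rewrite !mxE mulrC.
transitivity (bform 1%:M ((\row_de x de) *m Q^T) ((\row_de y de) *m Q^T)).
  by rewrite bform1E; apply: eq_bigr => ga _; rewrite !E.
rewrite bform_congr trmxK mulmx1 (orthogonalT oQ) bform1E.
by apply: eq_bigr => ga _; rewrite !mxE.
Qed.

(* s = mu ^ 2, in the normal form mu (E_11 - E_22), +-mu (E_12 + E_21) of the traceless
   shape operators *)
Definition curvature_normal_form (e1 e2 : V) (c p q s : R) (u v w z : V) :=
  let b1 x := g x e1 in let b2 x := g x e2 in
  let D x y := p * (b1 x * b1 y - b2 x * b2 y) + q * (b1 x * b2 y + b2 x * b1 y) in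
  c * (g v w * g u z - g u w * g v z)
  + (g v w * D u z + D v w * g u z - g u w * D v z - D u w * g v z)
  + 2 * s * (b1 u * b2 v - b2 u * b1 v) * (b1 w * b2 z - b2 w * b1 z).

(** The sum in the Gauss equation is invariant under rotation of the normal frame. After rotation
    only the members al and be are not multiples of g: their traceless parts give p, q through the
    products with g, and s through the products with themselves. *)
Lemma umbilical_or_normal_form : (forall ga, H ga = mean_coef ga *: G) \/
  exists (e : nat -> V) (c p q s : R), s != 0 /\
    (forall a b, (a < 4)%N -> (b < 4)%N -> g (e a) (e b) = (a == b)%:R) /\
    forall u v w z, g (w *m K u v) z = curvature_normal_form (e 0%N) (e 1%N) c p q s u v w z.
Proof.
have [B0|] := ddvv_equality tlT wintgen.
  left=> ga; apply: bform_eq => u v; rewrite bform_frame bformZm.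
  have /eqP := B0 ga; rewrite subr_eq0 => /eqP ->.
  rewrite -scalemx1 bformZm bform_congr; congr (_ * bform _ u v).
  have [e1 _ _] := frame_inv PG.
  by rewrite mulmx1 trmx_mul trmxK GT !mulmxA e1 mul1mx.
move=> [ O [Q [mu [nu [al [be [i [j]]]]]]]] /=.
move=> [oO oQ /andP[mu0 /eqP munu] /andP[ab ij] [Ba Bb B0]].
right.
pose y (l : 'I_n) (u : V) := (u *m (G *m P^T) *m O^T) ord0 l.
have yE l u : y l u = g u (row l (O *m P)).
  by rewrite /y rowE bform_mulr bform_deltar trmx_mul !mulmxA.
pose l ga := \sum_de Q ga de * mean_coef de.
pose B' ga := O *m (\sum_de Q ga de *: traceless de) *m O^T.
have FE ga u v : \sum_de Q ga de * bform (H de) u v =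
    l ga * g u v + bform (B' ga) (u *m (G *m P^T) *m O^T) (v *m (G *m P^T) *m O^T).
  have -> : bform (B' ga) (u *m (G *m P^T) *m O^T) (v *m (G *m P^T) *m O^T) =
      bform (\sum_de Q ga de *: traceless de) (u *m (G *m P^T)) (v *m (G *m P^T)).
    rewrite bform_congr /B' trmxK !mulmxA (orthogonalT oO) mul1mx -mulmxA.
    by rewrite (orthogonalT oO) mulmx1.
  rewrite bform_summ /l mulr_suml -big_split /=; apply: eq_bigr => d _.
  rewrite bformZm bform_frame /traceless bformBm -mulrA -mulrDr; congr (_ * _).
  have -> : bform (mean_coef d)%:M (u *m (G *m P^T)) (v *m (G *m P^T)) = mean_coef d * g u v.
    rewrite -scalemx1 bformZm bform_congr; congr (_ * bform _ u v).
    have [e1 _ _] := frame_inv PG.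
    by rewrite mulmx1 trmx_mul trmxK GT !mulmxA e1 mul1mx.
  by rewrite addrC subrK.
(* Two further frame indices, for vectors orthogonal to the distinguished plane. *)
have [a3 a3n] := @fresh_ord n [:: i; j] (ltnW n4).
have [a4 a4n] := @fresh_ord n [:: i; j; a3] n4.
pose ix (a : nat) := nth i [:: i; j; a3; a4] a.
exists (fun a => row (ix a) (O *m P)), (k + \sum_ga l ga ^+ 2), (l al * mu), (l be * nu), (mu ^+ 2).
split; first by rewrite expf_neq0.
split.
  move=> a b a4' b4'; rewrite !rowE bform_congr.
  have : uniq [:: i; j; a3; a4].
    move: a3n a4n; rewrite /= !inE !negb_or => /andP[h1 h2] /and3P[h3 h4 h5].
    by rewrite ij (eq_sym i a3) h1 (eq_sym i a4) h3 (eq_sym j a3) h2 (eq_sym j a4) h4 (eq_sym a3) h5.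
  move=> us.
  have -> : O *m P *m G *m (O *m P)^T = 1%:M.
    by rewrite trmx_mul !mulmxA -(mulmxA O) -(mulmxA O) PG mulmx1.
  rewrite bform_delta mxE (nth_uniq i _ _ us)//.
move=> u v w z; rewrite gaussK.
pose F ga u v := \sum_de Q ga de * bform (H de) u v.
have -> : \sum_ga (bform (H ga) v w * bform (H ga) u z - bform (H ga) u w * bform (H ga) v z) =
    \sum_ga (F ga v w * F ga u z - F ga u w * F ga v z).
  by rewrite !sumrB /F !(orthogonal_sum _ _ oQ).
(* The deviation of one normal direction from its umbilical contribution; it vanishes except for al
   and be. *)
pose X ga := F ga v w * F ga u z - F ga u w * F ga v z - l ga ^+ 2 * (g v w * g u z - g u w * g v z).
have -> : \sum_ga (F ga v w * F ga u z - F ga u w * F ga v z) =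
    (\sum_ga l ga ^+ 2) * (g v w * g u z - g u w * g v z) + (X al + X be).
  rewrite mulr_suml -[LHS](subrK (\sum_ga l ga ^+ 2 * (g v w * g u z - g u w * g v z))) addrC -sumrB.
  congr (_ + _); rewrite (bigD1 al)//= (bigD1 be) 1?eq_sym//= big1 ?addr0// => ga /andP[ga1 ga2].
  by rewrite /F !FE /B' (B0 ga ga1 ga2) !bform0m; ring.
rewrite /X /F !FE /B' Ba Bb !(bformZm, bformBm, bformDm, bform_delta_mx) -!/(y _ _).
rewrite /curvature_normal_form -!yE.
have e : nu * nu = mu * mu by rewrite -!expr2.
move: (g v w) (g u z) (g u w) (g v z) (y i u) (y i v) (y i w) (y i z) (y j u) (y j v) (y j w) (y j z).
move=> x1 x2 x3 x4 x5 x6 x7 x8 x9 x10 x11 x12.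
transitivity (k * (x1 * x2 - x3 * x4) + ((\sum_ga l ga ^+ 2) * (x1 * x2 - x3 * x4) +
   (l al * mu * (x1 * (x5 * x8 - x9 * x12) + (x6 * x7 - x10 * x11) * x2 - x3 * (x6 * x8 - x10 * x12) - (x5 * x7 - x9 * x11) * x4)
   + mu * mu * ((x6 * x7 - x10 * x11) * (x5 * x8 - x9 * x12) - (x5 * x7 - x9 * x11) * (x6 * x8 - x10 * x12))
   + (l be * nu * (x1 * (x5 * x12 + x9 * x8) + (x6 * x11 + x10 * x7) * x2 - x3 * (x6 * x12 + x10 * x8) - (x5 * x11 + x9 * x7) * x4)
   + nu * nu * ((x6 * x11 + x10 * x7) * (x5 * x12 + x9 * x8) - (x5 * x11 + x9 * x7) * (x6 * x12 + x10 * x8)))))); first by ring.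
by rewrite e; ring.
Qed.

End NormalForm.

Section TraceLemmas.
Variables (R : realType) (n : nat) (g : 'M[R]_n).
Local Notation V := 'rV[R]_n.

Lemma mul_outer (u e f : V) : u *m (g *m (e^T *m f)) = bform g u e *: f.
Proof. by rewrite !mulmxA -mul_scalar_mx -mx11_scalar. Qed.

Lemma tr_outer (u v : V) : \tr (g *m (v^T *m u)) = bform g u v.
Proof. by rewrite mulmxA mxtrace_mulC mulmxA trace_mx11. Qed.

Lemma tr_lin1_mx (f : V -> V) (M : 'M[R]_n) : (forall z, f z = z *m M) -> \tr (lin1_mx f) = \tr M.
Proof.
move=> fM; congr (\tr _); apply/row_matrixP => i; rewrite rowE [in RHS]rowE -fM.
by apply/rowP => j; rewrite -rowE !mxE.
Qed.

End TraceLemmas.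

(** * Ricci and Weyl tensors of the normal form, and independence *)

Section Curv.
Variables (R : realType) (n : nat) (Gf : 'rV[R]_n -> 'M[R]_n) (x : 'rV[R]_n).
Local Notation V := 'rV[R]_n.
Local Notation G := (Gf x).
Local Notation g := (bform G).
Hypothesis n4 : (4 <= n)%N.
Hypothesis pG : posdef G.
Variables (e : nat -> V) (c p q s : R).
Hypothesis s0 : s != 0.
Hypothesis eE : forall a b, (a < 4)%N -> (b < 4)%N -> g (e a) (e b) = (a == b)%:R.
Hypothesis NF : forall u v w z,
  g (Rop Gf x u v w) z = curvature_normal_form G (e 0%N) (e 1%N) c p q s u v w z.

Let b1 u := g u (e 0%N).
Let b2 u := g u (e 1%N).
Let N : R := n%:R.
Let n1 : N - 1 != 0. Proof. by rewrite /N subr_eq0 pnatr_eq1; case: n n4 => [|[]]. Qed.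
Let n2 : N - 2 != 0. Proof. by rewrite /N subr_eq0 eqr_nat; case: n n4 => [|[|[]]]. Qed.
Let n3 : N - 3 != 0. Proof. by rewrite /N subr_eq0 eqr_nat; case: n n4 => [|[|[|[]]]]. Qed.

Let gC u v : g u v = g v u. Proof. by apply: bformC; case: pG. Qed.

Let Dv u : V := p *: (b1 u *: e 0%N - b2 u *: e 1%N) + q *: (b1 u *: e 1%N + b2 u *: e 0%N).
Let D u v := p * (b1 u * b1 v - b2 u * b2 v) + q * (b1 u * b2 v + b2 u * b1 v).
Let Dm : 'M[R]_n := p *: (G *m ((e 0%N)^T *m e 0%N) - G *m ((e 1%N)^T *m e 1%N))
  + q *: (G *m ((e 0%N)^T *m e 1%N) + G *m ((e 1%N)^T *m e 0%N)).

Let om u v := b1 u * b2 v - b2 u * b1 v.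

Let DmE : exists (A : 'M[R]_n) (dv : V -> V),
  [/\ forall u, dv u = Dv u, forall u, u *m A = dv u & \tr A = 0].
Proof.
exists Dm, Dv; split=> // [u|]; last first.
  have trZ a (A : 'M[R]_n) : \tr (a *: A) = a * \tr A by rewrite linearZ.
  have trN (A : 'M[R]_n) : \tr (- A) = - \tr A by rewrite linearN.
  by rewrite /Dm !(mxtraceD, trZ, trN) !tr_outer !eE //= subrr addr0 !mulr0 addr0.
by rewrite /Dm /Dv !(mulmxDr, mulmxBr) -!scalemxAr !(mulmxDr, mulmxBr) !mul_outer mulmxN mul_outer.
Qed.

Let gDv u v : g (Dv u) v = D u v.
Proof.
rewrite /Dv !(bformDl, bformBl, bformNl, bformZl) (gC (e 0%N) v) (gC (e 1%N) v).
rewrite -/(b1 v) -/(b2 v) /D; ring.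
Qed.

Lemma Rop_normal_form u v w : Rop Gf x u v w =
  c *: (g v w *: u - g u w *: v) + (g v w *: Dv u + D v w *: u - g u w *: Dv v - D u w *: v)
  + (2 * s * om u v) *: (b1 w *: e 1%N - b2 w *: e 0%N).
Proof.
apply: (bform_injl pG) => z; rewrite NF /curvature_normal_form.
rewrite !(bformDl, bformBl, bformNl, bformZl) (gC (e 0%N) z) (gC (e 1%N) z).
rewrite -!/(b1 _) -!/(b2 _) /D /om; ring.
Qed.

(** D is trace free, so its product with g has trace (N - 2) D; the term in s contributes only on
    the plane of e 0, e 1. *)
Lemma ricci_normal_form u v : ricci Gf x u v =
  c * (N - 1) * g u v + (N - 2) * D u v - 2 * s * (b1 u * b1 v + b2 u * b2 v).
Proof.
have [Am [dv [dvE mulA trA]]] := DmE.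
have [jv jE] : exists jv, jv = b1 v *: e 1%N - b2 v *: e 0%N by eexists.
pose M : 'M[R]_n := c *: ((g u v)%:M - G *m (v^T *m u))
  + ((g u v) *: Am + (D u v)%:M - G *m (v^T *m dv u)
     - (p *: (b1 v *: (G *m ((e 0%N)^T *m u)) - b2 v *: (G *m ((e 1%N)^T *m u)))
        + q *: (b2 v *: (G *m ((e 0%N)^T *m u)) + b1 v *: (G *m ((e 1%N)^T *m u)))))
  + (2 * s) *: (b2 u *: (G *m ((e 0%N)^T *m jv))
     - b1 u *: (G *m ((e 1%N)^T *m jv))).
rewrite /ricci (@tr_lin1_mx R n _ M); last first.
  move=> z; rewrite Rop_normal_form -!dvE -jE /M.
  rewrite !(mulmxDr, mulmxBr, mulmxN) -!scalemxAr !(mulmxDr, mulmxBr, mulmxN) -!scalemxAr.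
  rewrite !mul_outer !mul_mx_scalar mulA -!/(b1 _) -!/(b2 _) /D /om.
  clear M; move: jv jE (g u v) (g z v) (b1 u) (b2 u) (b1 v) (b2 v) (b1 z) (b2 z) (dv z) (dv u).
  move=> d3 _ a1 a2 a3 a4 a5 a6 a7 a8 d1 d2.
  by apply/rowP => i; rewrite !mxE; ring.
have eE00 : g (e 0%N) (e 0%N) = 1 by rewrite eE.
have eE01 : g (e 0%N) (e 1%N) = 0 by rewrite eE.
have eE10 : g (e 1%N) (e 0%N) = 0 by rewrite eE.
have eE11 : g (e 1%N) (e 1%N) = 1 by rewrite eE.
have trN (A : 'M[R]_n) : \tr (- A) = - \tr A by rewrite linearN.
have trZ a (A : 'M[R]_n) : \tr (a *: A) = a * \tr A by rewrite linearZ.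
rewrite /M !(mxtraceD, trN, trZ) !mxtrace_scalar !tr_outer trA dvE gDv jE.
rewrite !(bformBl, bformNl, bformZl) eE00 eE01 eE10 eE11 -!/(b1 _) -!/(b2 _) -mulr_natr -/N.
rewrite -[D u v *+ n]mulr_natr -/N /D; ring.
Qed.

Let Pi u : V := b1 u *: e 0%N + b2 u *: e 1%N.

Lemma ricci_mx_normal_form : (forall u, u *m ricci_mx Gf x =
  (c * (N - 1)) *: u + (N - 2) *: Dv u - (2 * s) *: Pi u) /\
  kappa Gf x = N * (N - 1) * c - 4 * s.
Proof.
have [Am [dv [dvE mulA trA]]] := DmE.
pose S0 : 'M[R]_n := (c * (N - 1))%:M + (N - 2) *: Am
  - (2 * s) *: (G *m ((e 0%N)^T *m e 0%N) + G *m ((e 1%N)^T *m e 1%N)).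
have mulS u : u *m S0 = (c * (N - 1)) *: u + (N - 2) *: dv u - (2 * s) *: Pi u.
  rewrite /S0 !(mulmxDr, mulmxN) -!scalemxAr mulmxDr !mul_outer mulA mul_mx_scalar.
  by [].
have RS : ricci_mx Gf x = S0.
  have -> : ricci_mx Gf x = S0 *m G *m invmx G; last by rewrite mulmxK// posdef_unit.
  congr (_ *m _); apply/matrixP => i j; rewrite mxE ricci_normal_form.
  rewrite -[RHS]bform_delta -bform_mull mulS dvE.
  rewrite !(bformDl, bformBl, bformNl, bformZl) (gC (e 0%N) (delta_mx _ _)) (gC (e 1%N) (delta_mx _ _)).
  by rewrite -!/(b1 _) -!/(b2 _) /D; ring.
split; first by move=> u; rewrite RS mulS dvE.
have trN (A : 'M[R]_n) : \tr (- A) = - \tr A by rewrite linearN.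
have trZ a (A : 'M[R]_n) : \tr (a *: A) = a * \tr A by rewrite linearZ.
rewrite /kappa RS /S0 !(mxtraceD, trN, trZ) mxtrace_scalar !tr_outer trA !eE//= -mulr_natr -/N.
by ring.
Qed.

Let t := 2 * s / (N - 2).
Let s1 := - (2 * t) / (N - 1).

(** The parts with c and D are products of g with a symmetric form, which the Weyl projection
    removes. Only the term in s and its trace corrections t and s1 remain. *)
Lemma Cop_normal_form u v w : Cop Gf x u v w =
  (2 * s * om u v) *: (b1 w *: e 1%N - b2 w *: e 0%N)
  + t *: (g v w *: Pi u + g (Pi v) w *: u - g u w *: Pi v - g (Pi u) w *: v)
  + s1 *: (g v w *: u - g u w *: v).
Proof.
have [rE kE] := ricci_mx_normal_form.
rewrite /Cop /wedge_op !rE kE Rop_normal_form -/N.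
have [dv dvE] : exists dv, forall u, dv u = Dv u by exists Dv.
have gdv u' v' : g (dv u') v' = D u' v' by rewrite dvE gDv.
have [pi piE] : exists pi, forall u, pi u = Pi u by exists Pi.
rewrite -!dvE -!piE !(bformDl, bformBl, bformNl, bformZl) !gdv.
have [d dE] : exists d, d = D v w by eexists.
have [d' dE'] : exists d, d = D u w by eexists.
rewrite -dE -dE'.
move: (g v w) (g u w) (g (pi v) w) (g (pi u) w) (dv u) (dv v) (pi u) (pi v) (om u v) (b1 w) (b2 w).
clear dE dE'; move=> a1 a2 a3 a4 d1 d2 d3 d4 a5 a6 a7.
by apply/rowP => i; rewrite !mxE /s1 /t; field; rewrite n1 n2.
Qed.

Let Pp u v := b1 u * b1 v + b2 u * b2 v.

Let CT u v w z : Ctensor Gf x u v w z =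
  2 * s * om u v * (b1 w * b2 z - b2 w * b1 z)
  + t * (g v w * Pp u z + Pp v w * g u z - g u w * Pp v z - Pp u w * g v z)
  + s1 * (g v w * g u z - g u w * g v z).
Proof.
have gP u' v' : g (Pi u') v' = Pp u' v'.
  by rewrite /Pi !(bformDl, bformZl) (gC (e 0%N) v') (gC (e 1%N) v').
have [pi piE] : exists pi, forall u, pi u = Pi u by exists Pi.
have gpi u' v' : g (pi u') v' = Pp u' v' by rewrite piE gP.
rewrite /Ctensor Cop_normal_form -!piE !(bformDl, bformBl, bformNl, bformZl) !gpi.
by rewrite (gC (e 0%N) z) (gC (e 1%N) z) -!/(b1 _) -!/(b2 _).
Qed.

Let RT u v w z : Rtensor Gf x u v w z =
  c * (g v w * g u z - g u w * g v z)
  + (g v w * D u z + D v w * g u z - g u w * D v z - D u w * g v z)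
  + 2 * s * om u v * (b1 w * b2 z - b2 w * b1 z).
Proof. exact: NF. Qed.

(** Values on coordinate planes, numbered from 1: k12 of R on e 0, e 1; w12 and w13 of C on e 0, e 1
    and on e 0, e 2. *)
Let k12 := c - 2 * s.
Let w12 := 2 * t + s1 - 2 * s.
Let w13 := t + s1.

Let ROP a b d : (a < 4)%N -> (b < 4)%N -> (d < 4)%N -> Rop Gf x (e a) (e b) (e d) =
  c *: ((b == d)%:R *: e a - (a == d)%:R *: e b)
  + ((b == d)%:R *: (p *: ((a == 0)%:R *: e 0%N - (a == 1)%:R *: e 1%N) + q *: ((a == 0)%:R *: e 1%N + (a == 1)%:R *: e 0%N)) + D (e b) (e d) *: e a - (a == d)%:R *: (p *: ((b == 0)%:R *: e 0%N - (b == 1)%:R *: e 1%N) + q *: ((b == 0)%:R *: e 1%N + (b == 1)%:R *: e 0%N)) - D (e a) (e d) *: e b)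
  + (2 * s * om (e a) (e b)) *: ((d == 0)%:R *: e 1%N - (d == 1)%:R *: e 0%N).
Proof. by move=> a4 b4 d4; rewrite Rop_normal_form /Dv /b1 /b2 !eE. Qed.

Let w13_neq0 : w13 != 0.
Proof.
have -> : w13 = 2 * s * (N - 3) / ((N - 1) * (N - 2)).
  by rewrite /w13 /s1 /t; field; rewrite n1 n2.
by rewrite !mulf_neq0 ?invr_neq0 ?mulf_neq0// pnatr_eq0.
Qed.

Let t_neq0 : t != 0.
Proof. by rewrite !mulf_neq0 ?invr_neq0// pnatr_eq0. Qed.

(** Components with last pair e 0, e 1 show p = q = 0 unless a = 0; components with last pair e 0, e
    2 then give two incompatible linear equations for a and b. *)
Theorem normal_form_independent : ~ lin_dep
    (fun x1 x2 x3 x4 u v =>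
       derivation (Rop Gf x) (Ctensor Gf x) x1 x2 x3 x4 u v
       - derivation (Cop Gf x) (Rtensor Gf x) x1 x2 x3 x4 u v)
    (Qtensor G (Ctensor Gf x)).
Proof.
move=> [a [b [ab H]]].
have R010 : Rop Gf x (e 0%N) (e 1%N) (e 0%N) = (- k12) *: e 1%N.
  by rewrite ROP// /D /om /b1 /b2 !eE//=; apply/rowP => i; rewrite !mxE /k12; ring.
have R011 : Rop Gf x (e 0%N) (e 1%N) (e 1%N) = k12 *: e 0%N.
  by rewrite ROP// /D /om /b1 /b2 !eE//=; apply/rowP => i; rewrite !mxE /k12; ring.
have R012 : Rop Gf x (e 0%N) (e 1%N) (e 2%N) = 0.
  by rewrite ROP// /D /om /b1 /b2 !eE//=; apply/rowP => i; rewrite !mxE /k12; ring.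
have C010 : Cop Gf x (e 0%N) (e 1%N) (e 0%N) = (- w12) *: e 1%N.
  rewrite Cop_normal_form /Pi /om /b1 /b2 !(bformDl, bformZl) !eE//=.
  by apply/rowP => i; rewrite !mxE /w12; ring.
have C011 : Cop Gf x (e 0%N) (e 1%N) (e 1%N) = w12 *: e 0%N.
  rewrite Cop_normal_form /Pi /om /b1 /b2 !(bformDl, bformZl) !eE//=.
  by apply/rowP => i; rewrite !mxE /w12; ring.
have C012 : Cop Gf x (e 0%N) (e 1%N) (e 2%N) = 0.
  rewrite Cop_normal_form /Pi /om /b1 /b2 !(bformDl, bformZl) !eE//=.
  by apply/rowP => i; rewrite !mxE /w12; ring.
(* C is invariant under rotation of the plane e 0, e 1, and both R(e 0, e 1) and the wedge of e 0, e
   1 act here as multiples of that rotation. Only C.R survives, and rotating D exposes p and q. *)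
have q0 : a * (w12 * q) = 0.
  have := H (e 0%N) (e 2%N) (e 2%N) (e 0%N) (e 0%N) (e 1%N).
  rewrite /Qtensor /derivation /wedge_op !eE//= !(scale1r, scale0r, subr0, sub0r, subrr).
  rewrite R010 R012 C010 C012 !CT !RT /D /Pp /om /b1 /b2.
  rewrite !(bformZl, bformZr, bform0l, bform0r, bformNl, bformNr) !eE//= => h.
  lra.
have p0 : a * (w12 * p) = 0.
  have := H (e 0%N) (e 2%N) (e 2%N) (e 1%N) (e 0%N) (e 1%N).
  rewrite /Qtensor /derivation /wedge_op !eE//= !(scale1r, scale0r, subr0, sub0r, subrr).
  rewrite R010 R011 R012 C010 C011 C012 !CT !RT /D /Pp /om /b1 /b2.
  rewrite !(bformZl, bformZr, bform0l, bform0r, bformNl, bformNr) !eE//= => h.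
  lra.
have w12_neq0 : w12 != 0.
  have -> : w12 = - (2 * s * (N - 3) / (N - 1)).
    by rewrite /w12 /s1 /t; field; rewrite n1 n2.
  by rewrite oppr_eq0 !mulf_neq0 ?invr_neq0// pnatr_eq0.
have C020 : Cop Gf x (e 0%N) (e 2%N) (e 0%N) = (- w13) *: e 2%N.
  rewrite Cop_normal_form /Pi /om /b1 /b2 !(bformDl, bformZl) !eE//=.
  by apply/rowP => i; rewrite !mxE /w13; ring.
have C021 : Cop Gf x (e 0%N) (e 2%N) (e 1%N) = 0.
  rewrite Cop_normal_form /Pi /om /b1 /b2 !(bformDl, bformZl) !eE//=.
  by apply/rowP => i; rewrite !mxE; ring.
have C022 : Cop Gf x (e 0%N) (e 2%N) (e 2%N) = w13 *: e 0%N.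
  rewrite Cop_normal_form /Pi /om /b1 /b2 !(bformDl, bformZl) !eE//=.
  by apply/rowP => i; rewrite !mxE /w13; ring.
have C023 : Cop Gf x (e 0%N) (e 2%N) (e 3%N) = 0.
  rewrite Cop_normal_form /Pi /om /b1 /b2 !(bformDl, bformZl) !eE//=.
  by apply/rowP => i; rewrite !mxE; ring.
(* This component of Q(g, C) is the difference of the values of C on the planes e 2, e 3 and e 0, e
   3, namely - t. *)
have [a0|a0] := eqVneq a 0.
  have := H (e 0%N) (e 3%N) (e 3%N) (e 2%N) (e 0%N) (e 2%N).
  rewrite a0 mul0r add0r /Qtensor /derivation /wedge_op.
  rewrite !eE//= !(scale1r, scale0r, subr0, sub0r, subrr) !CT /Pp /om /b1 /b2.
  rewrite !(bformZl, bformZr, bform0l, bform0r, bformNl, bformNr) !eE//= => h.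
  have /eqP : b * t = 0 by lra.
  by rewrite mulf_eq0 (negPf t_neq0) orbF => /eqP b0; apply: ab; rewrite a0 b0.
have qz : q = 0 by move/eqP: q0; rewrite !mulf_eq0 (negPf a0) (negPf w12_neq0) => /eqP.
have pz : p = 0 by move/eqP: p0; rewrite !mulf_eq0 (negPf a0) (negPf w12_neq0) => /eqP.
have R020 : Rop Gf x (e 0%N) (e 2%N) (e 0%N) = (- c) *: e 2%N.
  by rewrite ROP// /D /om /b1 /b2 !eE//= pz qz; apply/rowP => i; rewrite !mxE; ring.
have R021 : Rop Gf x (e 0%N) (e 2%N) (e 1%N) = 0.
  by rewrite ROP// /D /om /b1 /b2 !eE//= pz qz; apply/rowP => i; rewrite !mxE; ring.
have R022 : Rop Gf x (e 0%N) (e 2%N) (e 2%N) = c *: e 0%N.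
  by rewrite ROP// /D /om /b1 /b2 !eE//= pz qz; apply/rowP => i; rewrite !mxE; ring.
have R023 : Rop Gf x (e 0%N) (e 2%N) (e 3%N) = 0.
  by rewrite ROP// /D /om /b1 /b2 !eE//= pz qz; apply/rowP => i; rewrite !mxE; ring.
have h1 : a * (c * t) + b * t = 0.
  have := H (e 0%N) (e 3%N) (e 3%N) (e 2%N) (e 0%N) (e 2%N).
  rewrite /Qtensor /derivation /wedge_op !eE//= !(scale1r, scale0r, subr0, sub0r, subrr).
  rewrite R020 R022 R023 C020 C022 C023 !CT !RT /D /Pp /om /b1 /b2 pz qz.
  rewrite !(bformZl, bformZr, bform0l, bform0r, bformNl, bformNr) !eE//= => h.
  lra.
(* On the planes e 0, e 1 and e 1, e 2 the values c - 2 s and c of R differ, so C.R contributes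
   here, unlike in [h1]. *)
have h2 : a * (c * (2 * s - t) - 2 * s * w13) + b * (2 * s - t) = 0.
  have := H (e 0%N) (e 1%N) (e 1%N) (e 2%N) (e 0%N) (e 2%N).
  rewrite /Qtensor /derivation /wedge_op !eE//= !(scale1r, scale0r, subr0, sub0r, subrr).
  rewrite R020 R021 R022 C020 C021 C022 !CT !RT /D /Pp /om /b1 /b2 pz qz.
  rewrite !(bformZl, bformZr, bform0l, bform0r, bformNl, bformNr) !eE//= /w13 => h.
  lra.
have h3 : a * c + b = 0.
  by apply: (mulIf t_neq0); rewrite mul0r mulrDl -mulrA.
have : a * (2 * s * w13) = 0 by have := congr1 (fun z => z * (2 * s - t)) h3 => /=; lra.
move/eqP; rewrite !mulf_eq0 (negPf a0) (negPf s0) (negPf w13_neq0) pnatr_eq0.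
by [].
Qed.

End Curv.

(** * Submanifolds *)

Lemma linear_coord (R : realType) n (phi : 'rV[R]_n -> R) u :
  (forall a u v, phi (a *: u + v) = a * phi u + phi v) ->
  phi u = \sum_j u ord0 j * phi (delta_mx ord0 j).
Proof.
move=> L; have p0 : phi 0 = 0 by have := L (-1) 0 0; rewrite scaler0 addr0 mulN1r addNr.
rewrite {1}(row_sum_delta u); elim: (index_enum _) => [|j r IH]; first by rewrite !big_nil.
by rewrite !big_cons L IH.
Qed.

Section Immersion.
Variables (R : realType) (n m : nat).
Variables (M : riemannian_manifold R n) (N : riemannian_manifold R (n + m)).
Variables (f : M -> N) (k : R).
Hypothesis N_space_form : constant_curvature N k.
Hypothesis f_immersion : isometric_immersion f.
Variables (i : mindex M) (a : mindex N).
Local Notation V := 'rV[R]_n.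

Definition overlap : set V := mchart i @` (mdom i `&` f @^-1` mdom a).
Local Notation U := overlap.
Local Notation W := (mchart a @` mdom a).
Local Notation F := (coord_map f i a).
Local Notation G := (metric i).
Local Notation Gt := (metric a).

Lemma overlap_sub : U `<=` mchart i @` mdom i.
Proof. by move=> _ [p [pi _] <-]; exists p. Qed.

Lemma overlap_open : open U.
Proof.
rewrite openE => _ [p [pi pa] <-]; rewrite /interior.
have ix : (mchart i @` mdom i) (mchart i p) by exists p.
have n1 : nbhs (mchart i p) (mchart i @` mdom i) by apply: open_nbhs_nbhs; split; [exact: m_open_img|].
have n2 : nbhs (mchart i p) ((f \o minv i) @^-1` mdom a).
  have c1 : {for mchart i p, continuous (minv i)} := m_inv_continuous ix.
  have c2 : {for minv i (mchart i p), continuous f} by case: f_immersion => cf _ _; exact: cf.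
  apply: (continuous_comp c1 c2); apply: open_nbhs_nbhs; split; first exact: m_open_dom.
  by rewrite /= m_chartK.
apply: filterS (filterI n1 n2) => _ [[q qi <-]]; rewrite /= m_chartK// => fq.
by exists q.
Qed.

Lemma overlap_img x : U x -> W (F x).
Proof. by move=> [p [pi pa] <-]; rewrite /coord_map /= m_chartK//; exists (f p). Qed.

Lemma metric_smoothn (j : mindex M) l : smoothn l (mchart j @` mdom j) (metric j).
Proof. by have /smooth_onP := @metric_smooth _ _ M j; exact. Qed.

Lemma overlap_smooth l : smoothn l U G.
Proof. exact: smoothn_sub overlap_sub (@metric_smoothn i l). Qed.

Let sGt l : smoothn l W Gt.
Proof. by have /smooth_onP := @metric_smooth _ _ N a; exact. Qed.

Let sF l : smoothn l U F.
Proof. by case: f_immersion => _ /(_ i a)/smooth_onP h _; exact: h. Qed.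

Lemma overlap_posdef x : U x -> posdef (G x).
Proof. by move=> /overlap_sub Ux; split; [exact: (@Defs.metric_sym _ _ M i x Ux)|exact: (@Defs.metric_pos _ _ M i x Ux)]. Qed.

Let pGt y : W y -> posdef (Gt y).
Proof. by move=> Wy; split; [exact: (@Defs.metric_sym _ _ N a y Wy)|exact: (@Defs.metric_pos _ _ N a y Wy)]. Qed.

Let iso x u v : U x -> bform (G x) u v = bform (Gt (F x)) ('D_u F x) ('D_v F x).
Proof. by case: f_immersion => _ _ h Ux; exact: h. Qed.

Let oW : open W. Proof. exact: m_open_img. Qed.

Local Notation h x u v := (second_form f i a x u v).

Lemma second_formE x u v : U x -> h x u v = sff F G Gt x u v.
Proof.
move=> Ux; rewrite /second_form /sff /cov.
have e1 : christoffel Gt (F x) ('D_u F x) ('D_v F x) = 'D_v F x *m pull F Gt x u.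
  exact: (christoffel_gam sGt _ _ (overlap_img Ux)).
have e2 : nabla G (cst u) (cst v) x = v *m gam G x u.
  by rewrite /nabla deriv_cst add0r; exact: (christoffel_gam overlap_smooth _ _ Ux).
by rewrite e1 e2.
Qed.

Lemma second_form_sym x u v : U x -> h x u v = h x v u.
Proof.
move=> Ux; rewrite (second_formE u v Ux) (second_formE v u Ux).
exact: (sff_sym overlap_open oW overlap_img sF overlap_smooth overlap_posdef sGt pGt u v Ux).
Qed.

Lemma second_form_normal x u v w : U x -> bform (Gt (F x)) (h x u v) ('D_w F x) = 0.
Proof.
move=> Ux; rewrite (second_formE u v Ux).
exact: (sff_normal overlap_open oW overlap_img sF overlap_smooth overlap_posdef sGt pGt iso u v w Ux).
Qed.

Let dF x : U x -> differentiable F x.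
Proof. by move=> Ux; exact: smoothn_diff (@sF 0%N) Ux. Qed.

Lemma second_form_linear x b u u' v : U x ->
  h x (b *: u + u') v = b *: h x u v + h x u' v.
Proof.
move=> Ux; rewrite !(second_formE _ _ Ux) /sff /cov /pull.
have [_ sv] := (smoothnS _ _ _).1 (@sF 1%N).
have dv : differentiable ('D_v F) x := smoothn_diff (sv v) Ux.
rewrite (derive_linear_dir b u u' dv) (derive_linear_dir b u u' (dF Ux)).
rewrite (gamP oW sGt pGt _ _ _ (overlap_img Ux)) (gamP overlap_open overlap_smooth overlap_posdef _ _ _ Ux).
have sA p q (c : R) (X : 'rV[R]_p) (A : 'M[R]_(p, q)) : X *m (c *: A) = c *: (X *m A).
  by rewrite scalemxAr.
rewrite !mulmxDr !sA (derive_linear_dir b _ _ (dF Ux)).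
have aux (X1 X2 P1 P2 Q1 Q2 : 'rV[R]_(n + m)) :
    b *: X1 + X2 + (b *: P1 + P2) - (b *: Q1 + Q2) = b *: (X1 + P1 - Q1) + (X2 + P2 - Q2).
  by apply/rowP => j; rewrite !mxE; ring.
exact: (aux _ _ _ _ _ _).
Qed.

Theorem gauss_space_form x u v w z : U x -> bform (G x) (w *m curv G x u v) z =
  k * (bform (G x) v w * bform (G x) u z - bform (G x) u w * bform (G x) v z)
  + bform (Gt (F x)) (h x v w) (h x u z) - bform (Gt (F x)) (h x u w) (h x v z).
Proof.
have aux (A B C D E : R) : A = C -> A = B - D + E -> B = C + D - E by lra.
move=> Ux; have := gauss overlap_open oW overlap_img sF overlap_smooth overlap_posdef sGt pGt iso u v w z Ux.
have [q qa qF] := overlap_img Ux.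
have sec u' v' : row_free (col_mx u' v') -> sectional Gt (F x) u' v' = k.
  by rewrite -qF; exact: N_space_form.
have e := sectional_full oW sGt pGt (overlap_img Ux) sec ('D_u F x) ('D_v F x) ('D_w F x) ('D_z F x).
rewrite (second_formE v w Ux) (second_formE u z Ux) (second_formE u w Ux) (second_formE v z Ux).
rewrite (iso v w Ux) (iso u z Ux) (iso u w Ux) (iso v z Ux).
exact: (aux _ _ _ _ _ e).
Qed.

Lemma Rop_overlap x u v w : U x -> Rop G x u v w = w *m curv G x u v.
Proof. exact: (Rop_curv overlap_open overlap_smooth overlap_posdef). Qed.

Lemma derivF x u : U x -> 'D_u F x = u *m \matrix_j 'D_(delta_mx ord0 j) F x.
Proof.
move=> Ux; rewrite mulmx_sum_row {1}(row_sum_delta u).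
have D0 : 'D_0 F x = 0.
  by have := derive_linear_dir (-1) 0 0 (dF Ux); rewrite scaler0 addr0 scaleN1r addNr.
elim: (index_enum _) => [|j r IH]; first by rewrite !big_nil.
by rewrite !big_cons (derive_linear_dir _ _ _ (dF Ux)) IH rowK.
Qed.

End Immersion.

Lemma half_sum (R : realFieldType) n (T : 'I_n -> 'I_n -> R) :
  (forall j l, T j l = T l j) -> (forall j, T j j = 0) ->
  \sum_(j < n) \sum_(l < n | (j < l)%N) T j l = 2^-1 * \sum_j \sum_l T j l.
Proof.
move=> TC T0.
have e : \sum_(j < n) \sum_(l < n | ~~ (j < l)%N) T j l = \sum_(j < n) \sum_(l < n | (j < l)%N) T j l.
  transitivity (\sum_(j < n) \sum_(l < n) if (l < j)%N then T j l else 0).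
    apply: eq_bigr => j _; rewrite big_mkcond; apply: eq_bigr => l _.
    rewrite -leqNgt leq_eqVlt; case: eqP => //= /val_inj ->.
    by rewrite ltnn T0.
  rewrite exchange_big; apply: eq_bigr => j _; rewrite [RHS]big_mkcond; apply: eq_bigr => l _.
  by rewrite TC.
have -> : \sum_j \sum_l T j l =
    \sum_(j < n) \sum_(l < n | (j < l)%N) T j l + \sum_(j < n) \sum_(l < n | ~~ (j < l)%N) T j l.
  by rewrite -big_split; apply: eq_bigr => j _; rewrite (bigID (fun l : 'I_n => (j < l)%N)).
by rewrite e; lra.
Qed.

Lemma coord_mulmxT (R : realType) p q (A : 'M[R]_p) (B : 'M[R]_(q, p)) (u : 'rV[R]_p) j :
  (u *m A *m B^T) ord0 j = bform A u (delta_mx ord0 j *m B).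
Proof. by rewrite /bform trmx_mul mulmxA trmx_delta -colE [RHS]mxE. Qed.

(** * The second fundamental form in a normal frame *)

Section SecondFundamental.
Variables (R : realType) (n m : nat) (G : 'M[R]_n) (gt : 'M[R]_(n + m)) (J : 'M[R]_(n, n + m)).
Local Notation V := 'rV[R]_n.
Variable h : V -> V -> 'rV[R]_(n + m).
Hypothesis pG : posdef G.
Hypothesis pgt : posdef gt.
Hypothesis GJ : J *m gt *m J^T = G.
Hypothesis hL : forall b u u' v, h (b *: u + u') v = b *: h u v + h u' v.
Hypothesis hS : forall u v, h u v = h v u.
Hypothesis hN : forall u v w, bform gt (h u v) (w *m J) = 0.

Definition form_mx (xi : 'rV[R]_(n + m)) : 'M[R]_n :=
  \matrix_(j, l) bform gt xi (h (delta_mx ord0 j) (delta_mx ord0 l)).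

Lemma form_mxT xi : (form_mx xi)^T = form_mx xi.
Proof. by apply/matrixP => j l; rewrite !mxE hS. Qed.

Lemma form_mxE xi u v : bform (form_mx xi) u v = bform gt xi (h u v).
Proof.
rewrite bform_sumE.
rewrite (@linear_coord _ _ (fun u => bform gt xi (h u v))); last first.
  by move=> b u1 u2; rewrite hL bformDr bformZr.
apply: eq_bigr => j _.
rewrite (@linear_coord _ _ (fun v => bform gt xi (h (delta_mx ord0 j) v))); last first.
  by move=> b u1 u2; rewrite !(hS (delta_mx _ _)) hL bformDr bformZr.
by rewrite mulr_sumr; apply: eq_bigr => l _; rewrite !mxE mulrA.
Qed.

Variables (P : 'M[R]_n) (X : 'M[R]_(m, n + m)).
Hypothesis PG : P *m G *m P^T = 1%:M.
Hypothesis XJ : X *m gt *m J^T = 0.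
Hypothesis XX : X *m gt *m X^T = 1%:M.

Definition normal_mx ga := form_mx (row ga X).

(** The rows of P J and X together form an orthonormal basis of the ambient space, and values of h
    have no components along the first n. *)
Lemma normal_expand u v w z :
  bform gt (h u v) (h w z) = \sum_ga bform (normal_mx ga) u v * bform (normal_mx ga) w z.
Proof.
have gtT := pgt.1.
pose F := col_mx (P *m J) X.
have JX : J *m gt *m X^T = 0.
  by apply: trmx_inj; rewrite trmx0 !trmx_mul trmxK gtT mulmxA.
have FF : F *m gt *m F^T = 1%:M.
  have b1 : P *m J *m gt *m (P *m J)^T = 1%:M.
    by rewrite trmx_mul !mulmxA -(mulmxA P J gt) -(mulmxA P (J *m gt)) GJ.
  have b2 : P *m J *m gt *m X^T = 0 by rewrite -(mulmxA P J gt) -mulmxA JX mulmx0.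
  have b3 : X *m gt *m (P *m J)^T = 0 by rewrite trmx_mul mulmxA XJ mul0mx.
  rewrite /F tr_col_mx mul_col_mx mul_col_row b1 b2 b3 XX.
  by rewrite -scalar_mx_block.
have [e1 e2 _] := frame_inv FF.
have -> : gt = (gt *m F^T) *m 1%:M *m (gt *m F^T)^T.
  by rewrite mulmx1 trmx_mul trmxK gtT !mulmxA e1 mul1mx.
have FX t ga : (t *m (gt *m F^T)) ord0 (rshift n ga) = bform gt (row ga X) t.
  rewrite (bformC _ _ gtT) mulmxA tr_col_mx mul_mx_row row_mxEr.
  by rewrite coord_mulmxT rowE.
have FJ u' v' j : (h u' v' *m (gt *m F^T)) ord0 (lshift m j) = 0.
  rewrite mulmxA tr_col_mx mul_mx_row row_mxEl trmx_mul mulmxA.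
  have -> : h u' v' *m gt *m J^T = 0.
    by apply/rowP => l; rewrite coord_mulmxT hN mxE.
  by rewrite mul0mx mxE.
rewrite -bform_congr bform1E big_split_ord /= big1 ?add0r => [|j _].
  apply: eq_bigr => ga _; rewrite !form_mxE.
  by rewrite !FX.
by rewrite FJ mul0r.
Qed.

End SecondFundamental.

Section WintgenAlgebra.
Variables (R : realType) (n m : nat) (P : 'M[R]_n) (H : 'I_m -> 'M[R]_n).
Hypothesis n2 : (2 <= n)%N.
Local Notation A := (frame_mx P H).
Local Notation B := (traceless P H).
Let N : R := n%:R.

Let N0 : N != 0. Proof. by rewrite pnatr_eq0; case: n n2. Qed.
Let N1 : N - 1 != 0. Proof. by rewrite subr_eq0 pnatr_eq1; case: n n2 => [|[]]. Qed.

Lemma fro_traceless ga : fro (B ga) (B ga) = fro (A ga) (A ga) - (\tr (A ga)) ^+ 2 / N.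
Proof.
set l := mean_coef P H ga; have lE : \tr (A ga) = l * N by rewrite /l /mean_coef divfK.
have -> : fro (B ga) (B ga) = fro (A ga) (A ga) - 2 * l * \tr (A ga) + l ^+ 2 * N.
  have -> : \tr (A ga) = fro (A ga) 1%:M by rewrite fro_tr trmx1 mulmx1.
  have -> : N = fro (1%:M : 'M[R]_n) 1%:M by rewrite fro_tr trmx1 mulmx1 mxtrace1.
  rewrite /fro !mulr_sumr -sumrB -big_split; apply: eq_bigr => i _ /=.
  rewrite !mulr_sumr -sumrB -big_split; apply: eq_bigr => j _ /=.
  rewrite /traceless -/l !mxE; case: (i == j); rewrite /= ?mulr1n ?mulr0n; ring.
by rewrite lE; field.
Qed.

Lemma brk_traceless ga de : brk (B ga) (B de) = brk (A ga) (A de).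
Proof.
rewrite /brk /traceless !(mulmxBl, mulmxBr) !mul_scalar_mx !mul_mx_scalar.
move: (A ga *m A de) (A de *m A ga) (A ga) (A de) => X Y Z T.
by apply/matrixP => i j; rewrite !mxE; case: (i == j); rewrite /= ?mulr1n ?mulr0n; ring.
Qed.

(** Commutators do not see the trace parts, and |B|^2 = |A|^2 - (tr A)^2 / N absorbs the mean
    curvature term. The constant k cancels, leaving the sum of the |B|^2 equal to the square
    root. *)
Lemma wintgen_traceless k :
  k + (\sum_ga ((\tr (A ga)) ^+ 2 - fro (A ga) (A ga))) / (N * (N - 1)) =
  \sum_ga (\tr (A ga) / N) ^+ 2
  - Num.sqrt (\sum_ga \sum_de fro (brk (A ga) (A de)) (brk (A ga) (A de))) / (N * (N - 1)) + k ->
  (\sum_ga fro (B ga) (B ga)) ^+ 2 = \sum_ga \sum_de fro (brk (B ga) (B de)) (brk (B ga) (B de)).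
Proof.
have S0 : 0 <= \sum_ga \sum_de fro (brk (A ga) (A de)) (brk (A ga) (A de)).
  by apply: sumr_ge0 => ga _; apply: sumr_ge0 => de _; exact: fro_ge0.
have -> : \sum_ga \sum_de fro (brk (B ga) (B de)) (brk (B ga) (B de)) =
    \sum_ga \sum_de fro (brk (A ga) (A de)) (brk (A ga) (A de)).
  by apply: eq_bigr => ga _; apply: eq_bigr => de _; rewrite brk_traceless.
move=> e; rewrite -(sqr_sqrtr S0); congr (_ ^+ 2); move: e.
move: (Num.sqrt _) => s.
have -> : \sum_ga fro (B ga) (B ga) =
    \sum_ga fro (A ga) (A ga) - (\sum_ga (\tr (A ga)) ^+ 2) / N.
  by rewrite mulr_suml -sumrB; apply: eq_bigr => ga _; rewrite fro_traceless.
have -> : \sum_ga (\tr (A ga) / N) ^+ 2 = (\sum_ga (\tr (A ga)) ^+ 2) / N ^+ 2.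
  by rewrite mulr_suml; apply: eq_bigr => ga _; rewrite expr_div_n.
rewrite sumrB; move: (\sum_ga _) (\sum_ga _) => t q e.
have : (k + (t - q) / (N * (N - 1))) * (N * (N - 1)) = (t / N ^+ 2 - s / (N * (N - 1)) + k) * (N * (N - 1)).
  by rewrite e.
have -> : (k + (t - q) / (N * (N - 1))) * (N * (N - 1)) = k * (N * (N - 1)) + (t - q).
  by field; rewrite N0 N1.
have -> : (t / N ^+ 2 - s / (N * (N - 1)) + k) * (N * (N - 1)) = t - t / N - s + k * (N * (N - 1)).
  by field; rewrite N0 N1.
lra.
Qed.

End WintgenAlgebra.

Lemma congr_entry (R : realType) p q (A : 'M[R]_p) (B : 'M[R]_(q, p)) j l :
  (B *m A *m B^T) j l = bform A (row j B) (row l B).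
Proof. by rewrite -bform_delta -bform_congr -!rowE. Qed.

(** The hypotheses say that s and t have the inner products of the multiples c and d of one vector
    of squared length L. *)
Lemma bform_sub0 (R : realType) p (A : 'M[R]_p) (s t : 'rV[R]_p) (c d L : R) :
  bform A s s = L * (c * c) -> bform A s t = L * (c * d) -> bform A t s = L * (d * c) ->
  bform A t t = L * (d * d) -> d = 1 -> bform A (s - c *: t) (s - c *: t) = 0.
Proof.
by rewrite bformBl !bformBr !bformZl !bformZr => -> -> -> -> ->; ring.
Qed.

(** * Wintgen equality and dependence at a point *)

Section Pointwise.
Variables (R : realType) (n m : nat).
Variables (M : riemannian_manifold R n) (N : riemannian_manifold R (n + m)).
Variables (f : M -> N) (k : R).
Hypothesis n4 : (4 <= n)%N.
Hypothesis N_space_form : constant_curvature N k.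
Hypothesis f_immersion : isometric_immersion f.
Variables (i : mindex M) (a : mindex N) (x : 'rV[R]_n).
Hypothesis Ux : overlap f i a x.
Local Notation V := 'rV[R]_n.
Local Notation F := (coord_map f i a).
Local Notation G := (metric i x).
Local Notation gt := (metric a (F x)).
Local Notation h := (second_form f i a x).

Definition jacobian : 'M[R]_(n, n + m) := \matrix_j 'D_(delta_mx ord0 j) F x.
Local Notation J := jacobian.

Lemma derivF_jacobian u : 'D_u F x = u *m J.
Proof. exact: derivF. Qed.

Lemma metric_posdef : posdef G.
Proof. exact: overlap_posdef Ux. Qed.

Lemma ambient_posdef : posdef gt.
Proof.
have U' := overlap_img Ux.
by split; [exact: (@Defs.metric_sym _ _ N a _ U')|exact: (@Defs.metric_pos _ _ N a _ U')].
Qed.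

Lemma jacobian_isometric : J *m gt *m J^T = G.
Proof.
apply: bform_eq => u v; rewrite -bform_congr -!derivF_jacobian.
by case: f_immersion => _ _ iso; rewrite (iso i a x Ux).
Qed.

Lemma second_form_jacobian u v w : bform gt (h u v) (w *m J) = 0.
Proof. by rewrite -derivF_jacobian; exact: (second_form_normal f_immersion). Qed.

Lemma tangent_frame_mx E : tangent_frame i x E <->
  (\matrix_j E j) *m G *m (\matrix_j E j)^T = 1%:M.
Proof.
have e j l : ((\matrix_j E j) *m G *m (\matrix_j E j)^T) j l = bform G (E j) (E l).
  by rewrite congr_entry !rowK.
split=> [tE|tE j l]; last by rewrite -e tE mxE.
by apply/matrixP => j l; rewrite e tE mxE.
Qed.

Lemma normal_frame_mx xi : normal_frame f i a x xi <->
  (\matrix_ga xi ga) *m gt *m J^T = 0 /\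
  (\matrix_ga xi ga) *m gt *m (\matrix_ga xi ga)^T = 1%:M.
Proof.
have e j l : ((\matrix_ga xi ga) *m gt *m (\matrix_ga xi ga)^T) j l = bform gt (xi j) (xi l).
  by rewrite congr_entry !rowK.
have e' j l : ((\matrix_ga xi ga) *m gt *m J^T) j l = bform gt (xi j) ('D_(delta_mx ord0 l) F x).
  rewrite derivF_jacobian -coord_mulmxT -[in RHS](rowK xi j) -!row_mul.
  by rewrite [RHS]mxE.
split=> [[n1 n2]|[n1 n2]]; split.
- by apply/matrixP => j l; rewrite e' n1 mxE.
- by apply/matrixP => j l; rewrite e n2 mxE.
- move=> al u; rewrite derivF_jacobian (bformC _ _ ambient_posdef.1).
  have -> : u *m J = \sum_j u ord0 j *: 'D_(delta_mx ord0 j) F x.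
    by rewrite mulmx_sum_row; apply: eq_bigr => j _; rewrite rowK.
  rewrite bform_suml big1// => j _; rewrite bformZl (bformC _ _ ambient_posdef.1).
  by rewrite -e' n1 mxE mulr0.
- by move=> al be; rewrite -e n2 mxE.
Qed.

Lemma ex_tangent_frame : exists E, tangent_frame i x E.
Proof.
have [P PP] := posdef_frame metric_posdef.
exists (fun j => row j P); apply/tangent_frame_mx.
by rewrite (_ : \matrix_j row j P = P)//; apply/row_matrixP => j; rewrite rowK.
Qed.

Lemma ex_normal_frame : exists xi, normal_frame f i a x xi.
Proof.
have [P PP] := posdef_frame metric_posdef.
have TT : (P *m J) *m gt *m (P *m J)^T = 1%:M.
  by rewrite trmx_mul !mulmxA -(mulmxA P J) -(mulmxA P (J *m gt)) jacobian_isometric.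
have [X [XT XX]] := normal_complement ambient_posdef TT.
exists (fun ga => row ga X); apply/normal_frame_mx.
have -> : \matrix_ga row ga X = X by apply/row_matrixP => j; rewrite rowK.
split=> //; move: XT; rewrite trmx_mul mulmxA => /(congr1 (mulmx^~ (P *m G))).
have [e1 _ _] := frame_inv PP.
have e2 : P^T *m (P *m G) = 1%:M by have [_ + _] := frame_inv PP; rewrite mulmxA.
by rewrite -mulmxA e2 mulmx1 mul0mx.
Qed.

Section Frame.
Variables (E : 'I_n -> V) (xi : 'I_m -> 'rV[R]_(n + m)).
Hypothesis tE : tangent_frame i x E.
Hypothesis nxi : normal_frame f i a x xi.
Let P : 'M[R]_n := \matrix_j E j.
Let X : 'M[R]_(m, n + m) := \matrix_ga xi ga.
Local Notation H := (normal_mx gt h X).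
Local Notation A := (frame_mx P H).

Let hL b u u' v : h (b *: u + u') v = b *: h u v + h u' v.
Proof. exact: (second_form_linear f_immersion). Qed.

Let hS u v : h u v = h v u.
Proof. exact: (second_form_sym f_immersion). Qed.

Let PG : P *m G *m P^T = 1%:M. Proof. exact/tangent_frame_mx. Qed.
Let XJ : X *m gt *m J^T = 0. Proof. by case/normal_frame_mx: nxi. Qed.
Let XX : X *m gt *m X^T = 1%:M. Proof. by case/normal_frame_mx: nxi. Qed.

Lemma normal_inner u v w z :
  bform gt (h u v) (h w z) = \sum_ga bform (H ga) u v * bform (H ga) w z.
Proof.
exact: (normal_expand ambient_posdef jacobian_isometric hL hS second_form_jacobian PG XJ XX).
Qed.

Lemma gauss_frame u v w z : bform G (w *m curv (metric i) x u v) z =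
  k * (bform G v w * bform G u z - bform G u w * bform G v z) +
  \sum_ga (bform (H ga) v w * bform (H ga) u z - bform (H ga) u w * bform (H ga) v z).
Proof.
have aux (b c d : R) (p q : 'I_m -> R) : c = \sum_ga p ga -> d = \sum_ga q ga ->
    b + c - d = b + \sum_ga (p ga - q ga) by move=> -> ->; rewrite -addrA -sumrB.
exact: (etrans (gauss_space_form N_space_form f_immersion u v w z Ux)
  (aux _ _ _ _ _ (normal_inner v w u z) (normal_inner u w v z))).
Qed.

Lemma frame_mxE ga j l : A ga j l = bform (H ga) (E j) (E l).
Proof. by rewrite /frame_mx congr_entry (rowK E j) (rowK E l). Qed.

Let AT ga : (A ga)^T = A ga.
Proof. by rewrite /frame_mx !trmx_mul trmxK form_mxT// mulmxA. Qed.

Lemma rho_frame : rho i x E =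
  k + (\sum_ga ((\tr (A ga)) ^+ 2 - fro (A ga) (A ga))) / (n%:R * (n%:R - 1)).
Proof.
have N0 : n%:R != 0 :> R by rewrite pnatr_eq0; case: n n4.
have N1 : n%:R - 1 != 0 :> R by rewrite subr_eq0 pnatr_eq1; case: n n4 => [|[]].
pose T j l := k * (1 - (j == l)%:R) + \sum_ga (A ga l l * A ga j j - A ga j l * A ga l j).
rewrite /rho; have -> : \sum_(j < n) \sum_(l < n | (j < l)%N) Rtensor (metric i) x (E j) (E l) (E l) (E j) =
    \sum_(j < n) \sum_(l < n | (j < l)%N) T j l.
  apply: eq_bigr => j _; apply: eq_bigr => l jl.
  rewrite /Rtensor (Rop_overlap f_immersion _ _ _ Ux).
  rewrite gauss_frame !tE /T eqxx; congr (_ * _ + _).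
    have jl0 : (j == l) = false by rewrite -val_eqE /= ltn_eqF.
    by rewrite (eq_sym l j) jl0 ?eqxx /= !mulr1 mulr0.
  by apply: eq_bigr => ga _; rewrite !frame_mxE.
rewrite half_sum; first last.
- move=> j; rewrite /T eqxx subrr mulr0 add0r big1// => ga _; exact: subrr.
- move=> j l; rewrite /T eq_sym; congr (_ + _); apply: eq_bigr => ga _; ring.
have -> : \sum_j \sum_l T j l = k * (n%:R * (n%:R - 1)) +
    \sum_ga ((\tr (A ga)) ^+ 2 - fro (A ga) (A ga)).
  have -> : k * (n%:R * (n%:R - 1)) = \sum_(j < n) \sum_(l < n) k * (1 - (j == l)%:R).
    transitivity (\sum_(j < n) k * (n%:R - 1)).
      by rewrite sumr_const card_ord -mulr_natr; ring.
    apply: eq_bigr => j _; rewrite -mulr_sumr sumrB sumr_const card_ord (bigD1 j)//= eqxx.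
    by rewrite big1 ?addr0// => l lj; rewrite eq_sym (negPf lj).
  have -> : \sum_ga ((\tr (A ga)) ^+ 2 - fro (A ga) (A ga)) =
      \sum_(j < n) \sum_(l < n) \sum_ga (A ga l l * A ga j j - A ga j l * A ga l j).
    rewrite [RHS](eq_bigr (fun j => \sum_ga \sum_l (A ga l l * A ga j j - A ga j l * A ga l j))); last first.
      by move=> j _; rewrite exchange_big.
    rewrite exchange_big; apply: eq_bigr => ga _; rewrite expr2 /mxtrace mulr_sumr -sumrB.
    apply: eq_bigr => j _; rewrite mulr_suml -sumrB; apply: eq_bigr => l _.
    by congr (_ - _ * _); rewrite -[in LHS]AT mxE.
  by rewrite -big_split; apply: eq_bigr => j _; rewrite -big_split.
by field; rewrite N0 N1.
Qed.

Lemma mean_curvature_frame : mean_curvature f i a x E ^+ 2 = \sum_ga (\tr (A ga) / n%:R) ^+ 2.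
Proof.
have -> : mean_curvature f i a x E ^+ 2 = bform gt (mean_vector f i a x E) (mean_vector f i a x E).
  rewrite sqr_sqrtr//; have [->|v0] := eqVneq (mean_vector f i a x E) 0; first by rewrite bform0l.
  by apply: ltW; have [_ pos] := ambient_posdef; exact: pos.
have e : bform gt (\sum_j h (E j) (E j)) (\sum_j h (E j) (E j)) = \sum_ga (\tr (A ga)) ^+ 2.
  transitivity (\sum_j \sum_ga \sum_l A ga j j * A ga l l).
    rewrite bform_suml; apply: eq_bigr => j _; rewrite bform_sumr exchange_big.
    apply: eq_bigr => l _; rewrite normal_inner; apply: eq_bigr => ga _.
    by rewrite !frame_mxE.
  rewrite exchange_big; apply: eq_bigr => ga _; rewrite expr2 /mxtrace mulr_suml.
  by apply: eq_bigr => j _; rewrite mulr_sumr.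
rewrite /mean_vector bformZl bformZr e mulrA mulr_sumr; apply: eq_bigr => ga _.
by ring.
Qed.

(** Matrices act on row vectors from the right, which reverses compositions; hence the order of al
    and be. *)
Lemma Rperp_frame al be j l :
  Rperp f i a x (E j) (E l) (xi al) (xi be) = brk (A be) (A al) j l.
Proof.
have [_ _ e3] := frame_inv PG.
have shE ga : Defs.shape f i a x (xi ga) = H ga *m (P^T *m P).
  by rewrite /Defs.shape e3; congr (_ *m _); rewrite /normal_mx (rowK xi ga).
have rE j' : E j' = delta_mx ord0 j' *m P by rewrite -rowE rowK.
rewrite /Rperp !shE bformBl /brk mxE [X in _ = _ + X]mxE.
have key ga de : bform G (E j *m (H ga *m (P^T *m P)) *m (H de *m (P^T *m P))) (E l) =
    (A ga *m A de) j l.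
  have -> : E j *m (H ga *m (P^T *m P)) *m (H de *m (P^T *m P)) =
      delta_mx ord0 j *m (A ga *m A de) *m P by rewrite (rE j) /frame_mx !mulmxA.
  by rewrite (rE l) bform_congr PG bform_mull mulmx1 bform_delta.
by rewrite !key.
Qed.

Lemma rho_perp_frame : rho_perp f i a x E xi =
  Num.sqrt (\sum_ga \sum_de fro (brk (A ga) (A de)) (brk (A ga) (A de))) / (n%:R * (n%:R - 1)).
Proof.
pose T j l al be := brk (A be) (A al) j l ^+ 2.
have brkC C D j l : brk C D j l = - brk D C j l :> R by rewrite /brk -opprB mxE.
have brkT al be j l : brk (A be) (A al) j l = - brk (A be) (A al) l j.
  rewrite -brkC /brk -[in RHS](AT al) -[in RHS](AT be) -!trmx_mul -linearB /=.
  by rewrite [RHS]mxE.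
rewrite /rho_perp.
have -> : \sum_(j < n) \sum_(l < n | (j < l)%N) \sum_(al < m) \sum_(be < m | (al < be)%N)
      Rperp f i a x (E j) (E l) (xi al) (xi be) ^+ 2 =
    (* Each ordered double sum is half of the full one. The resulting factor 1/4 leaves the root as
       1/2 and cancels the 2 in [rho_perp]. *)
    2^-1 ^+ 2 * \sum_ga \sum_de fro (brk (A ga) (A de)) (brk (A ga) (A de)).
  have T0 j l al : T j l al al = 0 by rewrite /T /brk subrr mxE expr0n.
  have T1 j al be : T j j al be = 0.
    have e := brkT al be j j; have e0 : brk (A be) (A al) j j = 0 by lra.
    by rewrite /T e0 expr0n.
  have T2 j l al be : T j l al be = T j l be al by rewrite /T brkC sqrrN.
  have T3 j l al be : T j l al be = T l j al be by rewrite /T brkT sqrrN.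
  transitivity (\sum_(j < n) \sum_(l < n | (j < l)%N) 2^-1 * \sum_al \sum_be T j l al be).
    apply: eq_bigr => j _; apply: eq_bigr => l _.
    rewrite -half_sum => [|al be|al]; [|exact: T2|exact: T0].
    apply: eq_bigr => al _; apply: eq_bigr => be _; by rewrite Rperp_frame.
  rewrite half_sum; first last.
  - by move=> j; rewrite big1 ?mulr0// => al _; rewrite big1.
  - by move=> j l; congr (_ * _); apply: eq_bigr => al _; apply: eq_bigr => be _.
  under eq_bigr => j _ do rewrite -mulr_sumr.
  rewrite -mulr_sumr mulrA expr2; congr (_ * _).
  rewrite /fro /T.
  transitivity (\sum_j \sum_al \sum_l \sum_be T j l al be).
    by apply: eq_bigr => j _; rewrite exchange_big.
  rewrite exchange_big.
  transitivity (\sum_al \sum_j \sum_be \sum_l T j l al be).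
    by apply: eq_bigr => al _; apply: eq_bigr => j _; rewrite exchange_big.
  apply: eq_bigr => al _; rewrite exchange_big; apply: eq_bigr => be _.
  apply: eq_bigr => j _; apply: eq_bigr => l _.
  by rewrite T2 /T expr2.
rewrite sqrtrM ?sqr_ge0// sqrtr_sqr ger0_norm ?invr_ge0//.
by field; rewrite ?pnatr_eq0 ?subr_eq0 ?pnatr_eq1; case: n n4 => [|[]].
Qed.

Lemma wintgen_frame :
  rho i x E = mean_curvature f i a x E ^+ 2 - rho_perp f i a x E xi + k ->
  (\sum_ga fro (traceless P H ga) (traceless P H ga)) ^+ 2 =
  \sum_ga \sum_de fro (brk (traceless P H ga) (traceless P H de)) (brk (traceless P H ga) (traceless P H de)).
Proof.
move=> e; apply: (@wintgen_traceless _ _ _ _ _ (ltnW (ltnW n4)) k).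
by rewrite -rho_frame e mean_curvature_frame rho_perp_frame.
Qed.

Lemma dependent_umbilical :
  rho i x E = mean_curvature f i a x E ^+ 2 - rho_perp f i a x E xi + k ->
  lin_dep
    (fun x1 x2 x3 x4 u v =>
       derivation (Rop (metric i) x) (Ctensor (metric i) x) x1 x2 x3 x4 u v
       - derivation (Cop (metric i) x) (Rtensor (metric i) x) x1 x2 x3 x4 u v)
    (Qtensor G (Ctensor (metric i) x)) ->
  forall u v, h u v = bform G u v *: mean_vector f i a x E.
Proof.
move=> /wintgen_frame wE dep u v.
have HT ga : (H ga)^T = H ga by rewrite form_mxT.
have := umbilical_or_normal_form n4 metric_posdef.1 PG HT gauss_frame wE.
case=> [um|[e [c [p [q [s [s0 [eE NF]]]]]]]]; last first.
  case: (@normal_form_independent R n (metric i) x n4 metric_posdef e c p q s s0 eE _ dep).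
  by move=> u' v' w z; rewrite (Rop_overlap f_immersion _ _ _ Ux); exact: NF.
have n0 : (0 < n)%N by apply: leq_trans n4.
pose h0 := h (E (Ordinal n0)) (E (Ordinal n0)).
have E00 : bform G (E (Ordinal n0)) (E (Ordinal n0)) = 1 by rewrite tE eqxx.
(* All inner products of values of h are now a constant times products of values of G, so h u v -
   G(u, v) h0 has length zero; [h0] is then the mean curvature vector. *)
have hE u' v' : h u' v' = bform G u' v' *: h0.
  apply/eqP; rewrite -subr_eq0; apply/negPn/negP => w0.
  have [_ /(_ _ w0)] := ambient_posdef.
  have lam u1 v1 u2 v2 : bform gt (h u1 v1) (h u2 v2) =
      (\sum_ga mean_coef P H ga ^+ 2) * (bform G u1 v1 * bform G u2 v2).
    rewrite normal_inner mulr_suml; apply: eq_bigr => ga _.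
    by rewrite um !bformZm; ring.
  apply/negP; rewrite -leNgt.
  have l1 := lam u' v' u' v'; have l2 := lam u' v' (E (Ordinal n0)) (E (Ordinal n0)).
  have l3 := lam (E (Ordinal n0)) (E (Ordinal n0)) u' v'.
  have l4 := lam (E (Ordinal n0)) (E (Ordinal n0)) (E (Ordinal n0)) (E (Ordinal n0)).
  have l0 : bform gt (h u' v' - bform G u' v' *: h0) (h u' v' - bform G u' v' *: h0) = 0.
    exact: (bform_sub0 l1 l2 l3 l4 E00).
  by rewrite l0.
rewrite (hE u v); congr (_ *: _); rewrite /mean_vector.
under eq_bigr => j _ do rewrite hE tE eqxx scale1r.
by rewrite sumr_const card_ord -[h0 *+ _]scaler_nat scalerA mulVf ?scale1r// pnatr_eq0 -lt0n.
Qed.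

End Frame.
End Pointwise.

Section ConstantCurvaturePoint.
Variables (R : realType) (n : nat) (Gf : 'rV[R]_n -> 'M[R]_n) (x : 'rV[R]_n) (c : R).
Local Notation V := 'rV[R]_n.
Local Notation G := (Gf x).
Local Notation g := (bform G).
Hypothesis n4 : (4 <= n)%N.
Hypothesis pG : posdef G.
Hypothesis RE : forall u v w, Rop Gf x u v w = c *: (g w v *: u - g w u *: v).
Let N : R := n%:R.
Let n1 : N - 1 != 0. Proof. by rewrite /N subr_eq0 pnatr_eq1; case: n n4 => [|[]]. Qed.
Let n2 : N - 2 != 0. Proof. by rewrite /N subr_eq0 eqr_nat; case: n n4 => [|[|[]]]. Qed.

Lemma ricci_mx_constant : ricci_mx Gf x = (c * (N - 1))%:M.
Proof.
have -> : ricci_mx Gf x = (c * (N - 1)) *: G *m invmx G.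
  congr (_ *m _); apply/matrixP => i j; rewrite mxE [RHS]mxE.
  pose X : 'M[R]_n := c *: ((g (delta_mx ord0 j) (delta_mx ord0 i))%:M
    - G *m ((delta_mx ord0 j : V)^T *m (delta_mx ord0 i : V))).
  rewrite /ricci (@tr_lin1_mx R n _ X); last first.
    move=> z; rewrite RE /X -scalemxAr mulmxBr mul_mx_scalar mul_outer.
    by rewrite (bformC (delta_mx ord0 j) z pG.1).
  rewrite /X.
  rewrite linearZ linearB /= mxtrace_scalar tr_outer (bformC (delta_mx _ j) _ pG.1) bform_delta.
  by rewrite -mulr_natr -/N; ring.
by rewrite -scalemxAl mulmxV ?posdef_unit// scalemx1.
Qed.

Lemma Cop_constant u v w : Cop Gf x u v w = 0.
Proof.
rewrite /Cop /wedge_op /kappa ricci_mx_constant !mul_mx_scalar mxtrace_scalar RE !bformZl.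
rewrite -mulr_natr -/N (bformC w v pG.1) (bformC w u pG.1).
by apply/rowP => i; rewrite !mxE; field; rewrite n1 n2.
Qed.

Lemma dependent_constant : lin_dep
    (fun x1 x2 x3 x4 u v =>
       derivation (Rop Gf x) (Ctensor Gf x) x1 x2 x3 x4 u v
       - derivation (Cop Gf x) (Rtensor Gf x) x1 x2 x3 x4 u v)
    (Qtensor G (Ctensor Gf x)).
Proof.
(* With C = 0 both R.C and C.R vanish, so the coefficients (1, 0) serve. *)
exists 1, 0; split; first by case=> /eqP; rewrite oner_eq0.
have C0 u v w z : Ctensor Gf x u v w z = 0 by rewrite /Ctensor Cop_constant bform0l.
have R0 : [/\ forall v w z, Rtensor Gf x 0 v w z = 0, forall u w z, Rtensor Gf x u 0 w z = 0,
    forall u v z, Rtensor Gf x u v 0 z = 0 & forall u v w, Rtensor Gf x u v w 0 = 0].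
  split=> *; rewrite /Rtensor ?bform0r// RE !(bform0l, bform0r, scaler0, scale0r, subr0, sub0r, oppr0) //.
have [r1 r2 r3 r4] := R0.
move=> x1 x2 x3 x4 u v; rewrite mul0r addr0 mul1r /derivation !C0 !Cop_constant r1 r2 r3 r4.
by rewrite !addr0 subrr.
Qed.

End ConstantCurvaturePoint.

Section Umbilical.
Variables (R : realType) (n m : nat).
Variables (M : riemannian_manifold R n) (N : riemannian_manifold R (n + m)).
Variables (f : M -> N) (k : R).
Hypothesis n4 : (4 <= n)%N.
Hypothesis N_space_form : constant_curvature N k.
Hypothesis f_immersion : isometric_immersion f.
Hypothesis umb : totally_umbilical f.

(** For h = g H the Gauss equation has constant-curvature form at the point, with c = k + |H|^2. *)
Lemma umbilical_curv i a x : overlap f i a x ->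
  exists c, forall u v, curv (metric i) x u v = c *: wedge (metric i x) u v.
Proof.
move=> Ux; have [E tE] := ex_tangent_frame Ux.
exists (k + bform (metric a (coord_map f i a x)) (mean_vector f i a x E) (mean_vector f i a x E)) => u v.
have hE u' v' : second_form f i a x u' v' = bform (metric i x) u' v' *: mean_vector f i a x E.
  by case: Ux tE => p [pi pa] <- tE; exact: umb.
have sA (b : R) (A : 'M[R]_n) w : w *m (b *: A) = b *: (w *m A) by rewrite -scalemxAr.
apply/row_matrixP => j; rewrite !rowE; apply: (bform_injl (overlap_posdef Ux)) => z.
rewrite sA mul_wedge bformZl bformBl !bformZl.
rewrite (gauss_space_form N_space_form f_immersion u v (delta_mx ord0 j) z Ux) !hE !bformZl !bformZr.
have GT := (overlap_posdef Ux).1.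
rewrite (bformC (delta_mx _ _) v GT) (bformC (delta_mx _ _) u GT).
by move: (bform _ _ _) (bform _ _ _) (bform _ _ _) (bform _ _ _) (bform _ _ _) => *; ring.
Qed.

Lemma umbilical_dependent : RC_CR_QgC_dependent M.
Proof.
move=> i p pi g x; have [a pa] := m_cover (f p).
have Ux : overlap f i a x by exists p.
have [c ce] := umbilical_curv Ux.
apply: (@dependent_constant R n g x c n4 (overlap_posdef Ux)) => u v w.
rewrite (Rop_overlap f_immersion u v w Ux) ce.
by rewrite -scalemxAr mul_wedge.
Qed.

Lemma umbilical_conformally_flat : conformally_flat M.
Proof.
move=> i p pi; have [a pa] := m_cover (f p).
have Ux : overlap f i a (mchart i p) by exists p.
have oU := @overlap_open _ _ _ _ _ f f_immersion i a.
have [c0 [d [d0 dU cE]]] := schur_local oU (@overlap_smooth _ _ _ _ _ f i a) (@overlap_posdef _ _ _ _ _ f i a)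
  (ltnW n4) (fun x Ux => umbilical_curv Ux) Ux.
have [U' [phi [oU' Up U'U sphi flat]]] := @conformally_flat_at R n (ball (mchart i p) d) (metric i) c0
  (ball_open _ _) (fun l => smoothn_sub dU (@overlap_smooth _ _ _ _ _ f i a l))
  (fun x xb => overlap_posdef (dU x xb)) cE (mchart i p) (ballxx _ d0).
exists U', phi; split=> //.
by move=> y /U'U /dU; exact: overlap_sub.
Qed.

End Umbilical.

Theorem theorem12 (R : realType) (n m : nat)
    (M : riemannian_manifold R n) (N : riemannian_manifold R (n + m))
    (f : M -> N) (k : R)
    (n_ge4 : (4 <= n)%N) (m_ge1 : (1 <= m)%N)
    (N_space_form : constant_curvature N k)
    (f_immersion : isometric_immersion f)
    (M_wintgen : wintgen_ideal f k) :
  (RC_CR_QgC_dependent M <-> totally_umbilical f) /\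
  (totally_umbilical f -> conformally_flat M).
Proof.
split; last exact: (umbilical_conformally_flat n_ge4 N_space_form f_immersion).
split; last exact: (umbilical_dependent n_ge4 N_space_form f_immersion).
move=> dep i a p pi pa x E tE.
have Ux : overlap f i a x by exists p.
(* The Wintgen hypothesis speaks of all frames, so a normal frame has to be exhibited before it can
   be used. *)
have [xi nxi] := ex_normal_frame f_immersion Ux.
exact: (dependent_umbilical n_ge4 N_space_form f_immersion Ux tE nxi (M_wintgen i a p pi pa E xi tE nxi) (dep i p pi)).
Qed.
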